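(* Let $X,Y$ be strings of total length $n$, let $d\in\mathbb{Z}_{+}$ be a threshold, $\epsilon\in\mathbb{R}_{+}$ a parameter, and $w\in\mathbb{Z}_{+}$ a width. There is a randomized preprocessing algorithm running in $\tilde{O}\big(\frac{n}{\epsilon^2 d}\big)$ time that builds a data structure which, with high probability (over the preprocessing randomness), correctly answers every query of the following form deterministically (with no further randomness) in $\tilde{O}(dw)$ time: given $x\in[0..|X|]$ and $y\in[0..|Y|]$ with $|x-y|\le w$, return a value $\mathsf{LCE}_{d,\epsilon}(x,y)$.
   Context: For integers $i\le j$, $[i..j]=\{k\in\mathbb{Z}: i\le k\le j\}$ and $[i..j)=\{k\in\mathbb{Z}: i\le k<j\}$. Strings are 0-indexed; $X[i..j)$ denotes $X[i]X[i+1]\cdots X[j-1]$. $\mathtt{HD}$ denotes Hamming distance between equal-length strings. For $x\in[0..|X|]$, $y\in[0..|Y|]$ and real $d\ge 0$, $\mathsf{LCE}_d(x,y)=\max\{\ell\in[0..\min(|X|-x,|Y|-y)] : \mathtt{HD}(X[x..x+\ell),Y[y..y+\ell))\le d\}$, and $\mathsf{LCE}_{d,\epsilon}(x,y)$ denotes any value between $\mathsf{LCE}_d(x,y)$ and $\mathsf{LCE}_{(1+\epsilon)d}(x,y)$ (inclusive). The algorithm has $O(1)$-time random access to characters of $X,Y$. $\tilde{O}(\cdot)$ hides factors polylogarithmic in $n$; ''with high probability'' means with probability at least $1-n^{-c}$ for an arbitrarily large constant $c$.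
   Formalization: The preprocessing time is taken as Õ(1 + n/(ε²d)), and its hidden constant may depend on an upper bound for ε; with a single constant for all ε > 0 the claim fails (d = w = 1, ε = √n would need about √n character reads). *)

(* Defs.v *)
From mathcomp Require Import all_boot all_order all_algebra.
From mathcomp Require Import boolp reals.

Set Implicit Arguments.
Unset Strict Implicit.
Unset Printing Implicit Defensive.

Import Order.TTheory GRing.Theory Num.Theory.

Section Strings.
Variable A : eqType.
Implicit Types X Y u v : seq A.

Definition substring X i j := take (j - i) (drop i X).

Definition HD u v := count (fun p => p.1 != p.2) (zip u v).

(* The maximum is over a nonempty set as soon as [0 <= t]. *)
Definition LCE (R : realType) X Y (t : R) (x y : nat) : nat :=
  \max_(l < (minn (size X - x) (size Y - y)).+1
       | ((HD (substring X x (x + l)) (substring Y y (y + l)))%:R <= t)%R) l.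

Definition is_approx_LCE (R : realType) X Y (d : nat) (eps : R)
    (x y v : nat) : Prop :=
  LCE X Y (d%:R : R)%R x y <= v <= LCE X Y ((1 + eps) * d%:R)%R x y.

End Strings.

(* A word RAM with words of [b] bits, presented as a structured language over  *)
(* registers and a random-access memory.  A program is a closed piece of       *)
(* syntax, so it is fixed before the input and the word size are known.  The   *)
(* strings are reachable only by unit-cost access to single characters, and    *)
(* the real number eps only by unit-cost comparison with a quotient of words:  *)
(* [EpsGe e1 e2] tests whether e1 <= eps * e2.                                 *)

Inductive binop := Add | Sub | Mul | Div | Mod | Eq | Lt.

Inductive expr :=
  | Const of nat
  | Reg of nat
  | LoadMem of expr
  | ReadX of expr
  | ReadY of expr
  | EpsGe of expr & expr
  | Binop of binop & expr & expr.

(* [Rand i] puts a uniformly random word in register [i]. *)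
Inductive cmd :=
  | Skip
  | Assign of nat & expr
  | StoreMem of expr & expr
  | Rand of nat
  | Seq of cmd & cmd
  | If of expr & cmd & cmd
  | While of expr & cmd.

Fixpoint rand_free (p : cmd) : bool :=
  match p with
  | Skip | Assign _ _ | StoreMem _ _ => true
  | Rand _ => false
  | Seq p1 p2 | If _ p1 p2 => rand_free p1 && rand_free p2
  | While _ p1 => rand_free p1
  end.

Fixpoint expr_cost (e : expr) : nat :=
  match e with
  | Const _ | Reg _ => 1
  | LoadMem e1 | ReadX e1 | ReadY e1 => (expr_cost e1).+1
  | EpsGe e1 e2 | Binop _ e1 e2 => (expr_cost e1 + expr_cost e2).+1
  end.

(* [tape] holds the random words not yet consumed; [Rand] is stuck on an empty *)
(* tape, which cannot occur within [T] time units on a tape of [T] words.      *)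
Record state := State {
  regs : nat -> nat;
  memory : nat -> nat;
  tape : seq nat }.

Definition set_reg (s : state) i v :=
  State [eta regs s with i |-> v] (memory s) (tape s).

Definition set_mem (s : state) a v :=
  State (regs s) [eta memory s with a |-> v] (tape s).

Section Semantics.
Variables (R : realType) (b : nat) (X Y : seq nat) (eps : R).

(* Subtraction is truncated at 0; Add and Mul wrap around modulo 2 ^ b. *)
Definition eval_binop (o : binop) (u v : nat) : nat :=
  match o with
  | Add => (u + v) %% 2 ^ b
  | Sub => u - v
  | Mul => (u * v) %% 2 ^ b
  | Div => u %/ v
  | Mod => u %% v
  | Eq => u == v
  | Lt => u < v
  end.

Fixpoint eval (s : state) (e : expr) : nat :=
  match e with
  | Const k => k %% 2 ^ b
  | Reg i => regs s i
  | LoadMem e1 => memory s (eval s e1)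
  | ReadX e1 => nth 0 X (eval s e1)
  | ReadY e1 => nth 0 Y (eval s e1)
  | EpsGe e1 e2 => ((eval s e1)%:R <= eps * (eval s e2)%:R)%R
  | Binop o e1 e2 => eval_binop o (eval s e1) (eval s e2)
  end.

(* [exec p s t s']: started in [s], [p] halts in [s'] after [t] time units. *)
Inductive exec : cmd -> state -> nat -> state -> Prop :=
  | exec_skip s : exec Skip s 1 s
  | exec_assign i e s :
      exec (Assign i e) s (expr_cost e).+1 (set_reg s i (eval s e))
  | exec_store e1 e2 s :
      exec (StoreMem e1 e2) s (expr_cost e1 + expr_cost e2).+1
           (set_mem s (eval s e1) (eval s e2))
  | exec_rand i r m v l :
      exec (Rand i) (State r m (v :: l)) 1 (set_reg (State r m l) i v)
  | exec_seq p1 p2 s t1 s1 t2 s2 :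
      exec p1 s t1 s1 -> exec p2 s1 t2 s2 -> exec (Seq p1 p2) s (t1 + t2) s2
  | exec_if e p1 p2 s t s' :
      exec (if eval s e != 0 then p1 else p2) s t s' ->
      exec (If e p1 p2) s ((expr_cost e).+1 + t) s'
  | exec_while_stop e p s :
      eval s e = 0 -> exec (While e p) s (expr_cost e).+1 s
  | exec_while_loop e p s t1 s1 t2 s2 :
      eval s e != 0 -> exec p s t1 s1 -> exec (While e p) s1 t2 s2 ->
      exec (While e p) s ((expr_cost e).+1 + t1 + t2) s2.

End Semantics.

(* Preprocessing finds |X|, |Y|, d, w in registers 0-3, all other registers and *)
(* the memory being zero.                                                      *)
Definition pre_state (X Y : seq nat) (d w b T : nat)
    (omega : T.-tuple 'I_(2 ^ b)) : state :=
  State (nth 0 [:: size X; size Y; d; w]) (fun=> 0)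
        [seq val v | v <- omega].

(* A query inherits only the memory left by preprocessing, finds x and y in    *)
(* registers 4 and 5, has no random words, and leaves its answer in register 0.*)
Definition query_state (X Y : seq nat) (d w : nat) (ds : nat -> nat)
    (x y : nat) : state :=
  State (nth 0 [:: size X; size Y; d; w; x; y]) ds [::].

Definition input_fits (b : nat) (X Y : seq nat) (d w : nat) : Prop :=
  [/\ size X + size Y < 2 ^ b, d < 2 ^ b, w < 2 ^ b &
      forall a, a \in X ++ Y -> a < 2 ^ b].

Definition logn2 (n : nat) : nat := (trunc_log 2 n).+1.

Local Open Scope ring_scope.

Definition uniform_Pr (R : realType) (Omega : finType) (E : Omega -> Prop) : R :=
  #|[set omega | `[< E omega >]]|%:R / #|Omega|%:R.

Definition answers_all_queries (R : realType) (b : nat) (X Y : seq nat)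
    (d w : nat) (eps : R) (qry : cmd) (tq : R) (ds : nat -> nat) : Prop :=
  forall x y : nat, (x <= size X)%N -> (y <= size Y)%N ->
    `|x%:Z - y%:Z| <= w%:Z ->
    exists (t : nat) (s : state),
      [/\ exec b X Y eps qry (query_state X Y d w ds x y) t s,
          t%:R <= tq &
          is_approx_LCE X Y d eps x y (regs s 0%N)].

(* Main.v *)
Require Import Defs.
From mathcomp Require Import all_boot all_order all_algebra zify ring lra.
From mathcomp Require Import boolp reals sequences exp.

Set Implicit Arguments.
Unset Strict Implicit.
Unset Printing Implicit Defensive.

Import Order.TTheory GRing.Theory Num.Theory.

(** Cut both strings into chunks of length L, about d w polylog n, and consider
    the dyadic intervals of chunks.  For an interval, a shift is flagged when one
    sampled position per chunk shows few mismatches.  Fix a flagged shift sg0 and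
    grow a set T of offsets from a singleton: while, for some flagged shift sg,
    the translate of T by sg - sg0 overlaps little with T (as estimated from K
    random elements of T), replace T by the union.  Since |T| grows geometrically,
    O(log n) rounds suffice.  Then K random elements of T serve as tests, and a
    position is heavy if it disagrees with Y at one of the tested offsets.  Under
    a flagged shift the two ends of a mismatch see translates of T with a large
    overlap, so at least one end is heavy.  Heavy positions are few, since every
    offset in T is a sum of few differences of flagged shifts.  Hence the number
    of mismatches of the interval under any flagged shift can be estimated by
    scanning the heavy ones among the samples, one in each block of length bet,
    which is about eps^2 d / polylog n.

    A query scans naively to a chunk boundary, climbs and then descends the dyadic
    intervals while the accumulated estimate stays below (1 + 1/(2q)) d, where q
    is a power of two of order 1/eps, and finishes with a naive scan over four
    chunks.  Each of the O(log n) intervals contributes an error of at most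
    d / (8 q log n).  When n <= d the answer is the length of the overlap. *)

(** Sampling every shift separately would cost a factor w too much in preprocessing, and the samples
    of a long interval are too many for a query to read. Heavy positions resolve both: heaviness
    does not depend on the shift of the query, so one list serves all flagged shifts, and its length
    is O(L) up to logarithms however long the interval is. The length L is squeezed from two sides.
    A chunk costs about W + L / bet, hence n W / L + n / bet in all, which asks for L at least d W;
    a query scans O(L) characters, which asks for L at most d w up to logarithms. The thresholds
    1/16 and 1/32 belong together: the two ends of a mismatch see translates of T sharing at least
    |T| / 16 elements, a light end disagrees on fewer than |T| / 32, so two light ends would leave a
    common witness that the characters agree. All random words are drawn once and shared by all
    intervals, and a union bound over polynomially many events covers every query. L and bet are
    powers of two, so that a random word reduced modulo them is exactly uniform. *)

(** * Program logic: frame conditions and termination within a time bound *)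

Fixpoint mods (c : cmd) : seq nat :=
  match c with
  | Assign i _ | Rand i => [:: i]
  | Seq c1 c2 | If _ c1 c2 => mods c1 ++ mods c2
  | While _ c1 => mods c1
  | _ => [::]
  end.

Fixpoint store_free (c : cmd) : bool :=
  match c with
  | StoreMem _ _ => false
  | Seq c1 c2 | If _ c1 c2 => store_free c1 && store_free c2
  | While _ c1 => store_free c1
  | _ => true
  end.

Lemma regs_set s i v r : regs (set_reg s i v) r = if r == i then v else regs s r.
Proof. by rewrite /set_reg /=. Qed.
Lemma memory_set_reg s i v : memory (set_reg s i v) = memory s.
Proof. by []. Qed.
Lemma memory_set s a v a' : memory (set_mem s a v) a' = if a' == a then v else memory s a'.
Proof. by rewrite /set_mem /=. Qed.

(** [lim] is evaluated again in every round, so [runs_For] asks that its value survive the body. *)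
Definition For (i : nat) (lim : expr) (body : cmd) : cmd :=
  Seq (Assign i (Const 0))
      (While (Binop Lt (Reg i) lim)
             (Seq body (Assign i (Binop Add (Reg i) (Const 1))))).

Section Machine.
Variables (R : realType) (b : nat) (X Y : seq nat) (eps : R).
Local Notation exec := (exec b X Y eps).
Local Notation eval := (eval b X Y eps).

(** What the syntax alone guarantees about a run. The loop rules supply it in every round, so
    invariants mention only what changes. *)
Definition framed (c : cmd) (s s' : state) : Prop :=
  [/\ forall r, r \notin mods c -> regs s' r = regs s r,
      rand_free c -> tape s' = tape s &
      store_free c -> memory s' = memory s].

Lemma exec_framed c s t s' : exec c s t s' -> framed c s s'.
Proof.
elim=> {c s t s'}.
- by [].
- move=> i e s; split=> // r; rewrite inE /= => /negbTE; by rewrite /= => ->.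
- by move=> e1 e2 s; split.
- move=> i r m v l; split=> // r'; rewrite inE /= => /negbTE; by rewrite /= => ->.
- move=> p1 p2 s t1 s1 t2 s2 _ [f1 f2 f3] _ [g1 g2 g3]; split=> /=.
  + by move=> r; rewrite mem_cat negb_or => /andP[h1 h2]; rewrite g1 // f1.
  + by move=> /andP[h1 h2]; rewrite g2 // f2.
  + by move=> /andP[h1 h2]; rewrite g3 // f3.
- move=> e p1 p2 s t s' _ [f1 f2 f3]; split=> /=.
  + by move=> r; rewrite mem_cat negb_or => /andP[h1 h2]; rewrite f1 //; case: ifP.
  + by move=> /andP[h1 h2]; rewrite f2 //; case: ifP.
  + by move=> /andP[h1 h2]; rewrite f3 //; case: ifP.
- by [].
- move=> e p s t1 s1 t2 s2 _ _ [f1 f2 f3] _ [g1 g2 g3]; split=> /=.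
  + by move=> r h; rewrite g1 // f1.
  + by move=> h; rewrite g2 // f2.
  + by move=> h; rewrite g3 // f3.
Qed.

Definition runs (c : cmd) (s : state) (t : nat) (Q : state -> Prop) : Prop :=
  exists t' s', [/\ exec c s t' s', t' <= t & Q s'].

Lemma runs_weaken c s t t' (Q Q' : state -> Prop) :
  runs c s t Q -> t <= t' ->
  (forall s', framed c s s' -> Q s' -> Q' s') -> runs c s t' Q'.
Proof.
move=> [u [s' [e le q]]] tt' QQ'; exists u, s'; split=> //.
  exact: leq_trans le tt'.
by apply: QQ' => //; exact: exec_framed e.
Qed.

Lemma runs_le c s t t' Q : runs c s t Q -> t <= t' -> runs c s t' Q.
Proof. by move=> h tt'; apply: runs_weaken h tt' _. Qed.

Lemma runs_skip s (Q : state -> Prop) : Q s -> runs Skip s 1 Q.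
Proof. by move=> q; exists 1, s; split=> //; exact: exec_skip. Qed.

Lemma runs_assign i e s (Q : state -> Prop) :
  Q (set_reg s i (eval s e)) -> runs (Assign i e) s (expr_cost e).+1 Q.
Proof. by move=> q; eexists _, _; split; [exact: exec_assign | |]. Qed.

Lemma runs_store e1 e2 s (Q : state -> Prop) :
  Q (set_mem s (eval s e1) (eval s e2)) ->
  runs (StoreMem e1 e2) s (expr_cost e1 + expr_cost e2).+1 Q.
Proof. by move=> q; eexists _, _; split; [exact: exec_store | |]. Qed.

Lemma runs_rand i s v l (Q : state -> Prop) : tape s = v :: l ->
  Q (set_reg (State (regs s) (memory s) l) i v) -> runs (Rand i) s 1 Q.
Proof.
case: s => r m tp /= -> q; eexists _, _; split; [exact: exec_rand | |] => //.
Qed.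

Lemma runs_seq c1 c2 s t1 t2 Q :
  runs c1 s t1 (fun s1 => runs c2 s1 t2 Q) -> runs (Seq c1 c2) s (t1 + t2) Q.
Proof.
move=> [u1 [s1 [e1 l1 [u2 [s2 [e2 l2 q]]]]]]; exists (u1 + u2), s2; split=> //.
  exact: exec_seq e1 e2.
exact: leq_add.
Qed.

Lemma runs_seqw c1 c2 s t1 t2 Q1 Q :
  runs c1 s t1 Q1 -> (forall s1, framed c1 s s1 -> Q1 s1 -> runs c2 s1 t2 Q) ->
  runs (Seq c1 c2) s (t1 + t2) Q.
Proof. by move=> h1 h2; apply: runs_seq; apply: runs_weaken h1 _ h2. Qed.

Lemma runs_if e c1 c2 s t Q :
  (eval s e != 0 -> runs c1 s t Q) -> (eval s e = 0 -> runs c2 s t Q) ->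
  runs (If e c1 c2) s ((expr_cost e).+1 + t) Q.
Proof.
move=> h1 h2.
have [u [s' [ex le q]]] : runs (if eval s e != 0 then c1 else c2) s t Q.
  by case: eqP => [/h2|/eqP/h1].
exists ((expr_cost e).+1 + u), s'; split=> //; first exact: exec_if.
by rewrite leq_add2l.
Qed.

(** [N] only bounds the number of rounds: the guard may fail earlier, provided that [Inv N] holds by
    then. The scan of a query uses this early exit. *)
Lemma runs_while e c s N tb (Inv : nat -> state -> Prop) :
  Inv 0 s ->
  (forall k s', k < N -> Inv k s' -> framed c s s' ->
     eval s' e = 0 /\ Inv N s' \/ eval s' e != 0 /\ runs c s' tb (Inv k.+1)) ->
  (forall s', Inv N s' -> framed c s s' -> eval s' e = 0) ->
  runs (While e c) s (N * ((expr_cost e).+1 + tb) + (expr_cost e).+1) (Inv N).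
Proof.
move=> I0 step stop.
have main m k s' : k + m = N -> Inv k s' -> framed c s s' ->
    runs (While e c) s' (m * ((expr_cost e).+1 + tb) + (expr_cost e).+1) (Inv N).
  elim: m k s' => [|m IH] k s' km I fr.
    have kN : k = N by lia.
    exists (expr_cost e).+1, s'; split=> //; last by rewrite -kN.
    by apply: exec_while_stop; apply: stop => //; rewrite -kN.
  have kN : k < N by lia.
  have [[e0 IN]|[e1 [u [s1 [ex le I1]]]]] := step k s' kN I fr.
    exists (expr_cost e).+1, s'; split=> //; last by lia.
    exact: exec_while_stop.
  have [|||u2 [s2 [ex2 le2 I2]]] := IH k.+1 s1; [lia | by [] | | ].
    have [g1 g2 g3] := exec_framed ex; have [f1 f2 f3] := fr; split.
    - by move=> r h; rewrite g1 // f1.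
    - by move=> h; rewrite g2 // f2.
    - by move=> h; rewrite g3 // f3.
  exists ((expr_cost e).+1 + u + u2), s2; split=> //; last by lia.
  exact: exec_while_loop ex ex2.
by apply: (main N 0 s) => //; split.
Qed.

(** The body is checked against [Inv k.+1] with the counter already advanced, since the increment
    follows it. [N < 2 ^ b] keeps the increment from wrapping around. *)
Lemma runs_For i lim c s N tb (Inv : nat -> state -> Prop) :
  i \notin mods c -> N < 2 ^ b -> 1 < 2 ^ b ->
  Inv 0 (set_reg s i 0) ->
  (forall s', (forall r, r \notin i :: mods c -> regs s' r = regs s r) ->
     (store_free c -> memory s' = memory s) -> eval s' lim = N) ->
  (forall k s', k < N -> regs s' i = k ->
     (forall r, r \notin i :: mods c -> regs s' r = regs s r) ->
     (rand_free c -> tape s' = tape s) ->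
     (store_free c -> memory s' = memory s) ->
     Inv k s' -> runs c s' tb (fun s2 => Inv k.+1 (set_reg s2 i k.+1))) ->
  runs (For i lim c) s (N * (tb + expr_cost lim + 7) + expr_cost lim + 5) (Inv N).
Proof.
move=> ic NB B1 I0 limN step.
pose body := Seq c (Assign i (Binop Add (Reg i) (Const 1))).
pose s0 := set_reg s i 0.
have fr0 s' : framed body s0 s' ->
    [/\ forall r, r \notin i :: mods c -> regs s' r = regs s r,
        rand_free c -> tape s' = tape s & store_free c -> memory s' = memory s].
  move=> [f1 f2 f3]; split.
  - move=> r h; rewrite f1; last first.
      by move: h; rewrite /= mem_cat !inE negb_or orbC negb_or.
    by move: h; rewrite inE negb_or regs_set => /andP[/negbTE -> _].
  - by move=> h; rewrite f2 //= h.
  - by move=> h; rewrite f3 //= h.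
have H : runs (While (Binop Lt (Reg i) lim) body) s0
   (N * ((expr_cost (Binop Lt (Reg i) lim)).+1 + (tb + 4)) +
     (expr_cost (Binop Lt (Reg i) lim)).+1) (fun s' => regs s' i = N /\ Inv N s').
  pose J k s' := regs s' i = k /\ Inv k s'.
  apply: (@runs_while _ _ s0 N (tb + 4) J).
  - by split=> //; rewrite regs_set eqxx.
  - move=> k s' kN [ik Ik] /fr0[f1 f2 f3]; right; split.
      by rewrite /= ik limN // kN.
    apply: runs_seqw (step k s' kN ik f1 f2 f3 Ik) _ => s1 [g1 _ _] I1.
    apply: runs_assign; rewrite /= g1 // ik (modn_small B1) modn_small ?addn1; last lia.
    by split=> //; rewrite regs_set eqxx.
  - by move=> s' [iN _] /fr0[f1 f2 f3]; rewrite /= limN // iN ltnn.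
apply: runs_le.
  apply: runs_seq; apply: runs_assign => /=; rewrite mod0n.
  by apply: runs_weaken H (leqnn _) _ => s' _ [].
move=> /=; nia.
Qed.

End Machine.

Section MachineDerived.
Variables (R : realType) (b : nat) (X Y : seq nat) (eps : R).
Local Notation runs := (runs b X Y eps).
Local Notation eval := (eval b X Y eps).

Lemma runs_set i e s v c2 t Q : eval s e = v -> runs c2 (set_reg s i v) t Q ->
  runs (Seq (Assign i e) c2) s ((expr_cost e).+1 + t) Q.
Proof. by move=> <- h; apply: runs_seq; apply: runs_assign. Qed.

Lemma runs_set1 i e s v (Q : state -> Prop) : eval s e = v -> Q (set_reg s i v) ->
  runs (Assign i e) s (expr_cost e).+1 Q.
Proof. by move=> <- h; apply: runs_assign. Qed.

Lemma runs_put e1 e2 s a v c2 t Q : eval s e1 = a -> eval s e2 = v ->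
  runs c2 (set_mem s a v) t Q ->
  runs (Seq (StoreMem e1 e2) c2) s ((expr_cost e1 + expr_cost e2).+1 + t) Q.
Proof. by move=> <- <- h; apply: runs_seq; apply: runs_store. Qed.

Lemma runs_put1 e1 e2 s a v (Q : state -> Prop) : eval s e1 = a -> eval s e2 = v ->
  Q (set_mem s a v) ->
  runs (StoreMem e1 e2) s (expr_cost e1 + expr_cost e2).+1 Q.
Proof. by move=> <- <- h; apply: runs_store. Qed.

(** Charging the sum of both branches instead of the maximum loses only constant factors. *)
Lemma runs_ifb e c1 c2 s (v : bool) t1 t2 Q : eval s e = v ->
  (v -> runs c1 s t1 Q) -> (~~ v -> runs c2 s t2 Q) ->
  runs (If e c1 c2) s ((expr_cost e).+1 + (t1 + t2)) Q.
Proof.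
move=> ev h1 h2; apply: runs_if; rewrite ev; case: v ev h1 h2 => // _ h1 h2 _.
  by apply: runs_le (h1 isT) _; lia.
by apply: runs_le (h2 isT) _; lia.
Qed.

End MachineDerived.

(** * Random words: expectations and tail bounds *)

Section RandomWords.
Section ModCount.
Variable Q : pred nat.

Lemma count_iota_shift (P : pred nat) a m :
  count P (iota a m) = count (fun i => P (a + i)) (iota 0 m).
Proof. by rewrite -(addn0 a) iotaDl count_map addn0. Qed.

Lemma count_modn_mul a m :
  count (fun v => Q (v %% m)) (iota 0 (a * m)) = a * count Q (iota 0 m).
Proof.
elim: a => [|a IH]; first by rewrite mul0n.
rewrite mulSn addnC iotaD count_cat IH add0n mulSn addnC; congr (_ + _).
rewrite count_iota_shift; apply: eq_in_count => i.
by rewrite mem_iota add0n => im; rewrite modnMDl modn_small.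
Qed.

(** A uniform word below [B] reduced modulo [m] is biased unless [m] divides [B]; still, every
    residue has [B %/ m] or [(B %/ m).+1] preimages. *)
Lemma count_modn_ge B m : B %/ m * count Q (iota 0 m) <=
  count (fun v => Q (v %% m)) (iota 0 B).
Proof.
by rewrite -count_modn_mul {2}(divn_eq B m) iotaD count_cat leq_addr.
Qed.

Lemma count_modn_le B m : 0 < m -> count (fun v => Q (v %% m)) (iota 0 B) <=
  (B %/ m).+1 * count Q (iota 0 m).
Proof.
move=> m0; rewrite -count_modn_mul.
have -> : (B %/ m).+1 * m = B + (m - B %% m).
  by rewrite mulSn {2}(divn_eq B m); have := ltn_pmod B m0; lia.
by rewrite iotaD count_cat leq_addr.
Qed.

End ModCount.

Local Open Scope ring_scope.

Section Prob.
Variables (R : realType) (B : nat).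
Hypothesis B0 : (0 < B)%N.

(** Expectation over [m] independent uniform words, averaged one word at a time, so that
    conditioning on a prefix is just [Ew_cat]. *)
Fixpoint Ew (m : nat) (F : seq nat -> R) : R :=
  if m is m'.+1 then (\sum_(v < B) Ew m' (fun l => F (val v :: l))) / B%:R
  else F [::].

Definition Pw m (E : seq nat -> bool) : R := Ew m (fun l => (E l)%:R).

Let Bpos : (0 : R) < B%:R. Proof. by rewrite ltr0n. Qed.

Lemma Ew_le m F G :
  (forall l, size l = m -> all (fun v => (v < B)%N) l -> F l <= G l) ->
  Ew m F <= Ew m G.
Proof.
elim: m F G => [|m IH] F G FG /=; first exact: FG.
rewrite ler_pM2r ?invr_gt0 //; apply: ler_sum => v _; apply: IH => l sl al.
by apply: FG => /=; rewrite ?sl // ltn_ord.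
Qed.

Lemma Ew_const m c : Ew m (fun=> c) = c.
Proof.
elim: m => [|m IH] //=; under eq_bigr do rewrite IH.
by rewrite sumr_const card_ord -[c *+ B]mulr_natr mulfK // gt_eqF.
Qed.

Lemma Ew_sum m (I : Type) (r : seq I) (F : I -> seq nat -> R) :
  Ew m (fun l => \sum_(i <- r) F i l) = \sum_(i <- r) Ew m (F i).
Proof.
elim: m F => [|m IH] F //=; under eq_bigr do rewrite IH.
by rewrite exchange_big /= mulr_suml.
Qed.

Lemma Ew_scale m c F : Ew m (fun l => c * F l) = c * Ew m F.
Proof.
elim: m F => [|m IH] F //=; under eq_bigr do rewrite IH.
by rewrite -mulr_sumr mulrA.
Qed.

Lemma Ew_cat m1 m2 F :
  Ew (m1 + m2) F = Ew m1 (fun l1 => Ew m2 (fun l2 => F (l1 ++ l2))).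
Proof.
elim: m1 F => [|m1 IH] F //=; congr (_ / _); apply: eq_bigr => v _.
by rewrite IH.
Qed.

Lemma Ew_prod m (g : nat -> nat -> R) :
  Ew m (fun l => \prod_(i < m) g i (nth 0%N l i)) =
  \prod_(i < m) ((\sum_(v < B) g i v) / B%:R).
Proof.
elim: m g => [|m IH] g /=; first by rewrite !big_ord0.
under eq_bigr => v _.
  under [X in Ew m X]funext => l do rewrite big_ord_recl /=.
  rewrite Ew_scale (IH (fun i => g i.+1)).
  over.
by rewrite -mulr_suml mulrAC big_ord_recl.
Qed.

Lemma Pw_le m (E E' : seq nat -> bool) :
  (forall l, size l = m -> all (fun v => (v < B)%N) l -> E l -> E' l) ->
  Pw m E <= Pw m E'.
Proof.
move=> EE'; apply: Ew_le => l sl al; rewrite ler_nat.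
by case El : (E l) => //; rewrite (EE' l).
Qed.

Lemma Pw_has m (I : eqType) (r : seq I) (E : I -> seq nat -> bool) p :
  (forall i, i \in r -> Pw m (E i) <= p) ->
  Pw m (fun l => has (fun i => E i l) r) <= (size r)%:R * p.
Proof.
move=> Ep; apply: (@le_trans _ _ (\sum_(i <- r) Pw m (E i))).
  rewrite -Ew_sum; apply: Ew_le => l _ _.
  elim: r {Ep} => [|i r IH] /=; first by rewrite big_nil.
  rewrite big_cons; case: (E i l) => /=; last by rewrite add0r.
  by rewrite lerDl sumr_ge0.
elim: r Ep => [|i r IH] Ep /=; first by rewrite big_nil mul0r.
rewrite big_cons -natr1 mulrDl mul1r addrC lerD ?Ep ?mem_head //.
by apply: IH => j jr; apply: Ep; rewrite inE jr orbT.
Qed.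

Lemma Pw_or m (E1 E2 : seq nat -> bool) : Pw m (fun l => E1 l || E2 l) <= Pw m E1 + Pw m E2.
Proof.
have := @Ew_sum m bool [:: true; false] (fun c l => ((if c then E1 l else E2 l))%:R).
rewrite !big_cons big_nil addr0 /Pw => <-; apply: Ew_le => l _ _.
by rewrite !big_cons big_nil; case: (E1 l); case: (E2 l) => //=; lra.
Qed.

(** Conditioning: the words [l1] are revealed, the event is controlled by the fresh block [l2], and
    [l3] has no influence. *)
Lemma Pw_group m1 m2 m3 (E : seq nat -> bool) (E' : seq nat -> seq nat -> bool) p :
  (forall l1 l2 l3, size l1 = m1 -> size l2 = m2 ->
     E (l1 ++ (l2 ++ l3)) -> E' l1 l2) ->
  (forall l1, size l1 = m1 -> Pw m2 (E' l1) <= p) ->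
  Pw (m1 + (m2 + m3)) E <= p.
Proof.
move=> EE' Ep; rewrite /Pw Ew_cat -[leRHS](Ew_const m1); apply: Ew_le => l1 s1 _.
apply: le_trans (Ep _ s1); rewrite Ew_cat; apply: Ew_le => l2 s2 _.
rewrite -[leRHS](Ew_const m3); apply: Ew_le => l3 _ _; rewrite ler_nat.
by case El : (E _) => //; rewrite (EE' _ _ _ s1 s2 El).
Qed.

Definition hits m (P : nat -> nat -> bool) (l : seq nat) : nat :=
  count (fun i => P i (nth 0%N l i)) (iota 0 m).

Definition pr1 (P : pred nat) : R := (count P (iota 0 B))%:R / B%:R.

(** Independence turns the moment into a product, whose factors [1 + (z - 1) p] are at most
    [expR ((z - 1) p)]. *)
Lemma Ew_mgf m P z : 0 <= z ->
  Ew m (fun l => z ^+ hits m P l) <= expR ((z - 1) * \sum_(i < m) pr1 (P i)).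
Proof.
move=> z0.
have -> : Ew m (fun l => z ^+ hits m P l) =
    Ew m (fun l => \prod_(i < m) (if P i (nth 0%N l i) then z else 1)).
  congr Ew; apply: funext => l; rewrite /hits -(big_mkord xpredT (fun i => if P i (nth 0%N l i) then z else 1)).
  rewrite /index_iota subn0 -sum1_count; elim: (iota 0 m) => [|i r IH].
    by rewrite !big_nil expr0.
  by rewrite !big_cons; case: ifP => _; rewrite ?mul1r ?exprD ?expr1 IH.
rewrite (Ew_prod m (fun i v => if P i v then z else 1)) mulr_sumr expR_sum.
apply: ler_prod => i _; apply/andP; split.
  by rewrite divr_ge0 // sumr_ge0 // => v _; case: ifP.
apply: le_trans (expR_ge1Dx _); rewrite /pr1.
have -> : \sum_(v < B) (if P i v then z else 1) =
    B%:R + (z - 1) * (count (P i) (iota 0 B))%:R.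
  rewrite -(big_mkord xpredT (fun v => if P i v then z else 1)) /index_iota subn0.
  rewrite -{2}(size_iota 0 B); elim: (iota 0 B) => [|v r IH].
    by rewrite big_nil /= mulr0 addr0.
  by rewrite big_cons IH /= -natr1 natrD; case: ifP => _ /=; lra.
by rewrite mulrDl divff ?gt_eqF // mulrA.
Qed.

(** Markov's inequality for [z ^ hits]: [z > 1] serves upper tails, [z < 1] lower tails, and [z = 0]
    the event of no hit at all. *)
Lemma Pw_markov m P z (E : seq nat -> bool) a : 0 <= z -> 0 < a ->
  (forall l, E l -> a <= z ^+ hits m P l) ->
  Pw m E <= expR ((z - 1) * \sum_(i < m) pr1 (P i)) / a.
Proof.
move=> z0 a0 Ez; rewrite ler_pdivlMr // mulrC; apply: le_trans (Ew_mgf m P z0).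
rewrite -Ew_scale; apply: Ew_le => l _ _; case El : (E l).
  by rewrite mulr1 Ez.
by rewrite mulr0 exprn_ge0.
Qed.

Lemma expR_le_inv (x : R) : x < 1 -> expR x <= (1 - x)^-1.
Proof.
move=> x1; rewrite -[x]opprK expRN opprK lef_pV2 ?posrE ?expR_gt0 ?subr_gt0 //.
exact: expR_ge1Dx.
Qed.

Lemma expR_le_frac (x c : R) : x < 1 -> 1 <= c * (1 - x) -> expR x <= c.
Proof.
move=> x1 h; apply: le_trans (expR_le_inv x1) _.
by rewrite -[leLHS]mul1r ler_pdivrMr ?subr_gt0.
Qed.

Lemma expRn_ge (k : nat) : (2 : R) ^+ k <= expR k%:R.
Proof.
rewrite -[k%:R]mulr1 expRM_natl lerXn2r ?nnegrE ?expR_ge0 //.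
by apply: le_trans (expR_ge1Dx _); lra.
Qed.

Lemma expRN_le (k : nat) (x : R) : k%:R <= x -> expR (- x) <= 2 ^- k.
Proof.
move=> kx; rewrite expRN lef_pV2 ?posrE ?expR_gt0 ?exprn_gt0 //.
by apply: le_trans (expRn_ge k) _; rewrite ler_expR.
Qed.

Definition mean m (P : nat -> nat -> bool) : R := \sum_(i < m) pr1 (P i).

Lemma pr1_ge0 P : 0 <= pr1 P. Proof. by rewrite divr_ge0. Qed.
Lemma mean_ge0 m P : 0 <= mean m P. Proof. by apply: sumr_ge0 => i _; exact: pr1_ge0. Qed.

(** From [expR x <= 1 / (1 - x)], where [1 - x] is at least 1/2. *)
Lemma expR_quad (x : R) : x <= 1/2 -> expR x - 1 <= x + 2 * x ^+ 2.
Proof.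
move=> x2; have := @expR_le_inv x; rewrite -div1r ler_pdivlMr ?subr_gt0; last lra.
by move=> /(_ ltac:(lra)) h; nra.
Qed.

Lemma tail_up m P (a t : R) (E : seq nat -> bool) : 0 < a -> a <= 1/2 ->
  (forall l, E l -> t <= (hits m P l)%:R) ->
  Pw m E <= expR ((a + 2 * a ^+ 2) * mean m P - a * t).
Proof.
move=> a0 a2 Et; apply: (le_trans (@Pw_markov m P (expR a) _ (expR (a * t)) _ _ _)).
- exact: expR_ge0.
- exact: expR_gt0.
- by move=> l /Et tl; rewrite -expRM_natr ler_expR ler_pM2l.
- rewrite -expRB ler_expR lerD2r ler_wpM2r ?mean_ge0 //.
  exact: expR_quad.
Qed.

Lemma tail_dn m P (a t : R) (E : seq nat -> bool) : 0 < a -> a <= 1/2 ->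
  (forall l, E l -> (hits m P l)%:R <= t) ->
  Pw m E <= expR ((- a + 2 * a ^+ 2) * mean m P + a * t).
Proof.
move=> a0 a2 Et; apply: (le_trans (@Pw_markov m P (expR (- a)) _ (expR (- a * t)) _ _ _)).
- exact: expR_ge0.
- exact: expR_gt0.
- by move=> l /Et tl; rewrite -expRM_natr ler_expR ler_nM2l ?oppr_lt0.
- rewrite -expRB ler_expR mulNr opprK lerD2r ler_wpM2r ?mean_ge0 //.
  by have := @expR_quad (- a); rewrite sqrrN; apply; lra.
Qed.

(** With [z = 4] the bound is [expR (3/4) / 4 ^ t], and [2 <= t] absorbs [expR (3/4) <= 4] into a
    factor [2 ^ t]. *)
Lemma tail_few m P (t : nat) : mean m P <= 1/4 -> (2 <= t)%N ->
  Pw m (fun l => (t <= hits m P l)%N) <= 2 ^- t.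
Proof.
move=> mu4 t2; apply: (le_trans (@Pw_markov m P 4 _ (4 ^+ t) _ _ _)) => //.
- by rewrite exprn_gt0.
- by move=> l tl; rewrite ler_weXn2l //; lra.
- rewrite ler_pdivrMr ?exprn_gt0 //.
  have -> : (2 : R) ^- t * 4 ^+ t = 2 ^+ t.
    have -> : (4 : R) = 2 * 2 by rewrite -natrM.
    by rewrite exprMn mulKf ?expf_neq0 ?pnatr_eq0.
  apply: (@le_trans _ _ (expR (3/4))).
    rewrite ler_expR; move: mu4; rewrite /mean; set x := (\sum_(_ < _) _); lra.
  apply: (@le_trans _ _ (2 ^+ 2)); first by apply: expR_le_frac; lra.
  by rewrite ler_weXn2l //; lra.
Qed.

(** With [z = 1/2] the bound is [2 ^ t * expR (- mean / 2)], and the mean is at least [4 t]. *)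
Lemma tail_many m P (t : nat) : 4 * t%:R <= mean m P ->
  Pw m (fun l => (hits m P l <= t)%N) <= 2 ^- t.
Proof.
move=> mu4; apply: (le_trans (@Pw_markov m P (1/2) _ ((1/2) ^+ t) _ _ _)) => //.
- lra.
- by rewrite exprn_gt0 //; lra.
- by move=> l tl; rewrite ler_wiXn2l //; lra.
- rewrite ler_pdivrMr ?exprn_gt0 //; last lra.
  have -> : (1/2 : R) ^+ t = 2 ^- t by rewrite div1r exprVn.
  have -> : (2 : R) ^- t * 2 ^- t = 2 ^- (t + t).
    by rewrite exprD invfM.
  have -> : (1/2 - 1) * \sum_(i < m) pr1 (P i) = - (mean m P / 2) by rewrite /mean; lra.
  by apply: expRN_le; rewrite natrD; lra.
Qed.

(** With [z = 4], hitting half of the draws gives [z ^ hits >= 2 ^ m], while the moment is at most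
    [(8/5) ^ m] because [expR (3/8) <= 8/5]. *)
Lemma tail_half m P : (forall i, (i < m)%N -> pr1 (P i) <= 1/8) ->
  Pw m (fun l => (m <= 2 * hits m P l)%N) <= (4/5) ^+ m.
Proof.
move=> p8; apply: (le_trans (@Pw_markov m P 4 _ (2 ^+ m) _ _ _)) => //.
- by rewrite exprn_gt0.
- move=> l tl; have -> : (4 : R) = 2 ^+ 2 by lra.
  by rewrite -exprM ler_weXn2l //; lra.
- rewrite ler_pdivrMr ?exprn_gt0 // -exprMn.
  apply: (@le_trans _ _ (expR (3/8 * m%:R))).
    rewrite ler_expR; apply: (@le_trans _ _ (3 * (m%:R * (1/8)))); last by lra.
    have -> : (4 - 1 : R) = 3 by lra.
    rewrite ler_pM2l //.
    apply: (le_trans (ler_sum _ (fun (i : 'I_m) _ => p8 i (ltn_ord i)))).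
    by rewrite sumr_const card_ord mulr_natl.
  rewrite expRM_natr lerXn2r ?nnegrE ?expR_ge0 //; first lra.
  by apply: expR_le_frac; lra.
Qed.

Lemma tail_none m P k : (forall i, (i < m)%N -> 1/64 <= pr1 (P i)) ->
  (64 * k <= m)%N -> Pw m (fun l => hits m P l == 0%N) <= 2 ^- k.
Proof.
move=> p64 km; apply: (le_trans (@Pw_markov m P 0 _ 1 _ _ _)) => //.
- by move=> l /eqP ->; rewrite expr0.
- rewrite divr1 sub0r mulN1r; apply: expRN_le.
  apply: (@le_trans _ _ (m%:R * (1/64))).
    have : ((64 * k)%:R <= m%:R :> R) by rewrite ler_nat.
    by rewrite natrM; lra.
  rewrite mulr_natl -[X in _ *+ X]card_ord -sumr_const; apply: ler_sum => i _.
  exact: p64.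
Qed.

Lemma sum_tuple_Ew T (F : seq nat -> R) :
  (\sum_(om : T.-tuple 'I_B) F [seq val v | v <- om]) / (B ^ T)%:R = Ew T F.
Proof.
elim: T F => [|T IH] F /=.
  rewrite expn0 divr1 (big_pred1 [tuple]) //= => om; by apply/esym/eqP; rewrite [LHS]tuple0 [RHS]tuple0.
rewrite expnS natrM invfM mulrA.
rewrite (reindex (fun p : 'I_B * T.-tuple 'I_B => [tuple of p.1 :: p.2])) /=; last first.
  exists (fun om : T.+1.-tuple 'I_B => (thead om, [tuple of behead om])).
    by move=> [v om] _ /=; congr (_, _); apply: val_inj.
  by move=> om _; rewrite /= [RHS]tuple_eta; apply: val_inj.
rewrite -(pair_bigA _ (fun v om => F (val v :: [seq val u | u <- tval om]))) /=.
rewrite mulr_suml mulr_suml [RHS]mulr_suml; apply: eq_bigr => v _.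
by rewrite -IH mulrAC.
Qed.

(** The event of the theorem is a [Prop] about program runs; it is reached through a boolean bad
    event outside of which it holds. *)
Lemma uniform_PrE T (E : seq nat -> Prop) (Tb : seq nat -> bool) :
  (forall l, size l = T -> all (fun v => (v < B)%N) l -> ~~ Tb l -> E l) ->
  1 - Pw T Tb <= uniform_Pr R (fun omega : T.-tuple 'I_B => E [seq val v | v <- omega]).
Proof.
move=> TE; have -> : uniform_Pr R (fun omega : T.-tuple 'I_B => E [seq val v | v <- omega]) =
    Ew T (fun l => `[< E l >]%:R).
  rewrite -sum_tuple_Ew /uniform_Pr card_tuple card_ord -sum1_card natr_sum.
  rewrite big_mkcond /=; congr (_ / _); apply: eq_bigr => om _.
  by rewrite inE; case: ifP.
rewrite lerBlDr /Pw.
have -> : Ew T (fun l => `[< E l >]%:R) + Ew T (fun l => (Tb l)%:R) =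
  Ew T (fun l => `[< E l >]%:R + (Tb l)%:R).
  have := @Ew_sum T bool [:: true; false] (fun c l => if c then `[< E l >]%:R else (Tb l)%:R).
  rewrite !big_cons big_nil addr0 => <-; congr Ew; apply: funext => l.
  by rewrite !big_cons big_nil addr0.
rewrite -[leLHS](Ew_const T); apply: Ew_le => l sl al; case Tl : (Tb l); first by rewrite lerDr.
by rewrite addr0 (asboolT (TE l sl al _)) // Tl.
Qed.

End Prob.
End RandomWords.

(** * Counting over intervals of integers *)

Lemma count_iota_sub (P : pred nat) a m a' m' : a' <= a -> a + m <= a' + m' ->
  count P (iota a m) <= count P (iota a' m').
Proof.
move=> h1 h2; have -> : m' = (a - a') + (m + (a' + m' - (a + m))) by lia.
rewrite iotaD count_cat iotaD count_cat.
have -> : a' + (a - a') = a by lia.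
by rewrite addnCA leq_addr.
Qed.

(** Since [v <= a + u], the truncated subtraction is a true translation on this window. *)
Lemma count_iota_trans (P : pred nat) a m u v a' m' :
  v <= a + u -> a' + v <= a + u -> a + u + m <= a' + m' + v ->
  count (fun j => P (j + u - v)) (iota a m) <= count P (iota a' m').
Proof.
move=> h1 h2 h3; have -> : count (fun j => P (j + u - v)) (iota a m) =
    count P (iota (a + u - v) m).
  rewrite count_iota_shift [RHS]count_iota_shift; apply: eq_in_count => i _ /=.
  by congr P; lia.
by apply: count_iota_sub; lia.
Qed.

Lemma count_iota_restrict (P : pred nat) a m N : a + m <= N ->
  (forall i, P i -> a <= i < a + m) -> count P (iota 0 N) = count P (iota a m).
Proof.
move=> aN Pa; have -> : N = a + (m + (N - (a + m))) by lia.
rewrite !iotaD !count_cat add0n.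
have z0 a' m' : (forall i, a' <= i < a' + m' -> ~ (a <= i < a + m)) -> count P (iota a' m') = 0.
  move=> h; apply/eqP; rewrite eqn0Ngt -has_count -all_predC; apply/allP => i.
  by rewrite mem_iota /= => /h hi; apply/negP => /Pa.
by rewrite (z0 0 a) ?(z0 (a + m)) ?addn0 // => i; lia.
Qed.

Lemma count_has (T : eqType) (Q : T -> pred nat) (U : seq T) (s : seq nat) B :
  (forall z, z \in U -> count (Q z) s <= B) ->
  count (fun i => has (fun z => Q z i) U) s <= size U * B.
Proof.
elim: U => [|z U IH] h /=; first by rewrite count_pred0.
rewrite mulSn; apply: leq_trans (_ : count (Q z) s + count (fun i => has (fun z => Q z i) U) s <= _).
  rewrite -count_predUI; apply: leq_trans (leq_addr _ _).
  by apply: sub_count => i.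
rewrite leq_add ?h ?mem_head // IH // => z' z'U; apply: h.
by rewrite inE z'U orbT.
Qed.

(* [(1 + 1/a)^k >= 1 + k/a] without fractions. *)
Lemma bernoulli_nat a k : a ^ k * (a + k) <= a * a.+1 ^ k.
Proof. by elim: k => [|k IH]; rewrite ?expn0 ?addn0 ?muln1 ?mul1n // !expnS; nia. Qed.

(** [(1 + 1/a) ^ a >= 2]. With [a = 16] this converts growth by 17/16 per round into doublings. *)
Lemma two_exp_le_expS a k : 0 < a -> 2 ^ k * a ^ (a * k) <= a.+1 ^ (a * k).
Proof.
move=> a0; rewrite !expnM -expnMn; case: k => [|k]; first by rewrite !expn0.
rewrite leq_exp2r //.
rewrite -(leq_pmul2l a0); have := bernoulli_nat a a.
move: (a ^ a) (a.+1 ^ a) => u v; nia.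
Qed.

(** * The combinatorial model: flags, tests, heavy positions, estimates *)

(** [iW] is the bound on [|x - y|] in force (w capped by n), [ilg] a logarithm of n, and [ic1] the
    confidence: an elementary event fails with probability of order [2 ^- (ic1 * ilg)]. *)
Record inst := Inst {
  iX : seq nat; iY : seq nat; idd : nat; iW : nat; ilg : nat;
  iq : nat; ibet : nat; iL : nat; ic1 : nat }.

Section Model.
Variable p : inst.
Local Notation X := (iX p). Local Notation Y := (iY p).
Local Notation d := (idd p). Local Notation W := (iW p).
Local Notation lg := (ilg p). Local Notation q := (iq p).
Local Notation bet := (ibet p). Local Notation L := (iL p).
Local Notation c1 := (ic1 p).

Definition iK := 64 * c1 * lg.
Definition itau := c1 * lg.
(** 224 = 16 * 14: this many rounds of growth by 17/16 multiply the size by at least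
    [2 ^ (14 * lg)], which exceeds the number of offsets. *)
Definition ilam := 224 * lg.
(** Offsets are stored with [iZ] added. A round moves them by at most [2 * W], so they stay
    nonnegative through all [ilam] rounds. *)
Definition iZ := 2 * W * ilam.+1.
Definition iS := 2 * W + 1.
Definition iLB := L %/ bet.
Definition iNc := minn (size X) (size Y) %/ L.
(** With more mismatches than this, the expected number of sampled ones exceeds [4 * itau], and the
    shift is unlikely to be flagged. *)
Definition iH := 4 * itau * L.
(** The random words in the order of their storage: one per chunk, [iK] per round, one per sampling
    block. *)
Definition iM := iNc + (ilam * iK + iNc * iLB).

(** [64 * 128] is the constant of the Chernoff exponent in [dev_exponent]. With [bet = 1] every
    position is sampled and the estimates are exact. *)
Definition wf := [/\ 0 < lg, 0 < W, 0 < d, W < 2 ^ lg & 32 * 64 * lg * d * W <= L] /\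
  [/\ 0 < bet, bet %| L, 0 < q, 1 < c1 &
      bet = 1 \/ 64 * 128 * c1 * q ^ 2 * lg ^ 3 * bet <= d].

Local Notation xs i := (nth 0 X i). Local Notation ys i := (nth 0 Y i).

(** Shifts carry the offset [W] to remain in [nat]: a query aligns [X[i]] with [Y[i + y - x]], which
    is the shift [sg = x + W - y]. *)
Definition mis sg i := xs i != ys (i + W - sg).
(** The margin chunks leave room for displacements by [W] and by offsets up to [iZ <= L / 4], so
    that subtractions do not truncate and indices stay inside the strings. *)
Definition valid k pw := (2 <= k) && (k + pw + 2 <= iNc).

Variable om : nat -> nat.
Definition posA c := c * L + om c %% L.
Definition posD bb := bb * bet + om (iNc + ilam * iK + bb) %% bet.

Section Interval.
Variables k pw : nat.

(** The count has mean [fplus / L]: at most 1/4 if [fplus <= 2 * d], above [4 * itau] beyond [iH].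
    In between, either outcome is acceptable. *)
Definition flag sg := count (fun c => mis sg (posA c)) (iota k.-1 (pw + 2)) < itau.
Definition sg0 := last 0 [seq sg <- iota 0 iS | flag sg].
(** Sampling with replacement. Each round owns [iK] words, which are independent of the [T] of that
    round. *)
Definition draws T l := [seq nth 0 T (om (iNc + l * iK + kk) %% size T) | kk <- iota 0 iK].
Definition cntU T (U : seq nat) sg := count (fun z => z + sg - sg0 \in (T : seq nat)) U.
Definition low T U := [seq sg <- iota 0 iS | flag sg && (2 * cntU T U sg < iK)].
Definition grow T sg := T ++ [seq z <- [seq z + sg - sg0 | z <- T] | z \notin (T : seq nat)].
(** The draws that reveal no [low] shift are kept as the tests; the boolean freezes the state in the
    remaining rounds. *)
Definition tstep l (st : seq nat * seq nat * bool) :=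
  let: (T, U, dn) := st in
  if dn then st else
  let U' := draws T l in
  if low T U' is [::] then (T, U', true) else (grow T (last 0 (low T U')), U', false).
Fixpoint trun l := if l is l'.+1 then tstep l' (trun l') else ([:: iZ], [::], false).
Definition tU := (trun ilam).1.2.

(** Composed with the shift [sg0], an offset becomes a test for [X]; [hvY] compares [Y] with
    itself. *)
Definition hvX U i := has (fun z => xs i != ys (i + W + iZ - sg0 - z)) U.
Definition hvY U j := has (fun z => ys j != ys (j + iZ - z)) U.
Definition listX := [seq i <- [seq posD bb | bb <- iota (k * iLB) (pw * iLB)] | hvX tU i].
(** The partner in [Y] of a position of the interval may lie in a neighbouring chunk, hence one more
    chunk on each side. *)
Definition listY := [seq j <- [seq posD bb | bb <- iota (k.-1 * iLB) ((pw + 2) * iLB)] | hvY tU j].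
Definition inI i := (k * L <= i) && (i < (k + pw) * L).
(** A mismatch whose end in [X] is heavy is counted there; demanding a light end in [X] avoids
    counting it twice. *)
Definition ymis sg j := [&& inI (j + sg - W), mis sg (j + sg - W) & ~~ hvX tU (j + sg - W)].
Definition est sg := bet * (count (mis sg) listX + count (ymis sg) listY).

Definition fplus sg := count (mis sg) (iota (k.-1 * L) ((pw + 2) * L)).
Definition fin sg := count (mis sg) (iota (k * L) (pw * L)).

Definition G1 sg := (((fplus sg <= 2 * d) ==> flag sg) && (flag sg ==> (fplus sg <= iH))).
Definition ovl T sg := count (fun z => z + sg - sg0 \in (T : seq nat)) T.
(** The draws have to tell overlaps below 1/16 from those above 15/16; in between both answers are
    harmless. *)
Definition G2 l sg := let T := (trun l).1.1 in let U := draws T l in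
  if 2 * cntU T U sg < iK then 16 * ovl T sg <= 15 * size T else size T <= 16 * ovl T sg.
Definition badX T i := count (fun z => xs i != ys (i + W + iZ - sg0 - z)) T.
Definition badY T j := count (fun z => ys j != ys (j + iZ - z)) T.
Definition G3 l i := let T := (trun l).1.1 in let U := draws T l in
  (hvX U i || (32 * badX T i < size T)) && (hvY U i || (32 * badY T i < size T)).
Definition mxp sg i := [&& inI i, hvX tU i & mis sg i].
Definition myp sg j := ymis sg j && hvY tU j.
(** Accuracy [d / (16 q lg)] is demanded up to [4 * d] only; a larger set merely must not look
    small, because a query rejects it anyway. *)
Definition dev (M : pred nat) :=
  let N := count M (iota 0 (iNc * L)) in
  let h := count (fun bb => M (posD bb)) (iota 0 (iNc * iLB)) in
  if N <= 4 * d then (16 * q * lg * (bet * h - N) <= d) && (16 * q * lg * (N - bet * h) <= d)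
  else 2 * d <= bet * h.
Definition G4 sg := dev (mxp sg) && dev (myp sg).

Definition good := [/\ forall sg, sg < iS -> G1 sg,
  forall l sg, l < ilam -> sg < iS -> G2 l sg,
  forall l i, l < ilam -> i < iNc * L -> G3 l i &
  forall sg, sg < iS -> G4 sg].

Hypothesis wfp : wf.
Hypothesis val : valid k pw.
Hypothesis gd : good.

Let lg0 : 0 < lg. Proof. by case: wfp => -[]. Qed.
Let W0 : 0 < W. Proof. by case: wfp => -[]. Qed.
Let LW : 32 * 64 * lg * W <= L.
Proof. by case: wfp => -[] _ _ d0 _ LL _; apply: leq_trans LL; nia. Qed.
Let Ld : 8 * d <= L. Proof. by case: wfp => -[] l0 w0 d0 _ LL _; nia. Qed.

Let LZ : 4 * iZ <= L.
Proof. by rewrite /iZ /ilam; apply: leq_trans LW; move: lg0 W0; nia. Qed.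
Let WZ : 2 * W <= iZ. Proof. by rewrite /iZ; nia. Qed.

Lemma sg0_lt : sg0 < iS.
Proof.
rewrite /sg0; set s := filter _ _.
have : last 0 s \in 0 :: s by rewrite mem_last.
by rewrite inE mem_filter mem_iota => /orP[/eqP->|/andP[_]]; rewrite /iS; lia.
Qed.

Lemma trun_inv l : l <= ilam -> let T := (trun l).1.1 in
  [/\ uniq T, 0 < size T & forall z, z \in T -> iZ <= z + 2 * W * l /\ z <= iZ + 2 * W * l].
Proof.
elim: l => [|l IH] ll /=; first by split=> // z; rewrite inE => /eqP->; lia.
have /IH[] : l <= ilam by lia.
case: (trun l) => [[T U] dn] /= u s h.
have h' z : z \in T -> iZ <= z + 2 * W * l.+1 /\ z <= iZ + 2 * W * l.+1.
  by move=> /h; lia.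
case: dn => //=; case E : (low T (draws T l)) => [|sg r] //=; split.
- rewrite /grow cat_uniq u /=; apply/andP; split.
    by apply/hasPn => z; rewrite mem_filter => /andP[].
  rewrite filter_uniq // map_inj_in_uniq // => z1 z2 z1T z2T.
  have sl := sg0_lt; have [a1 _] := h _ z1T; have [a2 _] := h _ z2T.
  have : 2 * W * l + 2 * W <= iZ by rewrite /iZ; nia.
  by rewrite /iS in sl; lia.
- by rewrite /grow size_cat; lia.
- move=> z; rewrite /grow mem_cat => /orP[/h'//|]; rewrite mem_filter.
  move=> /andP[_ /mapP[z' z'T ->]]; have [a1 a2] := h _ z'T.
  have sl := sg0_lt.
  have : last sg r \in low T (draws T l) by rewrite E mem_last.
  rewrite mem_filter mem_iota => /andP[_ sl2].
  have : 2 * W * l + 2 * W <= iZ by rewrite /iZ; nia.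
  by rewrite /iS in sl sl2; lia.
Qed.

Lemma draws_sub T l z : 0 < size T -> z \in draws T l -> z \in T.
Proof. by move=> s /mapP[kk _ ->]; rewrite mem_nth // ltn_pmod. Qed.

Lemma size_draws T l : size (draws T l) = iK.
Proof. by rewrite size_map size_iota. Qed.

Lemma trun_done l : l <= ilam -> (trun l).2 ->
  exists2 l', l' < l & [/\ (trun l).1.1 = (trun l').1.1,
    (trun l).1.2 = draws (trun l').1.1 l' & low (trun l').1.1 (draws (trun l').1.1 l') = [::]].
Proof.
elim: l => [|l IH] //= ll.
case E : (trun l) => [[T U] dn]; case: dn E => E /=.
  move=> _; case: IH => [| |l' l'l h]; [lia|by rewrite E|].
  by exists l'; [lia | rewrite E in h].
case E2 : (low T (draws T l)) => [|sg r] //= _; exists l => //; rewrite E /=.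
by [].
Qed.

(** The union has [2 |T| - ovl] elements, and [ovl] is at most 15/16 of [|T|] for a [low] shift. *)
Lemma trun_grow l : l <= ilam -> ~~ (trun l).2 -> 17 ^ l <= 16 ^ l * size (trun l).1.1.
Proof.
elim: l => [|l IH] //= ll.
have := trun_inv (ltnW ll).
have /IH : l <= ilam by lia.
case: gd => _ /(_ l) g2 _ _; move: g2; rewrite /G2.
case E : (trun l) => [[T U] dn]; case: dn E => E //= g2 /(_ isT) h [uT sT bT].
case E2 : (low T (draws T l)) => [|sg r] //= _.
have sgl : last sg r \in low T (draws T l) by rewrite E2 mem_last.
move: sgl; rewrite mem_filter mem_iota add0n => /andP[/andP[fl cl] sl].
have := g2 _ ll sl; rewrite cl => ov.
have : size (grow T (last sg r)) + ovl T (last sg r) = 2 * size T.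
  rewrite /grow size_cat size_filter count_map /ovl.
  have := count_predC (fun z => z + last sg r - sg0 \in T) T.
  rewrite (_ : count (predC _) T = count (preim (fun z => z + last sg r - sg0) (fun z => z \notin T)) T); first lia.
  by apply: eq_count.
by rewrite !expnS; nia.
Qed.

(** Otherwise [T] would outgrow the [4 * W * ilam + 1] offsets available to it. *)
Lemma trun_lam_done : (trun ilam).2.
Proof.
apply/negPn/negP => nd; have := trun_grow (leqnn _) nd.
have [uT sT bT] := trun_inv (leqnn ilam).
have : size (trun ilam).1.1 <= 4 * W * ilam + 1.
  rewrite -(size_iota (iZ - 2 * W * ilam) (4 * W * ilam + 1)); apply: uniq_leq_size => // z /bT.
  have : 2 * W * ilam <= iZ by rewrite /iZ; nia.
  by rewrite mem_iota; lia.
move=> sz h.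
have := @two_exp_le_expS 16 (14 * lg) isT.
have -> : 16 * (14 * lg) = ilam by rewrite /ilam; lia.
have : 4 * W * ilam + 1 < 2 ^ (14 * lg).
  rewrite [14 * lg]mulnC expnM; have WW : W < 2 ^ lg by case: wfp => -[].
  have lg2 : lg < 2 ^ lg by exact: ltn_expl.
  have e1 : 2 <= 2 ^ lg by rewrite -{1}(expn1 2) leq_exp2l.
  rewrite /ilam; move: (2 ^ lg) WW lg2 e1 => v WW lg2 e1.
  have : v ^ 14 = v * v * v ^ 12 by rewrite -mulnA -!expnS.
  have : 2 ^ 12 <= v ^ 12 by rewrite leq_exp2r.
  have -> : 2 ^ 12 = 64 * 64 by [].
  have WL : W * lg <= v * v by apply: leq_mul; exact: ltnW.
  have v1 : 0 < v * v by rewrite muln_gt0; lia.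
  move: (v ^ 12) (v ^ 14) => a c ha ->.
  apply: leq_trans (_ : v * v * (64 * 64) <= _); last by rewrite leq_mul2l ha orbT.
  by rewrite -mulnA (mulnCA W); lia.
have : 0 < 16 ^ ilam by rewrite expn_gt0.
move: (16 ^ ilam) (17 ^ ilam) (2 ^ (14 * lg)) h => a c e h; nia.
Qed.

Lemma flag_sg0 sg : sg < iS -> flag sg -> flag sg0.
Proof.
move=> sl fl; rewrite /sg0.
have : sg \in [seq sg <- iota 0 iS | flag sg] by rewrite mem_filter fl mem_iota.
case E : [seq _ <- _ | _] => [|a s] // _.
have : last a s \in [seq sg <- iota 0 iS | flag sg] by rewrite E mem_last.
by rewrite mem_filter => /andP[].
Qed.

Lemma flag_fplus sg : sg < iS -> flag sg -> fplus sg <= iH.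
Proof. by move=> sl fl; case: gd => /(_ _ sl)/andP[_]; rewrite fl. Qed.

Let k2 : 2 <= k. Proof. by case/andP: val. Qed.
Let kL : k.-1 * L + L = k * L.
Proof. by case: k k2 => //= k' _; rewrite mulSn addnC. Qed.
Let k1L : L <= k.-1 * L.
Proof. by case: k k2 => [|[|k']] //= _; rewrite mulSn leq_addr. Qed.

Lemma count_or3 (P Q1 Q2 Q3 : pred nat) s :
  (forall i, i \in s -> P i -> [|| Q1 i, Q2 i | Q3 i]) ->
  count P s <= count Q1 s + (count Q2 s + count Q3 s).
Proof.
elim: s => [|i s IH] h //=.
have := IH (fun j js => h j (mem_behead (s := i :: s) js)).
have := h i (mem_head _ _); case: (P i) => /=; last lia.
by move=> /(_ isT); case: (Q1 i); case: (Q2 i); case: (Q3 i) => //=; lia.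
Qed.

(* A self-mismatch of [Y] along [z] is charged to a mismatch of one of the
   generators of [z]. *)
Lemma count_split (P Q1 Q2 : pred nat) s :
  (forall i, i \in s -> (P i : nat) = Q1 i + Q2 i) -> count P s = count Q1 s + count Q2 s.
Proof.
elim: s => [|i s IH] h //=; rewrite (IH (fun j js => h j (mem_behead (s := i :: s) js))).
by rewrite h ?mem_head //; lia.
Qed.

(** Each round adds [2 * iH]: the new offset [z' + sg1 - sg0] follows [z'], crosses to [X] by [sg0]
    and returns by [sg1], both flagged. The window keeps the crossing inside the enlarged interval,
    where flagged shifts are controlled. *)
Lemma selfmis l : l <= ilam -> (exists2 sg, sg < iS & flag sg) -> forall z, z \in (trun l).1.1 ->
  forall a m, k * L <= a + W -> a + m <= (k + pw) * L + W ->
  count (fun j => ys j != ys (j + iZ - z)) (iota a m) <= 2 * l * iH.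
Proof.
move=> ll [sgf sgfl /(flag_sg0 sgfl) fl0]; elim: l ll => [|l IH] ll z.
  rewrite inE => /eqP-> a m _ _; rewrite (eq_count (a2 := pred0)) ?count_pred0 // => j.
  by rewrite addnK eqxx.
have IHl := IH (ltnW ll); have := trun_inv (ltnW ll) => /=.
move: IHl; case E : (trun l) => [[T U] dn]; case: dn E => E //= IHl [uT sT bT].
  by move=> /IHl h a m am1 am2; apply: leq_trans (h a m am1 am2) _; nia.
case E2 : (low T (draws T l)) => [|sg r] /=.
  by move=> /IHl h a m am1 am2; apply: leq_trans (h a m am1 am2) _; nia.
rewrite mem_cat => /orP[/IHl h a m am1 am2|].
  by apply: leq_trans (h a m am1 am2) _; nia.
rewrite mem_filter => /andP[_ /mapP[z' z'T ->]] a m am1 am2.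
have : last sg r \in low T (draws T l) by rewrite E2 mem_last.
rewrite mem_filter mem_iota add0n => /andP[/andP[fl _] sl].
move: (last sg r) fl sl => sg1 fl sl.
have s0 := sg0_lt; have [z1 z2] := bT _ z'T.
have lZ : 2 * W * l + 2 * W <= iZ by rewrite /iZ; nia.
(* The position of [X] that [sg0] aligns with [Y[j + iZ - z']]; from it, [sg1] leads to the new
   offset. *)
pose i' j := j + (iZ + sg0) - (z' + W).
apply: leq_trans (count_or3 (Q1 := fun j => ys j != ys (j + iZ - z'))
   (Q2 := fun j => mis sg0 (i' j)) (Q3 := fun j => mis sg1 (i' j)) _) _.
  move=> j; rewrite mem_iota => /andP[jk _]; rewrite /mis /i' /= => neq.
  have LZ' := LZ; rewrite /iS in s0 sl.
  have -> : j + (iZ + sg0) - (z' + W) + W - sg0 = j + iZ - z' by lia.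
  have -> : j + (iZ + sg0) - (z' + W) + W - sg1 = j + iZ - (z' + sg1 - sg0) by lia.
  apply: contraTT neq; rewrite !negb_or !negbK => /and3P[/eqP e1 /eqP e2 /eqP e3].
  by rewrite e1 -e2 e3.
have sh P : count (fun j => P (i' j)) (iota a m) <=
    count P (iota (k.-1 * L) ((pw + 2) * L)).
  have LZ' := LZ; rewrite /iS in s0 sl.
  by move: kL k1L am1 am2; rewrite !mulnDl => e1 e2 am1 am2; apply: count_iota_trans; lia.
have h0 := leq_trans (sh (mis sg0)) (flag_fplus sg0_lt fl0).
have h1 := leq_trans (sh (mis sg1)) (flag_fplus sl fl).
by have h2 := IHl _ z'T _ _ am1 am2; nia.
Qed.

(** Blocks are disjoint and hold one sample each. *)
Lemma count_posD (P : pred nat) a m :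
  count P [seq posD bb | bb <- iota a m] <= count P (iota (a * bet) (m * bet)).
Proof.
have b0 : 0 < bet by case: wfp => _ [].
elim: m a => [|m IH] a //=; rewrite mulSn iotaD count_cat.
have -> : a * bet + bet = a.+1 * bet by rewrite mulSn addnC.
apply: leq_add (IH _); case Pa : (P _) => //.
rewrite -has_count; apply/hasP; exists (posD a) => //.
by rewrite mem_iota /posD leq_addr ltn_add2l ltn_pmod.
Qed.

Let LBb : iLB * bet = L.
Proof. by rewrite /iLB divnK //; case: wfp => _ []. Qed.

Lemma tU_sub : exists2 l, l < ilam & [/\ tU = draws (trun l).1.1 l,
   low (trun l).1.1 tU = [::] & forall z, z \in tU -> z \in (trun l).1.1].
Proof.
have [l ll [h1 h2 h3]] := trun_done (leqnn _) trun_lam_done.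
exists l => //; rewrite /tU h2; split=> // z; apply: draws_sub.
by have [] := trun_inv (ltnW ll).
Qed.

Lemma size_tU : size tU = iK.
Proof. by have [l ll [-> _ _]] := tU_sub; rewrite size_draws. Qed.

(** For each of the [iK] tests, a heavy [i] either mismatches under [sg0] (at most [iH] positions)
    or has an [sg0]-partner that is a self-mismatch of [Y] along the test (at most [2 * l * iH]). *)
Lemma size_listX : (exists2 sg, sg < iS & flag sg) ->
  size listX <= iK * (2 * ilam + 1) * iH.
Proof.
move=> fl; have [sgf sgfl ffl] := fl; have fl0 := flag_sg0 sgfl ffl.
have [l ll [h1 h2 h3]] := tU_sub; rewrite size_filter.
apply: leq_trans (count_posD _ _ _) _; rewrite -(mulnA k) -(mulnA pw) LBb.
rewrite -size_tU -(mulnA (size _)); apply: count_has => z /h3 zT.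
apply: leq_trans (count_or3 (Q1 := fun i => mis sg0 i)
   (Q2 := fun i => ys (i + W - sg0) != ys (i + W - sg0 + iZ - z)) (Q3 := pred0) _) _.
  move=> i; rewrite mem_iota => /andP[ik _]; rewrite /mis /=.
  have LZ' := LZ; have s0 := sg0_lt; rewrite /iS in s0.
  have -> : i + W + iZ - sg0 - z = i + W - sg0 + iZ - z by lia.
  apply: contraTT; rewrite !negb_or !negbK => /and3P[/eqP e1 /eqP e2 _].
  by rewrite e1 e2.
rewrite count_pred0 addn0.
have h0 : count (mis sg0) (iota (k * L) (pw * L)) <= iH.
  apply: leq_trans (flag_fplus sg0_lt fl0); apply: count_iota_sub; move: kL.
    by lia.
  by rewrite mulnDl; lia.
have h4 : count (fun i => ys (i + W - sg0) != ys (i + W - sg0 + iZ - z)) (iota (k * L) (pw * L)) <= 2 * l * iH.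
  have LZ' := LZ; have s0 := sg0_lt; rewrite /iS in s0.
  apply: leq_trans (@count_iota_trans (fun j => ys j != ys (j + iZ - z)) (k * L) (pw * L) W sg0 (k * L + W - sg0) (pw * L) _ _ _) _.
  - by lia.
  - by lia.
  - by lia.
  by apply: (selfmis (ltnW ll) fl zT); rewrite ?mulnDl; lia.
by move: (leq_add h0 h4) => /leq_trans; apply; rewrite -mulSn leq_mul2r; lia.
Qed.

(** [selfmis] covers the interval itself; the two outer chunks are charged in full, whence
    [2 * L]. *)
Lemma size_listY : (exists2 sg, sg < iS & flag sg) ->
  size listY <= iK * (2 * ilam + 1) * iH + 2 * L.
Proof.
move=> fl; have [l ll [h1 h2 h3]] := tU_sub; rewrite size_filter.
have -> : (pw + 2) * iLB = iLB + (pw * iLB + iLB) by lia.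
have b0 : 0 < bet by case: wfp => _ [].
have LBL : iLB <= L by rewrite -LBb; nia.
rewrite !iotaD !map_cat !count_cat.
have -> : k.-1 * iLB + iLB = k * iLB by case: k k2 => //= k' _; rewrite mulSn addnC.
have c1 : count (hvY tU) [seq posD bb | bb <- iota (k.-1 * iLB) iLB] <= L.
  by apply: leq_trans (count_size _ _) _; rewrite size_map size_iota.
have c3 : count (hvY tU) [seq posD bb | bb <- iota (k * iLB + pw * iLB) iLB] <= L.
  by apply: leq_trans (count_size _ _) _; rewrite size_map size_iota.
suff c2 : count (hvY tU) [seq posD bb | bb <- iota (k * iLB) (pw * iLB)] <= iK * (2 * ilam + 1) * iH.
  move: c1 c3 c2; move: (count _ _) (count _ _) (count _ _) (_ * iH) => ? ? ? ?; lia.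
apply: leq_trans (count_posD _ _ _) _; rewrite -(mulnA k) -(mulnA pw) LBb.
rewrite -size_tU -(mulnA (size _)); apply: count_has => z /h3 zT.
apply: leq_trans (selfmis (ltnW ll) fl zT _ _) _; [lia | by rewrite mulnDl; lia |].
by rewrite leq_mul2r; lia.
Qed.

(* Both ends of a mismatch for a flagged shift cannot be light: the two
   translates of [T] they see overlap in more elements than they may miss. *)
Lemma heavy_mis sg i : sg < iS -> flag sg -> inI i -> mis sg i ->
  hvX tU i || hvY tU (i + W - sg).
Proof.
move=> sl fl /andP[i1 i2] ms; have [l ll [h1 h2 h3]] := tU_sub.
have [uT sT bT] := trun_inv (ltnW ll).
case: gd => _ g2 g3 _; case: (boolP (hvX tU i)) => //= nX; apply/negPn/negP => nY.
have iN : i + L < iNc * L.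
  have /andP[_ vv] := val.
  have : (k + pw + 2) * L <= iNc * L by rewrite leq_mul2r vv orbT.
  by rewrite !mulnDl in i2 *; lia.
have LZ' := LZ; have LW' := LW.
have bX : 32 * badX (trun l).1.1 i < size (trun l).1.1.
  have /andP[] := g3 l i ll ltac:(lia); rewrite -h1 (negbTE nX) /= => -> //.
have bY : 32 * badY (trun l).1.1 (i + W - sg) < size (trun l).1.1.
  have /andP[_] := g3 l (i + W - sg) ll ltac:(lia); rewrite -h1 (negbTE nY) /= => -> //.
have ov : size (trun l).1.1 <= 16 * ovl (trun l).1.1 sg.
  have := g2 l sg ll sl; rewrite /G2 -h1; case: ifP => // lo.
  have : sg \in low (trun l).1.1 tU by rewrite mem_filter fl lo mem_iota.
  by rewrite h2.
move: bX bY ov uT bT; rewrite /badX /badY /ovl; move: (trun l).1.1 sT => T sT bX bY ov uT bT.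
have s0 := sg0_lt; rewrite /iS in s0 sl.
have lZ : 2 * W * l + 2 * W <= iZ by rewrite /iZ; nia.
(* Translation is injective on [T], so the overlap has no more bad translates than [T] has bad
   elements. *)
have injc : count (fun z => (z + sg - sg0 \in T) && (xs i != ys (i + W + iZ - sg0 - (z + sg - sg0)))) T <=
   count (fun z => xs i != ys (i + W + iZ - sg0 - z)) T.
  rewrite -!size_filter.
  rewrite -(size_map (fun z => z + sg - sg0)); apply: uniq_leq_size.
    rewrite map_inj_in_uniq ?filter_uniq // => z1 z2; rewrite !mem_filter.
    by move=> /andP[_ /bT[a1 _]] /andP[_ /bT[a2 _]]; lia.
  move=> z /mapP[z1]; rewrite mem_filter => /andP[/andP[e0 e] _] ->.
  by rewrite mem_filter e e0.
(* Since 1/16 is not below 1/32 + 1/32, some [z] of the overlap is bad for neither end; both ends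
   then equal the same character of [Y]. *)
have /hasP[z zT /and3P[e1 e2 e3]] : has (fun z => [&& z + sg - sg0 \in T,
    xs i == ys (i + W + iZ - sg0 - (z + sg - sg0)) &
    ys (i + W - sg) == ys (i + W - sg + iZ - z)]) T.
  rewrite has_count.
  have := @count_or3 (fun z => z + sg - sg0 \in T) (fun z => [&& z + sg - sg0 \in T,
    xs i == ys (i + W + iZ - sg0 - (z + sg - sg0)) &
    ys (i + W - sg) == ys (i + W - sg + iZ - z)])
    (fun z => (z + sg - sg0 \in T) && (xs i != ys (i + W + iZ - sg0 - (z + sg - sg0))))
    (fun z => ys (i + W - sg) != ys (i + W - sg + iZ - z)) T.
  have hh : forall i0, i0 \in T -> i0 + sg - sg0 \in T -> [|| [&& i0 + sg - sg0 \in T,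
       xs i == ys (i + W + iZ - sg0 - (i0 + sg - sg0)) &
       ys (i + W - sg) == ys (i + W - sg + iZ - i0)],
       (i0 + sg - sg0 \in T) && (xs i != ys (i + W + iZ - sg0 - (i0 + sg - sg0)))
     | ys (i + W - sg) != ys (i + W - sg + iZ - i0)].
    by move=> z _ ->; case: eqP => //= _; case: eqP.
  by move=> /(_ hh); lia.
move: ms; rewrite /mis (eqP e2) (eqP e3); have [a1 a2] := bT _ zT.
have -> : i + W + iZ - sg0 - (z + sg - sg0) = i + W - sg + iZ - z by lia.
by rewrite eqxx.
Qed.

Lemma fin_split sg : sg < iS -> flag sg ->
  fin sg = count (mxp sg) (iota 0 (iNc * L)) + count (myp sg) (iota 0 (iNc * L)).
Proof.
move=> sl fl; have LW' := LW.
have vN : (k + pw) * L + 2 * L <= iNc * L.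
  by have /andP[_ vv] := val; rewrite -mulnDl leq_mul2r vv orbT.
rewrite (@count_iota_restrict (mxp sg) (k * L) (pw * L)); first last.
- by move=> i /and3P[]; rewrite /inI mulnDl.
- by move: vN; rewrite mulnDl; lia.
have -> : count (myp sg) (iota 0 (iNc * L)) =
   count (fun i => [&& mis sg i, ~~ hvX tU i & hvY tU (i + W - sg)]) (iota (k * L) (pw * L)).
  rewrite (@count_iota_restrict (myp sg) (k * L + W - sg) (pw * L)); first last.
  - move=> j /andP[/and3P[/andP[j1 j2] _ _] _]; rewrite /iS in sl.
    by move: kL k1L j1 j2; rewrite mulnDl; lia.
  - by move: vN; rewrite mulnDl; lia.
  rewrite count_iota_shift [RHS]count_iota_shift; apply: eq_in_count => i.
  rewrite mem_iota => /andP[_ ik]; rewrite /myp /ymis /= /inI.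
  have LW2 := LW; have kL' := kL; rewrite /iS in sl.
  have -> : k * L + W - sg + i + sg - W = k * L + i by lia.
  have -> : k * L + W - sg + i = k * L + i + W - sg by lia.
  have -> : (k * L <= k * L + i) && (k * L + i < (k + pw) * L) by rewrite mulnDl; lia.
  by rewrite andTb -andbA.
apply: count_split => i; rewrite mem_iota => ik.
have iI : inI i by rewrite /inI mulnDl.
rewrite /mxp iI /=; case mi : (mis sg i); rewrite ?andbF ?andbT //=.
by have := heavy_mis sl fl iI mi; case: (hvX tU i) => //= ->.
Qed.

(** As [bet] divides [L], an interval consists of whole blocks, so its samples can be counted over
    all blocks, the form in which [dev] speaks. *)
Lemma est_split sg : sg < iS ->
  est sg = bet * (count (fun bb => mxp sg (posD bb)) (iota 0 (iNc * iLB)) +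
                  count (fun bb => myp sg (posD bb)) (iota 0 (iNc * iLB))).
Proof.
move=> sl; have b0 : 0 < bet by case: wfp => _ [].
have LW' := LW; have := LBb => LBb'.
have pD bb a m : a * L <= posD bb < (a + m) * L <-> a * iLB <= bb < a * iLB + m * iLB.
  rewrite -LBb' !mulnA -mulnDl /posD.
  have := ltn_pmod (om (iNc + ilam * iK + bb)) b0; move: (_ %% bet) => r rb.
  by split; nia.
have vN : k * iLB + pw * iLB + 2 * iLB <= iNc * iLB.
  by have /andP[_ vv] := val; rewrite -!mulnDl leq_mul2r vv orbT.
rewrite /est; congr (_ * (_ + _)); rewrite count_filter count_map.
  rewrite (@count_iota_restrict (fun bb => mxp sg (posD bb)) (k * iLB) (pw * iLB)); first last.
  - by move=> bb /and3P[/pD].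
  - lia.
  apply: eq_in_count => bb; rewrite mem_iota => /pD ib.
  by rewrite /mxp /inI ib /= andbC.
rewrite (@count_iota_restrict (fun bb => myp sg (posD bb)) (k.-1 * iLB) ((pw + 2) * iLB)); first last.
- move=> bb /andP[/and3P[/andP[j1 j2] _ _] _]; rewrite -mulnDl; rewrite mulnDl; apply/pD.
  have -> : k.-1 + (pw + 2) = k + pw + 1 by lia.
  by rewrite /iS in sl; move: kL k1L; rewrite !mulnDl in j2 *; lia.
- by move: vN; rewrite mulnDl; case: k k2 => //= k' _; rewrite mulSn; lia.
by apply: eq_count => bb; rewrite /myp.
Qed.

(** If one of the two sets exceeded [4 * d], then [fin] would exceed [2 * d] and [est] would be at
    least [2 * d], against both alternatives. So both sets are estimated accurately, and two errors
    of [d / (16 q lg)] add up. *)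
Lemma est_acc sg : sg < iS -> flag sg -> (fin sg <= 2 * d) || (est sg < 2 * d) ->
  8 * q * lg * (est sg - fin sg) <= d /\ 8 * q * lg * (fin sg - est sg) <= d.
Proof.
move=> sl fl; rewrite (est_split sl) (fin_split sl fl).
case: gd => _ _ _ /(_ _ sl)/andP[]; rewrite /dev.
move: (count (mxp sg) _) (count (myp sg) _) => N1 N2.
move: (count _ _) (count _ _) => h1 h2 d1 d2 hyp.
have [n1 n2] : N1 <= 4 * d /\ N2 <= 4 * d.
  by move: d1 d2 hyp; do 2 case: ifP; rewrite ?mulnDr; lia.
move: d1 d2; rewrite n1 n2 mulnDr.
move: (bet * h1) (bet * h2) => e1 e2.
have -> : 8 * q * lg = 8 * (q * lg) by lia.
have -> : 16 * q * lg = 16 * (q * lg) by lia.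
move: (q * lg) => u /andP[a1 a2] /andP[a3 a4]; split; nia.
Qed.

Lemma noflag_fplus sg : sg < iS -> ~~ flag sg -> 2 * d < fplus sg.
Proof.
move=> sl nf; case: gd => /(_ _ sl)/andP[+ _] _ _ _.
by rewrite (negbTE nf) implybF -ltnNge.
Qed.


End Interval.
End Model.

(** * Hamming distances and LCE values as counts of mismatches *)

Lemma take_drop_iota (X : seq nat) x l : x + l <= size X ->
  take l (drop x X) = [seq nth 0 X (x + i) | i <- iota 0 l].
Proof.
move=> lx; apply: (@eq_from_nth _ 0).
  by rewrite size_map size_iota size_take size_drop; case: ifP; lia.
rewrite size_take size_drop => i il; have il' : i < l by move: il; case: ifP; lia.
by rewrite nth_take // nth_drop (nth_map 0) ?size_iota // nth_iota.
Qed.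

Lemma HD_count (X Y : seq nat) x y l : x + l <= size X -> y + l <= size Y ->
  HD (substring X x (x + l)) (substring Y y (y + l)) =
  count (fun i => nth 0 X (x + i) != nth 0 Y (y + i)) (iota 0 l).
Proof.
move=> lx ly; rewrite /HD /substring !addKn !take_drop_iota //.
by rewrite zip_map count_map.
Qed.

Lemma mul_subDD u a1 a2 c1 c2 : u * (a1 + a2 - (c1 + c2)) <= u * (a1 - c1) + u * (a2 - c2).
Proof. by rewrite -mulnDr leq_mul2l; apply/orP; right; lia. Qed.

Section LCE.
Variables (R : realType) (X Y : seq nat) (x y : nat).
Let m := minn (size X - x) (size Y - y).
Hypotheses (hx : x <= size X) (hy : y <= size Y).
Let h l := count (fun i => nth 0 X (x + i) != nth 0 Y (y + i)) (iota 0 l).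

(** Counts are monotone in the length, so it suffices to look at [v] and at one more character. *)
Lemma is_approx_LCE_count d (eps : R) v : v <= m ->
  ((h v)%:R <= (1 + eps) * d%:R)%R -> (v < m -> d < h v.+1) ->
  is_approx_LCE X Y d eps x y v.
Proof.
move=> vm hv hd.
have hE l : l <= m -> HD (substring X x (x + l)) (substring Y y (y + l)) = h l.
  by move=> lm; rewrite HD_count //; rewrite /m in lm; lia.
apply/andP; split.
  apply/bigmax_leqP => -[l lm] /=; rewrite hE // ler_nat => hl.
  rewrite leqNgt; apply/negP => vl.
  have : d < h v.+1 by apply: hd; apply: leq_trans vl _.
  have : h v.+1 <= h l by apply: count_iota_sub.
  by lia.
have vm' : v < m.+1 by [].
rewrite /LCE -/m (bigD1 (Ordinal vm')) /=; last by rewrite hE.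
exact: leq_maxl.
Qed.
End LCE.

(** * The walk of a query over dyadic intervals *)

Section Query.
Variables (p : inst) (om : nat -> nat) (x y : nat).
Local Notation X := (iX p). Local Notation Y := (iY p).
Local Notation d := (idd p). Local Notation W := (iW p).
Local Notation lg := (ilg p). Local Notation q := (iq p).
Local Notation L := (iL p). Local Notation Nc := (iNc p).

Definition qsg := x + W - y.
Definition qE := x + minn (size X - x) (size Y - y).
(** The last condition is the threshold [(1 + 1/(2q)) d], multiplied by [2 q]. *)
Definition qpass k pw acc := [&& valid p k pw, flag p om k pw qsg &
  2 * q * (acc + est p om k pw qsg) <= (2 * q + 1) * d].
Definition qstep k pw acc := if qpass k pw acc then (k + pw, acc + est p om k pw qsg) else (k, acc).
(** A step is tried only if [2 ^ j] is the exact power of two in [k]; success then makes [k]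
    divisible by [2 ^ j.+1]. *)
Definition qup j (st : nat * nat) := let: (k, acc) := st in
  if (2 ^ j %| k) && ~~ (2 ^ j.+1 %| k) then qstep k (2 ^ j) acc else st.
Definition qdn j (st : nat * nat) := let: (k, acc) := st in
  if 2 ^ j %| k then qstep k (2 ^ j) acc else st.

Definition qF e := count (mis p qsg) (iota x (e - x)).
(** A certificate that no scan has to go beyond the chunk boundary [e]. *)
Definition qfail e := (qE <= e * L) \/ (d < qF (e * L)).

Hypothesis wfp : wf p.
Hypothesis gd : forall k j, 2 ^ j %| k -> valid p k (2 ^ j) -> good p om k (2 ^ j).
Hypothesis hx : x <= size X.
Hypothesis hy : y <= size Y.
Hypothesis hxy : x <= y + W.
Hypothesis hyx : y <= x + W.

Let q0 : 0 < q. Proof. by case: wfp => _ []. Qed.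
Let d0 : 0 < d. Proof. by case: wfp => -[]. Qed.
Let LW : 2 * W <= L.
Proof.
case: wfp => -[] l0 w0 d0' _ LL _; apply: leq_trans LL.
by rewrite leq_mul2r; apply/orP; right; nia.
Qed.
Let L0 : 0 < L.
Proof. have w0 : 0 < W by case: wfp => -[]. by move: LW w0; lia. Qed.

Lemma qsg_lt : qsg < iS p. Proof. by rewrite /qsg /iS; lia. Qed.

Lemma qF_le e e' : e <= e' -> qF e <= qF e'.
Proof. by move=> ee; apply: count_iota_sub; lia. Qed.

Lemma qF_add a m : x <= a -> qF (a + m) = qF a + count (mis p qsg) (iota a m).
Proof.
move=> xa; rewrite /qF; have -> : a + m - x = (a - x) + m by lia.
by rewrite iotaD count_cat; congr (_ + count _ (iota _ _)); lia.
Qed.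

Lemma qfail_le e e' : e <= e' -> qfail e -> qfail e'.
Proof.
move=> ee [h|h]; [left; apply: leq_trans h _ | right; apply: leq_trans h _].
  by rewrite leq_mul2r ee orbT.
by apply: qF_le; rewrite leq_mul2r ee orbT.
Qed.

(* [t] intervals have been traversed, each contributing at most [d / (8 q lg)]
   to the error of [acc]. *)
Definition qacc t k acc := [/\ x + L <= k * L, k * L <= qE,
  8 * q * lg * (acc - qF (k * L)) <= t * d,
  8 * q * lg * (qF (k * L) - acc) <= t * d &
  2 * q * acc <= (2 * q + 1) * d].

Lemma validE k pw : valid p k pw -> (k + pw + 1) * L <= qE.
Proof.
move=> /andP[_ vv]; have : (k + pw + 2) * L <= Nc * L by rewrite leq_mul2r vv orbT.
have : Nc * L <= minn (size X) (size Y) by rewrite /iNc leq_divM.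
by rewrite /qE !mulnDl; lia.
Qed.

(** Two of the three chunks are the margin in [valid], which absorbs the rounding in [iNc]; the
    third is needed because the overlap may end up to [W <= L] beyond the length of the shorter
    string. *)
Lemma invalidE k pw : 2 <= k -> ~~ valid p k pw -> qfail (k + pw + 3).
Proof.
move=> k2; rewrite /valid k2 /= -ltnNge => vv; left.
have : minn (size X) (size Y) < (Nc + 1) * L by rewrite addn1 ltn_ceil.
have : (Nc + 1) * L <= (k + pw + 2) * L by rewrite leq_mul2r; lia.
have -> : (k + pw + 3) * L = (k + pw + 2) * L + L by lia.
by rewrite /qE; lia.
Qed.


(** [est_acc] applies because passing bounds the estimate by [(1 + 1/(2q)) d < 2 d]. *)
Lemma qstep_pass t k j acc : 2 ^ j %| k -> qacc t k acc -> t < 2 * lg -> qpass k (2 ^ j) acc ->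
  qacc t.+1 (k + 2 ^ j) (acc + est p om k (2 ^ j) qsg).
Proof.
move=> jk [a1 a2 a3 a4 a5] tl /and3P[v f th].
have es : (fin p k (2 ^ j) qsg <= 2 * d) || (est p om k (2 ^ j) qsg < 2 * d).
  by apply/orP; right; rewrite -(ltn_pmul2l q0); move: q0 d0 th; nia.
have [e1 e2] := est_acc wfp v (gd jk v) qsg_lt f es.
have FE : qF ((k + 2 ^ j) * L) = qF (k * L) + fin p k (2 ^ j) qsg.
  by rewrite mulnDl qF_add //; lia.
split=> //.
- by rewrite mulnDl; lia.
- by apply: leq_trans (validE v); rewrite leq_mul2r; lia.
- by rewrite FE mulSn; apply: leq_trans (mul_subDD _ _ _ _ _) _; rewrite addnC leq_add.
- by rewrite FE mulSn; apply: leq_trans (mul_subDD _ _ _ _ _) _; rewrite addnC leq_add.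
Qed.

(** Three ways to fail: the interval does not fit, and the overlap ends soon; the shift is not
    flagged, so the enlarged interval has more than [2 * d] mismatches; or the threshold is
    exceeded, which is impossible with at most [d] true mismatches, as all errors together are at
    most [d / (4 q)]. *)
Lemma qstep_fail t k j acc : 2 <= k -> 2 ^ j %| k -> qacc t k acc -> t < 2 * lg ->
  ~~ qpass k (2 ^ j) acc -> qfail (k + 2 ^ j + 3).
Proof.
move=> k2 jk [a1 a2 a3 a4 a5] tl; rewrite /qpass.
case: (boolP (valid _ _ _)) => [v|/(invalidE k2)//] /=.
have gk := gd jk v; have xk : x <= k.-1 * L.
  by move: a1; case: k k2 {jk v gk a2 a3 a4} => //= k' _; rewrite mulSn; lia.
case: (boolP (flag _ _ _ _ _)) => [f|nf _] /=; last first.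
  right; have := noflag_fplus gk qsg_lt nf; rewrite /fplus => fp.
  have : qF ((k + 2 ^ j + 1) * L) <= qF ((k + 2 ^ j + 3) * L).
    by apply: qF_le; rewrite leq_mul2r; lia.
  have -> : (k + 2 ^ j + 1) * L = k.-1 * L + (2 ^ j + 2) * L.
    by rewrite -mulnDl; congr (_ * _); lia.
  by rewrite qF_add //; lia.
rewrite -ltnNge => th; right.
have FE : qF ((k + 2 ^ j) * L) = qF (k * L) + fin p k (2 ^ j) qsg.
  by rewrite mulnDl qF_add //; lia.
apply: leq_trans (_ : d < qF ((k + 2 ^ j) * L)) _; last first.
  by apply: qF_le; rewrite leq_mul2r; lia.
rewrite ltnNge FE; apply/negP => le.
have es : (fin p k (2 ^ j) qsg <= 2 * d) || (est p om k (2 ^ j) qsg < 2 * d).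
  by apply/orP; left; lia.
have [e1 e2] := est_acc wfp v gk qsg_lt f es.
move: th e1 a3 le; move: (est _ _ _ _ _) (fin _ _ _ _) (qF _) => e f0 F th e1 a3 le.
have lg0 : 0 < lg by case: wfp => -[].
have : 8 * q * lg * (acc + e - (F + f0)) <= t.+1 * d.
  by rewrite mulSn; apply: leq_trans (mul_subDD _ _ _ _ _) _; rewrite addnC leq_add.
have : t.+1 * d <= 2 * lg * d by rewrite leq_mul2r tl orbT.
move=> h1 h2; have : 4 * q * (acc + e - (F + f0)) <= d.
  rewrite -(leq_pmul2l (_ : 0 < 2 * lg)); last by lia.
  by apply: leq_trans h1; apply: leq_trans h2; rewrite [leqLHS](_ : _ = 8 * q * lg * (acc + e - (F + f0))) //; move: (acc + e - _) => u; nia.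
move: th le; move: (acc + e) (F + f0) => A S th le h4.
have g1 : q * A <= q * S + q * (A - S) by rewrite -mulnDr leq_mul2l; lia.
have g2 : q * S <= q * d by rewrite leq_mul2l le orbT.
by move: d0; lia.
Qed.

Definition Jn := if Nc == 0 then 0 else (trunc_log 2 Nc).+1.

Lemma Jn_gt : Nc < 2 ^ Jn.
Proof. by rewrite /Jn; case: eqP => [->|/eqP N0] //; rewrite trunc_log_ltn. Qed.

(** Either the climb is still aligned, or a step of some level [a] has failed and the answer is at
    most [2 ^ a + 3] chunks away. *)
Definition qupinv j k := (2 ^ j %| k) \/ exists2 a, a <= j & (2 ^ a %| k) /\ qfail (k + 2 ^ a + 3).
Definition qdninv j k := exists2 a, a <= j & (2 ^ a %| k) /\ qfail (k + 2 ^ a + 3).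

Lemma qup_inv j t k acc : 2 <= k -> qacc t k acc -> t < 2 * lg -> qupinv j k ->
  let: (k', acc') := qup j (k, acc) in
  [/\ 2 <= k', exists2 t', t' <= t.+1 & qacc t' k' acc' & qupinv j.+1 k'].
Proof.
move=> k2 ac tl inv; rewrite /qup; case: ifP => [/andP[h1 h2]|h].
  rewrite /qstep; case: ifP => [ps|/negbT nps].
    split; [lia | by exists t.+1 => //; apply: qstep_pass |].
    left; case/dvdnP: h1 h2 => m ->; rewrite expnS dvdn_pmul2r ?expn_gt0 // => o.
    by rewrite -mulSnr dvdn_pmul2r ?expn_gt0 // dvdn2 /= -dvdn2.
  split=> //; first by exists t.
  by right; exists j => //; split=> //; apply: qstep_fail ac tl nps.
split=> //; first by exists t.
case: inv => [jk|[a aj ha]]; last by right; exists a => //; lia.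
by left; move: h; rewrite jk /= => /negbFE.
Qed.

(** A step that passes shrinks the remaining [2 ^ j.+1] to [2 ^ j]; one that fails certifies [2 ^ j]
    directly; and if [k] is not aligned to [2 ^ j], then [a <= j] already. *)
Lemma qdn_inv j t k acc : 2 <= k -> qacc t k acc -> t < 2 * lg -> qdninv j.+1 k ->
  let: (k', acc') := qdn j (k, acc) in
  [/\ 2 <= k', exists2 t', t' <= t.+1 & qacc t' k' acc' & qdninv j k'].
Proof.
move=> k2 ac tl [a aj [ak fl]]; rewrite /qdn; case: ifP => [h1|h].
  rewrite /qstep; case: ifP => [ps|/negbT nps].
    split; [lia | by exists t.+1 => //; apply: qstep_pass |].
    exists j => //; split; first by rewrite dvdn_add.
    apply: qfail_le fl; have : 2 ^ a <= 2 ^ j.+1 by rewrite leq_exp2l.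
    by rewrite expnS; lia.
  split=> //; first by exists t.
  by exists j => //; split=> //; apply: qstep_fail ac tl nps.
split=> //; first by exists t.
exists a => //; rewrite leqNgt; apply/negP => ja.
have : 2 ^ j %| k by apply: dvdn_trans ak; rewrite dvdn_exp2l // ltnW.
by rewrite h.
Qed.

(** An interval of [2 ^ Jn] chunks never fits. *)
Lemma qtop_inv k : 2 <= k -> qupinv Jn k -> qdninv Jn k.
Proof.
move=> k2 [jk|//]; exists Jn => //; split=> //; apply: invalidE => //.
by rewrite /valid k2 /= -ltnNge; have := Jn_gt; lia.
Qed.

Definition qh l := count (fun i => nth 0 X (x + i) != nth 0 Y (y + i)) (iota 0 l).

Lemma qhE l : qh l = qF (x + l).
Proof.
rewrite /qF addKn count_iota_shift; apply: eq_count => i; rewrite /mis /qsg.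
by congr (nth 0 X _ != nth 0 Y _); lia.
Qed.

Lemma qacc_err t k acc pos : t <= 2 * lg -> qacc t k acc -> k * L <= pos ->
  let accp := acc + (qF pos - qF (k * L)) in
  4 * q * (accp - qF pos) <= d /\ 4 * q * (qF pos - accp) <= d.
Proof.
move=> tl [a1 a2 a3 a4 a5] kp; have lg0 : 0 < lg by case: wfp => -[].
have hh u : 8 * q * lg * u <= t * d -> 4 * q * u <= d.
  move=> h; rewrite -(leq_pmul2l (_ : 0 < 2 * lg)); last by lia.
  have td : t * d <= 2 * lg * d by rewrite leq_mul2r tl orbT.
  by rewrite [leqLHS](_ : _ = 8 * q * lg * u) //; [apply: leq_trans h td | lia].
have := qF_le kp => ?; split; apply: hh.
  by apply: leq_trans a3; rewrite leq_mul2l; apply/orP; right; lia.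
by apply: leq_trans a4; rewrite leq_mul2l; apply/orP; right; lia.
Qed.

(** The true count is at most [(1 + 1/(2q) + 1/(4q)) d], within [(1 + eps) d] if [1 <= eps * q], and
    an integer below [d + 1] if [d < q]. When the scan stops, one more mismatch lifts the estimate
    above [(1 + 1/(2q)) d], hence the true count above [d]. *)
Lemma query_correct (R : realType) (eps : R) (k pos accp : nat) (stop : bool) :
  (0 < eps)%R -> (1 <= eps * q%:R)%R \/ d < q ->
  x <= pos <= qE ->
  4 * q * (accp - qF pos) <= d -> 4 * q * (qF pos - accp) <= d ->
  2 * q * accp <= (2 * q + 1) * d ->
  (if stop then (pos < qE) && mis p qsg pos && ((2 * q + 1) * d < 2 * q * accp.+1)
   else pos == minn qE ((k + 4) * L)) -> (stop \/ qfail (k + 4)) ->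
  is_approx_LCE X Y d eps x y (pos - x).
Proof.
move=> e0 eq /andP[xp pE] err1 err2 th st fl.
have qq := q0; have dd := d0.
have hp : qh (pos - x) = qF pos by rewrite qhE subnKC.
have hp1 : qh (pos - x).+1 = qF pos.+1.
  by rewrite qhE; congr qF; lia.
apply: is_approx_LCE_count => //.
- by move: pE; rewrite /qE; lia.
- rewrite -/(qh _) hp.
  have g1 : q * qF pos <= q * accp + q * (qF pos - accp) by rewrite -mulnDr leq_mul2l; lia.
  have : q * qF pos <= (q + 1) * d by lia.
  have : qF pos <= d \/ (1 <= eps * q%:R)%R.
    by case: eq => [|dq]; [right | left; nia].
  move=> [le _|eq1 h].
    apply: (@le_trans _ _ (d%:R)%R); first by rewrite ler_nat.
    by rewrite mulrDl mul1r lerDl mulr_ge0 // ltW.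
  have qR : (0 < q%:R :> R)%R by rewrite ltr0n.
  rewrite -(ler_pM2l qR); apply: (@le_trans _ _ ((q + 1) * d)%:R%R).
    by rewrite -natrM ler_nat.
  rewrite natrM natrD mulrA ler_wpM2r // mulrDr mulr1 lerD2l.
  by rewrite mulrC.
- rewrite -/(qh _) hp1 => pm.
  have pE' : pos < qE by rewrite /qE; lia.
  move: st; case: stop fl => fl.
    move=> /andP[/andP[_ mp] st].
    have : qF pos.+1 = qF pos + 1.
      by rewrite -[pos.+1]addn1 qF_add //= mp.
    have g1 : q * accp <= q * qF pos + q * (accp - qF pos) by rewrite -mulnDr leq_mul2l; lia.
    have g2 : q * d < q * (qF pos + 1) by lia.
    by move=> ->; move: g2; rewrite ltn_pmul2l.
  move=> /eqP pos4; case: fl => [//|fl].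
  have e4 : pos = (k + 4) * L by lia.
  case: fl => [|]; rewrite -e4; first lia.
  by move=> h; apply: leq_trans h _; apply: qF_le.
Qed.

End Query.

(** * Probability of failure *)

Section BadEvents.
(** The Chernoff exponent for mean at most [4 r] and deviation [r / (16 u)], with [r = d / bet] and
    [u = q * lg]. The choice [1 / (256 u)] makes the quadratic term half of the linear one. *)
Lemma dev_exponent (R : realType) (r u : R) : (u != 0 ->
  2 * (1 / (256 * u)) ^+ 2 * (4 * r) - 1 / (256 * u) * (r / (16 * u)) =
  - (r / (64 * 128 * u ^+ 2)))%R.
Proof. by move=> u0; field. Qed.

Lemma mul_sub_gt c a e d : d < c * (a - e) -> e <= a.
Proof. by case: (leqP e a) => // /ltnW; rewrite -subn_eq0 => /eqP ->; rewrite muln0. Qed.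

Section Bad.
Variables (R : realType) (p : inst) (b : nat).
Local Notation B := (2 ^ b)%N.
Local Notation d := (idd p). Local Notation W := (iW p).
Local Notation lg := (ilg p). Local Notation q := (iq p).
Local Notation bet := (ibet p). Local Notation L := (iL p).
Local Notation c1 := (ic1 p). Local Notation Nc := (iNc p).
Local Notation K := (iK p). Local Notation lam := (ilam p). Local Notation LB := (iLB p).
Hypothesis wfp : wf p.
Hypothesis LB2 : L %| B.
Hypothesis ZB : 2 * iZ p < B.
Variables k pw : nat.
Hypothesis vl : valid p k pw.

Let B0 : 0 < B. Proof. by rewrite expn_gt0. Qed.
Let L0 : 0 < L. Proof. by case: wfp => -[] l0 w0 d0 _ LL _; apply: leq_trans LL; nia. Qed.
Let b0 : 0 < bet. Proof. by case: wfp => _ []. Qed.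
Let bB : bet %| B. Proof. by apply: dvdn_trans LB2; case: wfp => _ []. Qed.
Let k2 : 2 <= k. Proof. by case/andP: vl. Qed.
Let kN : k + pw + 2 <= Nc. Proof. by case/andP: vl. Qed.

Local Notation PwB := (Pw R B).
Local Notation nt l := (fun i => nth 0 l i).

Section Ext.
Variables (om om' : nat -> nat).
(** Flags depend on the first block of random words only, and the set [T] of round [l] on the words
    before the draws of that round. This is the independence behind the uses of [Pw_group]. *)
Lemma flag_ext sg : (forall c, c < Nc -> om c = om' c) -> flag p om k pw sg = flag p om' k pw sg.
Proof.
move=> e; rewrite /flag; congr (_ < _); apply: eq_in_count => c; rewrite mem_iota => h.
by rewrite /posA e //; lia.
Qed.
Lemma sg0_ext : (forall c, c < Nc -> om c = om' c) -> sg0 p om k pw = sg0 p om' k pw.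
Proof. by move=> e; rewrite /sg0 (eq_filter (fun sg => flag_ext sg e)). Qed.
Lemma draws_ext T l : (forall i, i < Nc + l.+1 * K -> om i = om' i) -> draws p om T l = draws p om' T l.
Proof.
move=> e; apply/eq_in_map => kk; rewrite mem_iota add0n => h; rewrite e // mulSn; lia.
Qed.
Lemma trun_ext l : (forall i, i < Nc + l * K -> om i = om' i) -> trun p om k pw l = trun p om' k pw l.
Proof.
elim: l => [|l IH] e //=; rewrite IH; last by move=> i il; apply: e; rewrite mulSn; lia.
case: (trun _ _ _ _ _) => [[T U] dn]; rewrite /tstep; case: dn => //.
rewrite (draws_ext T e).
have e0 c : c < Nc -> om c = om' c by move=> h; apply: e; lia.
have -> : low p om k pw T (draws p om' T l) = low p om' k pw T (draws p om' T l).
  by rewrite /low /cntU (sg0_ext e0); apply: eq_filter => sg; rewrite (flag_ext _ e0).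
by case: (low _ _ _ _ _ _) => // sg r; rewrite /grow (sg0_ext e0).
Qed.
End Ext.

Lemma pr1_div (Q : pred nat) m : 0 < m -> m %| B ->
  pr1 R B (fun v => Q (v %% m)%N) = ((count Q (iota 0 m))%:R / m%:R)%R.
Proof.
move=> m0 /dvdnP[a aB]; rewrite /pr1 aB count_modn_mul natrM natrM.
have : (0 < a) by move: B0; rewrite aB; case: a {aB}.
by move=> a0; rewrite invfM mulrACA divff ?mul1r // pnatr_eq0; lia.
Qed.

(** The size of [T] need not divide [2 ^ b]; the bias costs a factor of two, from 1/16 up to 1/8
    here and from 1/32 down to 1/64 in [pr1_mod_ge]. *)
Lemma pr1_mod_le (Q : pred nat) m : 0 < m -> m <= B -> 16 * count Q (iota 0 m) <= m ->
  (pr1 R B (fun v => Q (v %% m)%N) <= 1/8)%R.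
Proof.
move=> m0 mB h; rewrite /pr1 ler_pdivrMr ?ltr0n //.
have := count_modn_le Q B m0; have := leq_divM B m; have : 0 < B %/ m by rewrite divn_gt0.
move: (count _ (iota 0 B)) (count _ _) (B %/ m) h => u v a h a0 h1 h2.
have : 8 * u <= B by nia.
by rewrite -(ler_nat R) natrM; lra.
Qed.

Lemma pr1_mod_ge (Q : pred nat) m : 0 < m -> m <= B -> m <= 32 * count Q (iota 0 m) ->
  (1/64 <= pr1 R B (fun v => Q (v %% m)%N))%R.
Proof.
move=> m0 mB h; rewrite /pr1 ler_pdivlMr ?ltr0n //.
have := count_modn_ge Q B m; have := ltn_ceil B m0; have : 0 < B %/ m by rewrite divn_gt0.
move: (count _ (iota 0 B)) (count _ _) (B %/ m) h => u v a h a0 h1 h2.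
have : B <= 64 * u by nia.
by rewrite -(ler_nat R) natrM; lra.
Qed.

(* The expected number of hits of one uniform sample per block. *)
Lemma mean_blocks (M : pred nat) m N : 0 < m -> m %| B ->
  mean R B N (fun c v => M (c * m + v %% m)%N) = ((count M (iota 0 (N * m)%N))%:R / m%:R)%R.
Proof.
move=> m0 mB; rewrite /mean; elim: N => [|N IH]; first by rewrite big_ord0 mul0r.
rewrite big_ord_recr /= IH (pr1_div (fun v => M (N * m + v)) m0 mB) -mulrDl -natrD.
by rewrite mulSnr iotaD count_cat add0n (count_iota_shift M (N * m) m).
Qed.

Local Notation err := ((2 : R) ^- (c1 * lg))%R.

Lemma block_range a m c r : r < L ->
  (a * L <= c * L + r) && (c * L + r < (a + m) * L) = (a <= c) && (c < a + m).
Proof. by move=> rL; apply/idP/idP => /andP[h1 h2]; apply/andP; split; nia. Qed.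

Lemma P_G1 sg : (PwB (iM p) (fun l => ~~ G1 p (nt l) k pw sg) <= err)%R.
Proof.
apply: (@Pw_group R B B0 0 Nc (lam * K + Nc * LB) _
  (fun _ l => ~~ G1 p (nt l) k pw sg)) => [l1 l2 l3 /size0nil -> /= s2|l1 _].
  rewrite /G1 (@flag_ext (nt (l2 ++ l3)) (nt l2)) // => c cN.
  by rewrite nth_cat s2 cN.
(* Restricted to the window, the mismatches can be counted over all chunks, one independent word
   each. *)
pose M i := (k.-1 * L <= i) && (i < (k.-1 + (pw + 2)) * L) && mis p sg i.
pose P c v := M (c * L + v %% L).
have kN' : k.-1 + (pw + 2) <= Nc by lia.
have fl l : flag p (nt l) k pw sg = (hits Nc P l < itau p).
  rewrite /flag /hits (@count_iota_restrict _ k.-1 (pw + 2)) //; last first.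
    by move=> c; rewrite /P /M block_range ?ltn_pmod // => /andP[].
  congr (_ < _); apply: eq_in_count => c; rewrite mem_iota /P /M /posA => h.
  by rewrite block_range ?ltn_pmod // h.
have mE : mean R B Nc P = ((fplus p k pw sg)%:R / L%:R)%R.
  rewrite /P (mean_blocks M) //; congr (_%:R / _)%R; rewrite /fplus.
  rewrite (@count_iota_restrict _ (k.-1 * L) ((pw + 2) * L)); first last.
  - by move=> i /andP[]; rewrite mulnDl.
  - by rewrite -mulnDl leq_mul2r kN' orbT.
  by apply: eq_in_count => i; rewrite mem_iota -mulnDl /M => ->.
have LR : (0 < L%:R :> R)%R by rewrite ltr0n.
have [l1g Ld] : 1 < itau p /\ 8 * d <= L.
  case: wfp => -[l0 w0 d0 _ LL] [_ _ _ c10 _]; split; first by rewrite /itau; nia.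
  apply: leq_trans LL; rewrite (_ : _ * W = 8 * d * (256 * lg * W)); last by lia.
  by rewrite leq_pmulr // !muln_gt0 l0 w0.
have [f1|f1] := leqP (fplus p k pw sg) (2 * d).
  apply: le_trans (_ : (PwB Nc (fun l => (itau p <= hits Nc P l)%N) <= _)%R); last first.
    apply: tail_few => //; rewrite mE ler_pdivrMr //.
    by move: Ld f1; rewrite -!(ler_nat R) !natrM; lra.
  apply: Pw_le => // l _ _; rewrite /G1 f1 fl implyTb.
  case: ltnP => //= h; rewrite -ltnNge => f3.
  have : 1 * L <= 4 * itau p * L by rewrite leq_mul2r; lia.
  by move: f3; rewrite /iH; lia.
(* Between [2 * d] and [iH] both implications of [G1] hold whatever is drawn. *)
have [f2|f2] := leqP (fplus p k pw sg) (iH p).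
  rewrite (_ : (fun l => _) = (fun=> false)); last first.
    by apply: funext => l; rewrite /G1 f2 implybT andbT leqNgt f1.
  by rewrite /Pw Ew_const // invr_ge0 exprn_ge0.
apply: le_trans (_ : (PwB Nc (fun l => (hits Nc P l <= itau p)%N) <= _)%R); last first.
  apply: tail_many => //; rewrite mE ler_pdivlMr //.
  by move: f2; rewrite /iH -(ltr_nat R) !natrM; lra.
apply: Pw_le => // l _ _; rewrite /G1 fl (leqNgt (fplus _ _ _ _)) f1 /= implybE.
by rewrite negb_or negbK => /andP[/ltnW].
Qed.

Let K0 : K = (64 * (c1 * lg))%N. Proof. by rewrite /iK mulnA. Qed.

(** [(4/5) ^ 64 <= 1/2], and [iK] has a factor 64. *)
Lemma tail_half_err m (P : nat -> nat -> bool) : m = K ->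
  (forall i, i < m -> (pr1 R B (P i) <= 1/8)%R) ->
  (PwB m (fun l => (m <= 2 * hits m P l)%N) <= err)%R.
Proof.
move=> mK h; apply: le_trans (tail_half B0 h) _; rewrite mK K0 exprM -exprVn.
by rewrite lerXn2r ?nnegrE ?exprn_ge0 //; lra.
Qed.

Section Draw.
Variables (l : nat).
Hypothesis ll : l < lam.

Lemma iM_split : iM p = (Nc + l * K) + (K + ((lam - l.+1) * K + Nc * LB)).
Proof.
rewrite /iM; have -> : lam * K = l * K + (K + (lam - l.+1) * K).
  by rewrite -mulSn -mulnDl; congr (_ * _); lia.
by lia.
Qed.

Lemma trun_pre l1 l2 : size l1 = Nc + l * K ->
  trun p (nt (l1 ++ l2)) k pw l = trun p (nt l1) k pw l.
Proof. by move=> s1; apply: trun_ext => i il; rewrite nth_cat s1 il. Qed.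

Lemma draws_pre T l1 l2 l3 : size l1 = Nc + l * K -> size l2 = K ->
  draws p (nt (l1 ++ (l2 ++ l3))) T l = [seq nth 0 T (nth 0 l2 kk %% size T) | kk <- iota 0 K].
Proof.
move=> s1 s2; apply/eq_in_map => kk; rewrite mem_iota add0n => h.
rewrite nth_cat s1 ltnNge leq_addr /= addKn nth_cat s2; case/andP: h => _ ->.
by [].
Qed.

Lemma sg0_pre l1 l2 : size l1 = Nc + l * K ->
  sg0 p (nt (l1 ++ l2)) k pw = sg0 p (nt l1) k pw.
Proof.
by move=> s1; apply: sg0_ext => c cN; rewrite nth_cat s1 (_ : c < _ = true) //; lia.
Qed.

Lemma sizeT om : 0 < size (trun p om k pw l).1.1 <= B.
Proof.
have [uT sT bT] := trun_inv om wfp vl (ltnW ll); rewrite sT /=.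
apply: leq_trans (_ : 2 * iZ p + 1 <= _); last by lia.
rewrite -(size_iota 0 (2 * iZ p + 1)); apply: uniq_leq_size => // z /bT.
have : 2 * W * l <= iZ p by rewrite /iZ; nia.
by rewrite mem_iota; lia.
Qed.

Lemma count_nth (T : seq nat) (Q : pred nat) :
  count (fun i => Q (nth 0 T i)) (iota 0 (size T)) = count Q T.
Proof. by rewrite -{3}(mkseq_nth 0 T) count_map. Qed.

(** [T] is fixed before its draws. An overlap below 1/16 rarely looks like a half, one above 15/16
    rarely like less, and in between [G2] cannot fail. *)
Lemma P_G2 sg : (PwB (iM p) (fun l' => ~~ G2 p (nt l') k pw l sg) <= err)%R.
Proof.
rewrite iM_split.
pose Q (l1 : seq nat) z := z + sg - sg0 p (nt l1) k pw \in (trun p (nt l1) k pw l).1.1.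
pose P l1 (kk v : nat) := let T := (trun p (nt l1) k pw l).1.1 in Q l1 (nth 0 T (v %% size T)).
pose G l1 l2 := let T := (trun p (nt l1) k pw l).1.1 in
  if 2 * hits K (P l1) l2 < K then 16 * count (Q l1) T <= 15 * size T
  else size T <= 16 * count (Q l1) T.
apply: (@Pw_group R B B0 _ _ _ _ (fun l1 l2 => ~~ G l1 l2)) => [l1 l2 l3 s1 s2|l1 s1].
  rewrite /G2 trun_pre // draws_pre // /G /ovl /cntU sg0_pre // count_map.
  by [].
have /andP[T0 TB] := sizeT (nt l1).
rewrite /G; have [o1|o1] := ltnP (16 * count (Q l1) (trun p (nt l1) k pw l).1.1) (size (trun p (nt l1) k pw l).1.1).
  apply: le_trans (tail_half_err (erefl K) (P := P l1) _); last first.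
    move=> i _; apply: (pr1_mod_le (Q := fun i => Q l1 (nth 0 (trun p (nt l1) k pw l).1.1 i))) => //.
    rewrite (count_nth _ (Q l1)).
    by lia.
  apply: Pw_le => // l2 _ _; case: ltnP => //; lia.
have [o2|o2] := leqP (16 * count (Q l1) (trun p (nt l1) k pw l).1.1) (15 * size (trun p (nt l1) k pw l).1.1).
  rewrite (_ : (fun l => _) = (fun=> false)); last by apply: funext => l2; case: ifP.
  by rewrite /Pw Ew_const // invr_ge0 exprn_ge0.
apply: le_trans (tail_half_err (erefl K) (P := fun kk v => ~~ P l1 kk v) _); last first.
  move=> i _; apply: (pr1_mod_le (Q := fun i => ~~ Q l1 (nth 0 (trun p (nt l1) k pw l).1.1 i))) => //.
  rewrite (count_nth _ (predC (Q l1))).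
  by have := count_predC (Q l1) (trun p (nt l1) k pw l).1.1; lia.
apply: Pw_le => // l2 _ _; case: (ltnP (2 * hits K (P l1) l2) K) => // h _.
have e : hits K (P l1) l2 + hits K (fun kk v => ~~ P l1 kk v) l2 = K.
  by rewrite -[RHS](size_iota 0); exact: (count_predC (fun i => P l1 i (nth 0 l2 i))).
by move: h e; lia.
Qed.

(** It is unlikely that all [K] draws miss a subset of density 1/32. [Q] receives the words
    preceding the draws because the subset depends on [sg0]. *)
Lemma P_avoid (Q : seq nat -> seq nat -> pred nat) :
  (PwB (iM p) (fun l' => let T := (trun p (nt l') k pw l).1.1 in
     ~~ (has (Q (take (Nc + l * K)%N l') T) (draws p (nt l') T l)) &&
     (size T <= 32 * count (Q (take (Nc + l * K)%N l') T) T)%N) <= err)%R.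
Proof.
rewrite iM_split.
pose T l1 := (trun p (nt l1) k pw l).1.1.
pose P l1 (kk v : nat) := Q l1 (T l1) (nth 0 (T l1) (v %% size (T l1))).
pose G l1 l2 := (hits K (P l1) l2 == 0) && (size (T l1) <= 32 * count (Q l1 (T l1)) (T l1)).
apply: (@Pw_group R B B0 _ _ _ _ (fun l1 l2 => G l1 l2)) => [l1 l2 l3 s1 s2 /=|l1 s1].
  rewrite trun_pre // draws_pre // -s1 take_size_cat // /G -/(T l1) => /andP[h ->].
  by rewrite andbT /hits eqn0Ngt -has_count; move: h; rewrite has_map.
have /andP[T0 TB] := sizeT (nt l1).
rewrite /G; case: leqP => [h|_]; last first.
  rewrite (_ : (fun l => _) = (fun=> false)); last by apply: funext => l2; rewrite andbF.
  by rewrite /Pw Ew_const // invr_ge0 exprn_ge0.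
apply: le_trans (@tail_none R B B0 K (P l1) (c1 * lg) _ _); last first.
- by rewrite K0.
- move=> i _; apply: (pr1_mod_ge (Q := fun i => Q l1 (T l1) (nth 0 (T l1) i))) => //.
  by rewrite (count_nth _ (Q l1 (T l1))).
by apply: Pw_le => // l2 _ _; rewrite andbT.
Qed.

Lemma P_G3 i : (PwB (iM p) (fun l' => ~~ G3 p (nt l') k pw l i) <= err + err)%R.
Proof.
pose QX (l1 : seq nat) (T : seq nat) z := nth 0 (iX p) i != nth 0 (iY p) (i + W + iZ p - sg0 p (nt l1) k pw - z).
pose QY (l1 : seq nat) (T : seq nat) z := nth 0 (iY p) i != nth 0 (iY p) (i + iZ p - z).
apply: le_trans (lerD (P_avoid QX) (P_avoid QY)).
apply: le_trans (Pw_or R B0 _ _ _).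
apply: Pw_le => // l' sl _; rewrite /G3 negb_and !negb_or -!leqNgt /=.
have e : sg0 p (nt l') k pw = sg0 p (nt (take (Nc + l * K) l')) k pw.
  by apply: sg0_ext => c cN; rewrite nth_take //; lia.
by rewrite /hvX /badX /hvY /badY /QX /QY -e.
Qed.

End Draw.

(** [Mf] stands for a set determined by flags and tests, so the words that place the samples in
    their blocks are independent of it. *)
Lemma P_dev (Mf : (nat -> nat) -> pred nat) :
  (forall om om', (forall i, i < Nc + lam * K -> om i = om' i) -> Mf om = Mf om') ->
  (PwB (iM p) (fun l => ~~ dev p (nt l) (Mf (nt l))) <= err + err)%R.
Proof.
move=> Mext; have -> : iM p = (Nc + lam * K) + (Nc * LB + 0) by rewrite /iM; lia.
pose h M l2 := hits (Nc * LB) (fun bb v => M (bb * bet + v %% bet)) l2.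
pose G (M : pred nat) l2 := let N := count M (iota 0 (Nc * L)) in
  if N <= 4 * d then (16 * q * lg * (bet * h M l2 - N) <= d) && (16 * q * lg * (N - bet * h M l2) <= d)
  else 2 * d <= bet * h M l2.
apply: (@Pw_group R B B0 _ _ _ _ (fun l1 l2 => ~~ G (Mf (nt l1)) l2)) => [l1 l2 l3 s1 s2|l1 s1].
  have e : Mf (nt (l1 ++ (l2 ++ l3))) = Mf (nt l1).
    by apply: Mext => i il; rewrite nth_cat s1 il.
  rewrite /dev /G e /h /hits; move: (Mf _) => M.
  rewrite (_ : count (fun bb => M (posD p (nt (l1 ++ (l2 ++ l3))) bb)) _ =
     count (fun bb => M (bb * bet + nth 0 l2 bb %% bet)) (iota 0 (Nc * LB))) //.
  apply: eq_in_count => bb; rewrite mem_iota add0n => /andP[_ hb].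
  by rewrite /posD nth_cat s1 ltnNge leq_addr /= addKn nth_cat s2 hb.
move: (Mf _) => M {Mf Mext}; rewrite /G; set N := count M _.
have LBb : LB * bet = L by rewrite /iLB divnK //; case: wfp => _ [].
have e0 : (0 <= err)%R by rewrite invr_ge0 exprn_ge0.
(* With blocks of length 1 the samples exhaust the set, and nothing can deviate. *)
case: (wfp) => -[l0 w0 d0 _ LL] [_ _ q0 c10 [b1|bd]].
  have hN l2 : bet * h M l2 = N.
    rewrite b1 mul1n /h /hits b1 /N -LBb b1 muln1; apply: eq_count => bb.
    by rewrite muln1 modn1 addn0.
  rewrite (_ : (fun l => _) = (fun=> false)).
    by rewrite /Pw Ew_const // addr_ge0.
  apply: funext => l2; rewrite hN subnn muln0 /=; case: ifP => // /negbT; lia.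
have mE : mean R B (Nc * LB) (fun bb v => M (bb * bet + v %% bet)%N) = (N%:R / bet%:R)%R.
  by rewrite (mean_blocks M) // -mulnA LBb.
have bR : (0 < bet%:R :> R)%R by rewrite ltr0n.
have qR : (1 <= q%:R :> R)%R by rewrite ler1n.
have lR : (1 <= lg%:R :> R)%R by rewrite ler1n.
have dR : (0 < d%:R :> R)%R by rewrite ltr0n.
set r := (d%:R / bet%:R : R)%R.
have rb : (r * bet%:R = d%:R)%R by rewrite /r divfK // gt_eqF.
have bd' : (64 * 128 * (c1 * lg)%:R * (q%:R * lg%:R) ^+ 2 <= r :> R)%R.
  rewrite /r ler_pdivlMr //; move: bd; rewrite -(ler_nat R) => bd; apply: le_trans bd.
  by rewrite !natrM ?natrX; lra.
set u := (q%:R * lg%:R : R)%R in bd'.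
have u1 : (1 <= u)%R by rewrite /u -[leLHS]mulr1 ler_pM.
have c1R : (0 <= (c1 * lg)%:R :> R)%R by [].
(* For [N > 4 d] the mean is at least [4 r] and has to fall to [2 r]; with [a = 1/8] the exponent is
   at most [- mean / 32]. *)
case: leqP => N4; last first.
  apply: le_trans (_ : err <= _)%R; last by rewrite lerDl.
  apply: le_trans (@tail_dn R B B0 (Nc * LB) (fun bb v => M (bb * bet + v %% bet)%N) (1/8)%R (2 * r)%R _ _ _ _) _.
  - lra.
  - lra.
  - move=> l2; rewrite -ltnNge -(ltr_nat R) !natrM -/(h M l2) => hh.
    by rewrite -(ler_pM2r bR) -mulrA rb mulrC ltW.
  rewrite mE; have : (4 * r <= N%:R / bet%:R)%R.
    by rewrite ler_pdivlMr // -mulrA rb; move: N4; rewrite -(ltr_nat R) natrM; lra.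
  set mu := (N%:R / bet%:R : R)%R => hm.
  apply: le_trans (@expRN_le R (c1 * lg) (mu / 32) _); first by rewrite ler_expR; lra.
  have : ((c1 * lg)%:R * 1 <= (c1 * lg)%:R * u ^+ 2)%R by rewrite ler_wpM2l // expr2 -[leLHS]mulr1 ler_pM.
  by lra.
have mu4 : (N%:R / bet%:R <= 4 * r)%R.
  by rewrite ler_pdivrMr // -mulrA rb; move: N4; rewrite -(ler_nat R) natrM.
have u0 : (0 < u)%R by lra.
set a := (1 / (256 * u))%R.
have a0 : (0 < a)%R by rewrite divr_gt0 // mulr_gt0.
have a2 : (a <= 1/2)%R.
  by rewrite /a ler_pdivrMr ?mulr_gt0 //; lra.
set del := (r / (16 * u))%R.
have key : (2 * a ^+ 2 * (4 * r) - a * del <= - (c1 * lg)%:R)%R.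
  have -> : (2 * a ^+ 2 * (4 * r) - a * del = - (r / (64 * 128 * u ^+ 2)))%R.
    by rewrite /a /del dev_exponent // gt_eqF.
  rewrite lerN2 ler_pdivlMr; last by rewrite mulr_gt0 ?exprn_gt0 //; lra.
  by lra.
have muge : (0 <= N%:R / bet%:R :> R)%R by rewrite divr_ge0.
have Ndel : ((N%:R / bet%:R + del) * bet%:R = N%:R + d%:R / (16 * u))%R.
  by rewrite mulrDl divfK ?gt_eqF // /del mulrAC rb.
have Ndel' : ((N%:R / bet%:R - del) * bet%:R = N%:R - d%:R / (16 * u))%R.
  by rewrite mulrBl divfK ?gt_eqF // /del mulrAC rb.
apply: le_trans (_ : PwB (Nc * LB) (fun l => ~~ (16 * q * lg * (bet * h M l - N) <= d)%N) +
   PwB (Nc * LB) (fun l => ~~ (16 * q * lg * (N - bet * h M l) <= d)%N) <= _)%R.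
  apply: le_trans (Pw_or R B0 _ _ _); apply: Pw_le => // l _ _; by rewrite negb_and.
apply: lerD.
  apply: le_trans (@tail_up R B B0 (Nc * LB) (fun bb v => M (bb * bet + v %% bet)%N) a (N%:R / bet%:R + del)%R _ a0 a2 _) _.
    move=> l2; rewrite -ltnNge => hh; rewrite -(ler_pM2r bR) Ndel -/(h M l2).
    have hN : N <= bet * h M l2 by exact: mul_sub_gt hh.
    rewrite -lerBrDl ler_pdivrMr; last by lra.
    move: hh; rewrite -(ltr_nat R) !natrM natrB // natrM => hh.
    by apply: ltW; apply: lt_le_trans hh _; rewrite /u; lra.
  rewrite mE; apply: le_trans (expRN_le (x := (c1 * lg)%:R) (lexx _)); rewrite ler_expR.
  apply: le_trans key; rewrite mulrDl.
  set mu := (N%:R / bet%:R : R)%R in mu4 muge *.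
  have : (2 * a ^+ 2 * mu <= 2 * a ^+ 2 * (4 * r))%R by rewrite ler_wpM2l // mulr_ge0 // exprn_ge0 // ltW.
  by lra.
apply: le_trans (@tail_dn R B B0 (Nc * LB) (fun bb v => M (bb * bet + v %% bet)%N) a (N%:R / bet%:R - del)%R _ a0 a2 _) _.
  move=> l2; rewrite -ltnNge => hh; rewrite -(ler_pM2r bR) Ndel' -/(h M l2).
  have hN : bet * h M l2 <= N by exact: mul_sub_gt hh.
  rewrite lerBrDl -lerBrDr ler_pdivrMr; last by lra.
  move: hh; rewrite -(ltr_nat R) !natrM natrB // natrM => hh.
  by apply: ltW; apply: lt_le_trans hh _; rewrite /u; lra.
rewrite mE; apply: le_trans (expRN_le (x := (c1 * lg)%:R) (lexx _)); rewrite ler_expR.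
apply: le_trans key; rewrite mulrDl.
set mu := (N%:R / bet%:R : R)%R in mu4 muge *.
have : (2 * a ^+ 2 * mu <= 2 * a ^+ 2 * (4 * r))%R by rewrite ler_wpM2l // mulr_ge0 // exprn_ge0 // ltW.
by lra.
Qed.

End Bad.

Section Union.
Variables (R : realType) (p : inst) (b : nat).
Local Notation B := (2 ^ b)%N.
Local Notation lg := (ilg p). Local Notation c1 := (ic1 p). Local Notation Nc := (iNc p).
Local Notation nt l := (fun i => nth 0 l i).
Hypothesis wfp : wf p.
Hypothesis LB2 : iL p %| B.
Hypothesis ZB : 2 * iZ p < B.
Hypothesis nlg : size (iX p) + size (iY p) < 2 ^ lg.

Definition bad1 k pw l :=
  [|| has (fun sg => ~~ G1 p (nt l) k pw sg) (iota 0 (iS p)),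
      has (fun m => has (fun sg => ~~ G2 p (nt l) k pw m sg) (iota 0 (iS p))) (iota 0 (ilam p)),
      has (fun m => has (fun i => ~~ G3 p (nt l) k pw m i) (iota 0 (Nc * iL p))) (iota 0 (ilam p)) |
      has (fun sg => ~~ G4 p (nt l) k pw sg) (iota 0 (iS p))].
(** All intervals use the same random words, so their bad events are joined; levels from [lg] on
    contain no valid interval. *)
Definition bad l := has (fun k => has (fun j => valid p k (2 ^ j) && bad1 k (2 ^ j) l)
  (iota 0 lg)) (iota 0 Nc).

Let NcL : Nc * iL p < 2 ^ lg.
Proof.
by apply: leq_ltn_trans nlg; apply: leq_trans (leq_divM _ _) _; lia.
Qed.

Lemma notbad_good l k j : ~~ bad l -> valid p k (2 ^ j) -> good p (nt l) k (2 ^ j).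
Proof.
move=> nb v; have /andP[k2 kN] := v.
have L0 : 0 < iL p by case: wfp => -[] l0 w0 d0 _ LL _; apply: leq_trans LL; rewrite !muln_gt0 l0 w0 d0.
have jl : j < lg.
  rewrite -(ltn_exp2l _ _ (isT : 1 < 2)); apply: leq_trans NcL; rewrite ltnS.
  by apply: leq_trans (leq_pmulr _ L0); lia.
have : ~~ bad1 k (2 ^ j) l.
  move: nb; rewrite /bad -all_predC => /allP/(_ k); rewrite mem_iota => /(_ ltac:(lia)) /=.
  by rewrite -all_predC => /allP/(_ j); rewrite mem_iota jl /= v => /(_ isT).
rewrite /bad1 !negb_or => /and4P[]; rewrite -!all_predC => /allP h1 /allP h2 /allP h3 /allP h4.
split.
- by move=> sg sl; apply/negPn; apply: h1; rewrite mem_iota.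
- move=> m sg ml sl; have := h2 m; rewrite mem_iota ml => /(_ isT) /=.
  by rewrite -all_predC => /allP/(_ sg); rewrite mem_iota sl /= => /(_ isT)/negPn.
- move=> m i ml il; have := h3 m; rewrite mem_iota ml => /(_ isT) /=.
  by rewrite -all_predC => /allP/(_ i); rewrite mem_iota il /= => /(_ isT)/negPn.
- by move=> sg sl; apply/negPn; apply: h4; rewrite mem_iota.
Qed.

Local Open Scope ring_scope.
Let err : R := 2 ^- (c1 * lg).
Let e0 : 0 <= err. Proof. by rewrite invr_ge0 exprn_ge0. Qed.
Let B0 : (0 < B)%N. Proof. by rewrite expn_gt0. Qed.

(** [5 * iS] is one event per shift for [G1] and four for [G4]: two sets, with an upper and a lower
    tail each. *)
Lemma P_bad1 k pw : valid p k pw ->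
  Pw R B (iM p) (bad1 k pw) <=
  (5 * iS p + ilam p * iS p + 2 * (ilam p * (Nc * iL p)))%N%:R * err.
Proof.
move=> v; rewrite /bad1.
have h1 : Pw R B (iM p) (fun l => has (fun sg => ~~ G1 p (nt l) k pw sg) (iota 0 (iS p))) <= (iS p)%:R * err.
  by rewrite -{2}(size_iota 0%N (iS p)); apply: Pw_has => // sg _; exact: P_G1.
have h2 : Pw R B (iM p) (fun l => has (fun m => has (fun sg => ~~ G2 p (nt l) k pw m sg) (iota 0 (iS p))) (iota 0 (ilam p))) <=
   (ilam p)%:R * ((iS p)%:R * err).
  rewrite -{2}(size_iota 0%N (ilam p)); apply: Pw_has => // m; rewrite mem_iota => /andP[_ ml].
  rewrite -{2}(size_iota 0%N (iS p)); apply: Pw_has => // sg _; exact: P_G2.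
have h3 : Pw R B (iM p) (fun l => has (fun m => has (fun i => ~~ G3 p (nt l) k pw m i) (iota 0 (Nc * iL p)%N)) (iota 0 (ilam p))) <=
   (ilam p)%:R * ((Nc * iL p)%N%:R * (err + err)).
  rewrite -{2}(size_iota 0%N (ilam p)); apply: Pw_has => // m; rewrite mem_iota => /andP[_ ml].
  rewrite -{2}(size_iota 0%N (Nc * iL p)%N); apply: Pw_has => // i _; exact: P_G3.
have h4 : Pw R B (iM p) (fun l => has (fun sg => ~~ G4 p (nt l) k pw sg) (iota 0 (iS p))) <=
   (iS p)%:R * ((err + err) + (err + err)).
  rewrite -{2}(size_iota 0%N (iS p)); apply: Pw_has => // sg _.
  have ext om om' : (forall i, (i < Nc + ilam p * iK p)%N -> om i = om' i) ->
      tU p om k pw = tU p om' k pw /\ sg0 p om k pw = sg0 p om' k pw.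
    move=> e; rewrite /tU (trun_ext wfp LB2 ZB v e); split=> //; apply: (sg0_ext wfp LB2 ZB v) => c cN.
    by apply: e; lia.
  apply: le_trans (lerD (P_dev R wfp LB2 ZB v (Mf := fun om => mxp p om k pw sg) _)
     (P_dev R wfp LB2 ZB v (Mf := fun om => myp p om k pw sg) _)).
  - apply: le_trans (Pw_or R B0 _ _ _); apply: Pw_le => // l _ _.
    by rewrite /G4 negb_and.
  - by move=> om om' /ext[e1 e2]; apply: funext => i; rewrite /mxp /hvX e1 e2.
  - by move=> om om' /ext[e1 e2]; apply: funext => i; rewrite /myp /ymis /hvY /hvX e1 e2.
apply: le_trans (Pw_or R B0 _ _ _) _; apply: le_trans (lerD h1 (Pw_or R B0 _ _ _)) _.
apply: le_trans (lerD (lexx _) (lerD h2 (Pw_or R B0 _ _ _))) _.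
apply: le_trans (lerD (lexx _) (lerD (lexx _) (lerD h3 h4))) _.
clear; move: (iS p) (ilam p) (Nc * iL p)%N err => a1 a2 a3 e.
by rewrite le_eqVlt; apply/orP; left; apply/eqP; rewrite !natrD !natrM; ring.
Qed.

(** [W], [lg] and the number of positions are below [2 ^ lg], so a power [2 ^ (14 * lg)] generously
    counts the events. *)
Lemma P_bad : Pw R B (iM p) bad <= (2 ^ (14 * lg))%N%:R * err.
Proof.
set u := (5 * iS p + ilam p * iS p + 2 * (ilam p * (Nc * iL p)))%N.
apply: (@le_trans _ _ (Nc%:R * (lg%:R * (u%:R * err)))).
  apply: le_trans (Pw_has B0 (p := lg%:R * (u%:R * err)) _) _; last by rewrite size_iota.
  move=> k _.
  apply: le_trans (Pw_has B0 (p := u%:R * err) _) _; last by rewrite size_iota.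
  move=> j _.
  case v : (valid p k (2 ^ j)); first exact: P_bad1.
  by rewrite /Pw Ew_const // mulr_ge0.
rewrite !mulrA ler_wpM2r // -!natrM ler_nat /u [(14 * lg)%N]mulnC expnM.
have WW : (iW p < 2 ^ lg)%N by case: wfp => -[].
have lg2 : (lg < 2 ^ lg)%N by exact: ltn_expl.
have l0 : (0 < lg)%N by case: wfp => -[].
have L0 : (0 < iL p)%N by case: wfp => -[] _ w0 d0 _ LL _; apply: leq_trans LL; rewrite !muln_gt0 l0 w0 d0.
have e1 : (2 <= 2 ^ lg)%N by rewrite -{1}(expn1 2) leq_exp2l.
have Nl : (Nc <= 2 ^ lg)%N by apply: leq_trans (ltnW NcL); exact: leq_pmulr.
have NcL' := NcL; rewrite /iS /ilam.
move: (2 ^ lg)%N (Nc * iL p)%N WW lg2 e1 Nl NcL' => v m WW lg2 e1 Nl NcL'.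
have -> : (v ^ 14 = v * v * (v * v * v ^ 10))%N by rewrite -!mulnA -!expnS.
have : (2 ^ 10 <= v ^ 10)%N by rewrite leq_exp2r.
have -> : (2 ^ 10 = 16 * 64)%N by [].
move: (v ^ 10)%N => a ha.
apply: leq_mul; first by apply: leq_mul => //; exact: ltnW.
apply: (@leq_trans (v * v * (16 * 64))%N); last by rewrite leq_mul2l ha orbT.
have g1 : (lg * iW p <= v * v)%N by apply: leq_mul; exact: ltnW.
have g2 : (lg * m <= v * v)%N by apply: leq_mul; exact: ltnW.
have g3 : (2 * v <= v * v)%N by rewrite leq_mul2r e1 orbT.
by lia.
Qed.

End Union.
End BadEvents.

(** * Preprocessing of one interval: programs and correctness *)

Notation "% i" := (Reg i) (at level 5, i at level 0, format "% i").
Notation "# k" := (Const k) (at level 5, k at level 0, format "# k").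
Notation "a +' b" := (Binop Add a b) (at level 50, left associativity).
Notation "a -' b" := (Binop Defs.Sub a b) (at level 50, left associativity).
Notation "a *' b" := (Binop Mul a b) (at level 40, left associativity).
Notation "a /' b" := (Binop Div a b) (at level 40, left associativity).
Notation "a %%' b" := (Binop Mod a b) (at level 40, left associativity).
Notation "a <' b" := (Binop Lt a b) (at level 70).
Notation "a =' b" := (Binop Eq a b) (at level 70).
Notation "i <~ e" := (Assign i e) (at level 75).
Notation "c1 ;; c2" := (Seq c1 c2) (at level 80, right associativity).

(** Removes innermost reductions modulo [2 ^ b] whose argument [lia] bounds from the context. *)
Ltac mds := repeat match goal with |- context [modn ?x (expn 2 ?n)] =>
  lazymatch x with context [modn _ (expn 2 _)] => fail
  | _ => rewrite (@modn_small x (expn 2 n)); [ | by lia] end end.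

Lemma filter_iotaSr (P : pred nat) m :
  [seq x <- iota 0 m.+1 | P x] = [seq x <- iota 0 m | P x] ++ (if P m then [:: m] else [::]).
Proof. by rewrite -addn1 iotaD filter_cat. Qed.

Lemma take_nthS (U : seq nat) m : m < size U -> take m.+1 U = rcons (take m U) (nth 0 U m).
Proof. by move=> mU; rewrite (take_nth 0 mU). Qed.

Definition same (lo n : nat) (m m' : nat -> nat) : Prop :=
  forall a, (a < lo) || (lo + n <= a) -> m' a = m a.

Lemma count_iotaSr (P : pred nat) a m : count P (iota a m.+1) = count P (iota a m) + P (a + m).
Proof. by rewrite -addn1 iotaD count_cat /= addn0. Qed.

Definition c_hits : cmd :=
  41 <~ #0 ;;
  For 42 (%31 +' #2)
    (43 <~ %32 +' %42 -' #1 ;;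
     43 <~ %43 *' %11 +' LoadMem (%22 +' %43) %%' %11 ;;
     If (ReadX %43 =' ReadY (%43 +' %8 -' %40)) Skip (41 <~ %41 +' #1)).

Definition c_flags : cmd :=
  34 <~ #0 ;;
  For 40 %17
    (c_hits ;;
     StoreMem (%33 +' #3 +' %40) (%41 <' %14) ;;
     If (%41 <' %14) (34 <~ %40) Skip).

(** All intervals reuse one membership table for [T]. *)
Definition c_clear : cmd := For 40 (#2 *' %16 +' #1) (StoreMem (%20 +' %40) #0).

Definition c_init : cmd :=
  c_clear ;; StoreMem %21 %16 ;; StoreMem (%20 +' %16) #1 ;; 35 <~ #1 ;; 36 <~ #0.

Definition c_draw : cmd :=
  For 40 %13
    (41 <~ LoadMem (%23 +' %37 *' %13 +' %40) %%' %35 ;;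
     StoreMem (%33 +' #3 +' %17 +' %40) (LoadMem (%21 +' %41))).

Definition c_cnt : cmd :=
  42 <~ #0 ;;
  For 43 %13
    (If (LoadMem (%20 +' (LoadMem (%33 +' #3 +' %17 +' %43) +' %40 -' %34)))
        (42 <~ %42 +' #1) Skip).

(** The initial value [S] is not a shift and signals that no shift is [low]. *)
Definition c_sel : cmd :=
  41 <~ %17 ;;
  For 40 %17
    (If (LoadMem (%33 +' #3 +' %40))
        (c_cnt ;; If (%42 +' %42 <' %13) (41 <~ %40) Skip) Skip).

(** Register 44 keeps the old size, as register 35 grows in the loop. The table is read while it is
    being extended, which is harmless because translation is injective. *)
Definition c_grow : cmd :=
  44 <~ %35 ;;
  For 40 %44
    (45 <~ LoadMem (%21 +' %40) +' %41 -' %34 ;;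
     If (LoadMem (%20 +' %45)) Skip
        (StoreMem (%20 +' %45) #1 ;; StoreMem (%21 +' %35) %45 ;; 35 <~ %35 +' #1)).

Definition c_round : cmd :=
  If (%36 =' #0) (c_draw ;; c_sel ;; If (%41 =' %17) (36 <~ #1) c_grow) Skip.

Definition c_tests : cmd := c_init ;; For 37 %15 c_round.

Definition c_hv (rd : expr -> expr) : cmd :=
  42 <~ #0 ;;
  For 43 %13
    (If (rd %41 =' ReadY (%41 +' %48 -' LoadMem (%33 +' #3 +' %17 +' %43))) Skip (42 <~ #1)).

Definition c_list (rd : expr -> expr) : cmd :=
  46 <~ #0 ;;
  For 40 %50
    (41 <~ (%49 +' %40) *' %10 +' LoadMem (%24 +' (%49 +' %40)) %%' %10 ;;
     c_hv rd ;;
     If %42 (StoreMem (%51 +' %46) %41 ;; 46 <~ %46 +' #1) Skip).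

(** Layout of a record: [sg0], the lengths of the two lists, the flags, the tests, then both
    lists. *)
Definition c_process : cmd :=
  33 <~ %19 +' (%30 *' (%12 +' #1) +' %32) *' %18 ;;
  c_flags ;; c_tests ;;
  48 <~ %8 +' %16 -' %34 ;; 49 <~ %32 *' %25 ;; 50 <~ %31 *' %25 ;;
  51 <~ %33 +' #3 +' %17 +' %13 ;;
  c_list ReadX ;;
  StoreMem %33 %34 ;; StoreMem (%33 +' #1) %46 ;;
  48 <~ %16 ;; 49 <~ (%32 -' #1) *' %25 ;; 50 <~ (%31 +' #2) *' %25 ;;
  51 <~ %51 +' %46 ;;
  c_list ReadY ;;
  StoreMem (%33 +' #2) %46.

Section Pre.
Variables (R : realType) (b : nat) (eps : R) (p : inst) (om : nat -> nat).
Local Notation X := (iX p). Local Notation Y := (iY p).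
Local Notation d := (idd p). Local Notation W := (iW p).
Local Notation lg := (ilg p). Local Notation q := (iq p).
Local Notation bet := (ibet p). Local Notation L := (iL p).
Local Notation Nc := (iNc p). Local Notation K := (iK p). Local Notation Z := (iZ p).
Local Notation S := (iS p). Local Notation LB := (iLB p). Local Notation lam := (ilam p).
Local Notation runs := (runs b X Y eps).
Local Notation eval := (eval b X Y eps).

Definition aTM := 64.
Definition aTL := aTM + (2 * Z + 1).
Definition aBA := aTL + (2 * Z + 1).
Definition aBB := aBA + Nc.
Definition aBD := aBB + lam * K.
Definition aRB := aBD + Nc * LB.
(** Record space per chunk: the lists of an interval have at most [pw * LB] and [(pw + 2) * LB]
    entries, together at most [4 * pw * LB]. *)
Definition iRS := 3 + S + K + 4 * LB.
(** The address is computed from level and first chunk, without a directory. Records of one level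
    are disjoint because their intervals are. *)
Definition abase j k := aRB + (j * (Nc + 1) + k) * iRS.
(** Beyond the last record there is room for string positions, offsets, [L] and [d], so a single
    hypothesis excludes wraparound. *)
Definition aTOP := aRB + (lg * (Nc + 1) + (Nc + 1)) * iRS + (size X + size Y) + 4 * Z + L + d.

Hypothesis wfp : wf p.
Hypothesis HB : aTOP < 2 ^ b.

(** A product of equations in [Type], so that [rewrite !g] uses whichever of them fits. *)
Definition glob (s : state) : Type :=
  (regs s 7 = lg) * (regs s 8 = W) * (regs s 9 = q) * (regs s 10 = bet) * (regs s 11 = L) *
  (regs s 12 = Nc) * (regs s 13 = K) * (regs s 14 = itau p) * (regs s 15 = lam) * (regs s 16 = Z) *
  (regs s 17 = S) * (regs s 18 = iRS) * (regs s 19 = aRB) * (regs s 20 = aTM) * (regs s 21 = aTL) *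
  (regs s 22 = aBA) * (regs s 23 = aBB) * (regs s 24 = aBD) * (regs s 25 = LB).

Lemma glob_frame s s' : (forall r, r < 30 -> regs s' r = regs s r) -> glob s -> glob s'.
Proof. by move=> e g; rewrite /glob !e // !g. Qed.

Lemma glob_fr s s' l : (forall r, r \notin l -> regs s' r = regs s r) -> all (leq 30) l ->
  glob s -> glob s'.
Proof.
move=> fr /allP al; apply: glob_frame => r r30; apply: fr; apply/negP => /al.
by rewrite leqNgt r30.
Qed.

Lemma glob_set s r v : 30 <= r -> glob s -> glob (set_reg s r v).
Proof.
move=> r30; apply: glob_frame => r' h; rewrite regs_set; case: eqP => // e.
by move: r30; rewrite -e leqNgt h.
Qed.

Definition memR (m : nat -> nat) := forall i, i < iM p -> m (aBA + i) = om i.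

Lemma bnd : [/\ 64 < 2 ^ b, 2 * W <= Z, aBA + iM p + iRS <= aTOP & aBA = 64 + 4 * Z + 2]
  /\ [/\ aTL = 65 + 2 * Z, aRB = aBA + iM p, size X + size Y + 4 * Z + L + d + aRB + iRS <= aTOP & 
      S = 2 * W + 1].
Proof.
have w1 : 2 * W <= Z by rewrite /iZ; nia.
have e1 : aBA = 64 + 4 * Z + 2 by rewrite /aBA /aTL /aTM; lia.
have e2 : aRB = aBA + iM p by rewrite /aRB /aBD /aBB /iM; lia.
have e3 : iRS <= (lg * (Nc + 1) + (Nc + 1)) * iRS by rewrite leq_pmull //; lia.
have e4 : aTL = 65 + 2 * Z by rewrite /aTL /aTM; lia.
have := HB; rewrite /aTOP => h; split; split; rewrite /iS; lia.
Qed.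

Lemma valid_bnd k pw : valid p k pw ->
  [/\ 2 <= k, k + pw + 2 <= Nc, (k + pw + 2) * L <= Nc * L, Nc * L <= size X & Nc * L <= size Y].
Proof.
move=> /andP[k2 kN]; have : Nc * L <= minn (size X) (size Y) by rewrite /iNc leq_divM.
by rewrite leq_min => /andP[h1 h2]; split=> //; rewrite leq_mul2r kN orbT.
Qed.

Section Interval.
Variables (j k pw : nat).
Hypothesis val : valid p k pw.
Hypothesis jlg : j < lg.
Hypothesis pw0 : 0 < pw.

Definition ivl (s : state) : Type :=
  (regs s 30 = j) * (regs s 31 = pw) * (regs s 32 = k) * (regs s 33 = abase j k).

Lemma abase_bnd : abase j k + pw * iRS <= aTOP /\ aRB <= abase j k.
Proof.
have [k2 kN _ _ _] := valid_bnd val; rewrite /abase leq_addr; split=> //.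
have h1 : j.+1 * (Nc + 1) <= lg * (Nc + 1) by rewrite leq_mul2r jlg orbT.
have h2 : (j * (Nc + 1) + k + pw) * iRS <= (lg * (Nc + 1) + (Nc + 1)) * iRS.
  by rewrite leq_mul2r; apply/orP; right; rewrite mulSn in h1; lia.
by move: h2; rewrite /aTOP mulnDl; lia.
Qed.

Lemma ivl_fr s s' l : (forall r, r \notin l -> regs s' r = regs s r) -> all (leq 34) l ->
  ivl s -> ivl s'.
Proof.
move=> fr /allP al g; have e r : r < 34 -> regs s' r = regs s r.
  by move=> h; apply: fr; apply/negP => /al; rewrite leqNgt h.
by rewrite /ivl !e // !g.
Qed.

Lemma ivl_set s r v : 34 <= r -> ivl s -> ivl (set_reg s r v).
Proof.
move=> r34; apply: (@ivl_fr _ _ [:: r]); last by rewrite /= r34.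
by move=> r'; rewrite inE regs_set => /negbTE ->.
Qed.

Let bd := bnd.
Let B64 : 64 < 2 ^ b. Proof. by case: bd => -[]. Qed.
Let vb := valid_bnd val.
Let ab := abase_bnd.
Let NM : Nc <= iM p. Proof. by rewrite /iM leq_addr. Qed.
Let L0 : 0 < L.
Proof. by case: wfp => -[] l0 w0 d0 _ LL _; apply: leq_trans LL; rewrite !muln_gt0 l0 w0 d0. Qed.
Let LW : 2 * W <= L.
Proof.
case: wfp => -[] l0 w0 d0 _ LL _; apply: leq_trans LL.
by rewrite leq_mul2r; apply/orP; right; nia.
Qed.

Lemma hits_ok s sg : glob s -> ivl s -> memR (memory s) -> regs s 40 = sg -> sg < S ->
  runs c_hits s ((pw + 2) * 50 + 20) (fun s' => regs s' 41 =
    count (fun c => mis p sg (posA p om c)) (iota k.-1 (pw + 2))).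
Proof.
move=> g iv mR r40 sgS.
have [[_ w1 w2 w3] [w4 w5 w6 w7]] := bd; have HB' := HB.
have [k2 kN kL NX NY] := vb.
apply: runs_le; first apply: (@runs_set _ _ _ _ _ _ _ _ 0); first by rewrite /= mod0n.
  apply: (runs_For (N := pw + 2) (tb := 35)
    (Inv := fun m s' => regs s' 41 = count (fun c => mis p sg (posA p om c)) (iota k.-1 m))) => //.
  - by lia.
  - by lia.
  - by move=> s' fr _; rewrite /= !fr // !regs_set /= !iv; mds.
  move=> m s' mN r42 fr _ /(_ isT) me I.
  have g' : glob s' by apply: (glob_fr fr) => //; exact: glob_set.
  have iv' : ivl s' by apply: (ivl_fr fr) => //; exact: ivl_set.
  have r40' : regs s' 40 = sg by rewrite fr // regs_set.
  pose c := k.-1 + m.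
  have cN : c < Nc by rewrite /c; lia.
  have cL : c * L + L <= Nc * L by rewrite -mulSnr leq_mul2r cN orbT.
  have rL := ltn_pmod (om c) L0.
  have pA : posA p om c < Nc * L by rewrite /posA; lia.
  have cs : count (fun c => mis p sg (posA p om c)) (iota k.-1 m) <= m.
    by rewrite -[leqRHS](size_iota k.-1 m) count_size.
  apply: runs_le.
    apply: (@runs_set _ _ _ _ _ _ _ _ c).
      by rewrite /= r42 !iv'; mds; rewrite /c; lia.
    apply: (@runs_set _ _ _ _ _ _ _ _ (posA p om c)).
      rewrite /= !g' (modn_small (_ : aBA + c < _)); last by lia.
      by rewrite me mR; [rewrite /posA; mds | lia].
    apply: (@runs_ifb _ _ _ _ _ _ _ _ _ (~~ mis p sg (posA p om c))).
    - by rewrite /= r40' !g' /mis negbK; mds.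
    - move=> ms; apply: runs_skip; rewrite count_iotaSr !regs_set /= I -/c.
      by rewrite (negbTE ms) addn0.
    - rewrite negbK => ms; apply: (@runs_set1 _ _ _ _ _ _ _ _ (count (fun c => mis p sg (posA p om c)) (iota k.-1 m) + 1)).
        by rewrite /= I; mds.
      by rewrite count_iotaSr !regs_set /= -/c ms.
  by [].
rewrite /=; lia.
Qed.

Local Notation base := (abase j k).
Local Notation fl := (flag p om k pw).
Local Notation s0 := (sg0 p om k pw).

Let eRS : iRS = 3 + S + K + 4 * LB. Proof. by []. Qed.
Let bRS : base + iRS <= aTOP.
Proof. by case: ab => h _; apply: leq_trans h; rewrite leq_add2l leq_pmull. Qed.
Let bRB : aBA + iM p <= base.
Proof. by case: ab => _; case: bd => _ [_ -> _ _]. Qed.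

Let twoK_le : 2 * K <= iM p.
Proof.
apply: leq_trans (_ : lam * K <= _); last by rewrite /iM; lia.
by rewrite leq_mul2r /ilam; case: wfp => -[l0 _ _ _ _] _; lia.
Qed.

Lemma flags_ok s : glob s -> ivl s -> memR (memory s) ->
  runs c_flags s (S * ((pw + 2) * 50 + 60) + 20) (fun s' =>
    [/\ regs s' 34 = s0, forall sg, sg < S -> memory s' (base + 3 + sg) = fl sg &
        same (base + 3) S (memory s) (memory s')]).
Proof.
move=> g iv mR.
have [[_ w1 w2 w3] [w4 w5 w6 w7]] := bd; have HB' := HB.
have e1 := eRS; have e2 := bRS; have e3 := bRB.
apply: runs_le; first apply: (@runs_set _ _ _ _ _ _ _ _ 0); first by rewrite /= mod0n.
  apply: (runs_For (N := S) (tb := (pw + 2) * 50 + 45)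
    (Inv := fun m s' => [/\ regs s' 34 = last 0 [seq sg <- iota 0 m | fl sg],
      forall sg, sg < m -> memory s' (base + 3 + sg) = fl sg &
      same (base + 3) S (memory s) (memory s')])) => //.
  - by lia.
  - by lia.
  - by move=> s' fr _; rewrite /= !fr // !regs_set /= !g.
  move=> m s' mN r40 fr _ _ [I1 I2 I3].
  have g' : glob s' by apply: (glob_fr fr) => //; exact: glob_set.
  have iv' : ivl s' by apply: (ivl_fr fr) => //; exact: ivl_set.
  have mR' : memR (memory s') by move=> i iM; rewrite I3 ?mR //; lia.
  apply: runs_le.
    apply: runs_seqw (hits_ok g' iv' mR' r40 mN) _ => s1 [f1 _ /(_ isT) f3] h1.
    have g1 : glob s1 by apply: (glob_fr f1).
    have iv1 : ivl s1 by apply: (ivl_fr f1).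
    have r40' : regs s1 40 = m by rewrite f1.
    apply: (@runs_put _ _ _ _ _ _ _ _ (base + 3 + m) (fl m)).
    - by rewrite /= r40' !iv1; mds.
    - by rewrite /= !g1 h1.
    apply: (@runs_ifb _ _ _ _ _ _ _ _ _ (fl m)).
    - by rewrite /= !g1 h1.
    - move=> fm; apply: (@runs_set1 _ _ _ _ _ _ _ _ m); first by rewrite /=.
      split.
      + by rewrite filter_iotaSr fm last_cat /=.
      + move=> sg; rewrite ltnS leq_eqVlt memory_set_reg => /orP[/eqP->|sm].
          by rewrite !memory_set_reg memory_set eqxx.
        rewrite !memory_set_reg memory_set f3 I2 // ifF //; apply/eqP; lia.
      + move=> a ha; rewrite !memory_set_reg memory_set f3 I3 // ifF //; apply/eqP; lia.
    - move=> fm; apply: runs_skip; split.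
      + rewrite filter_iotaSr (negbTE fm) cats0 regs_set /= f1 //.
      + move=> sg; rewrite ltnS leq_eqVlt memory_set_reg => /orP[/eqP->|sm].
          by rewrite memory_set eqxx.
        rewrite memory_set f3 I2 // ifF //; apply/eqP; lia.
      + move=> a ha; rewrite memory_set_reg memory_set f3 I3 // ifF //; apply/eqP; lia.
  by rewrite /=; lia.
rewrite /=; lia.
Qed.

(** The list serves drawing and enumeration, the bit table membership in constant time. *)
Definition Trep (T : seq nat) (m : nat -> nat) :=
  (forall i, i < size T -> m (aTL + i) = nth 0 T i) /\
  (forall z, z <= 2 * Z -> m (aTM + z) = (z \in T)).
Definition Urep (U : seq nat) (m : nat -> nat) :=
  forall i, i < K -> m (base + 3 + S + i) = nth 0 U i.

Lemma init_ok s : glob s -> ivl s ->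
  runs c_init s ((2 * Z + 1) * 20 + 40) (fun s' =>
    [/\ regs s' 35 = 1, regs s' 36 = 0, Trep [:: Z] (memory s') &
        same aTM (4 * Z + 2) (memory s) (memory s')]).
Proof.
move=> g iv.
have [[_ w1 w2 w3] [w4 w5 w6 w7]] := bd; have HB' := HB.
have eTM : aTM = 64 by []. have e3 := bRB.
have h : runs c_clear s ((2 * Z + 1) * 17 + 10) (fun s' =>
   (forall a, aTM <= a < aTM + (2 * Z + 1) -> memory s' a = 0) /\ same aTM (2 * Z + 1) (memory s) (memory s')).
  apply: runs_le.
    apply: (runs_For (N := 2 * Z + 1) (tb := 5)
     (Inv := fun m s' => (forall a, aTM <= a < aTM + m -> memory s' a = 0) /\
         same aTM (2 * Z + 1) (memory s) (memory s'))) => //.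
    - by lia.
    - by lia.
    - by split=> // a; lia.
    - by move=> s' fr _; rewrite /= !fr // !g; mds.
    move=> m s' mN r40 fr _ _ [I1 I2].
    have g' : glob s' by apply: (glob_fr fr).
    apply: runs_le.
      apply: (@runs_put1 _ _ _ _ _ _ _ _ (aTM + m) 0).
      - by rewrite /= r40 !g'; mds.
      - by rewrite /= mod0n.
      split=> a ha; rewrite memory_set_reg memory_set; case: eqP => // e; [|lia|].
        by apply: I1; lia.
      by rewrite I2.
    by [].
  by rewrite /=; lia.
apply: runs_le.
  apply: runs_seqw h _ => s1 [f1 _ _] [h1 h2].
  have g1 : glob s1 by apply: (glob_fr f1).
  apply: (@runs_put _ _ _ _ _ _ _ _ aTL Z); [by rewrite /= !g1 | by rewrite /= !g1 |].
  apply: (@runs_put _ _ _ _ _ _ _ _ (aTM + Z) 1).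
  - by rewrite /= !g1; mds.
  - by rewrite /=; mds.
  apply: (@runs_set _ _ _ _ _ _ _ _ 1); first by rewrite /=; mds.
  apply: (@runs_set1 _ _ _ _ _ _ _ _ 0); first by rewrite /= mod0n.
  split=> //; first split.
  - move=> [|i] //= _; rewrite addn0 eqxx ifF //; apply/eqP; lia.
  - move=> z zZ; rewrite !memory_set_reg !memory_set inE eqn_add2l; case: eqP => //= ne.
    rewrite ifF ?h1 //; [lia | apply/eqP; lia].
  - move=> a ha; rewrite !memory_set_reg !memory_set ifF; last by apply/eqP; lia.
    rewrite ifF ?h2 //; [lia | apply/eqP; lia].
by rewrite /=; lia.
Qed.

Section Round.
Variables (l : nat) (T : seq nat).
Hypothesis ll : l < lam.
Hypothesis uT : uniq T.
Hypothesis sT : 0 < size T.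
Hypothesis bT : forall z, z \in T -> Z <= z + 2 * W * l /\ z <= Z + 2 * W * l.

Let lZ : 2 * W * l + 2 * W <= Z. Proof. by move: ll; rewrite /iZ; nia. Qed.
Let s0S : s0 < S. Proof. exact: sg0_lt. Qed.
Let TZ z : z \in T -> z <= 2 * Z. Proof. by move=> /bT; lia. Qed.
Let sT2 : size T <= 2 * Z + 1.
Proof.
rewrite -(size_iota 0 (2 * Z + 1)); apply: uniq_leq_size => // z /TZ.
by rewrite mem_iota; lia.
Qed.

Lemma draw_ok s : glob s -> ivl s -> memR (memory s) -> regs s 37 = l -> regs s 35 = size T ->
  Trep T (memory s) ->
  runs c_draw s (K * 40 + 20) (fun s' => Urep (draws p om T l) (memory s') /\
    same (base + 3 + S) K (memory s) (memory s')).
Proof.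
move=> g iv mR r37 r35 [T1 T2].
have [[_ w1 w2 w3] [w4 w5 w6 w7]] := bd; have HB' := HB.
have e1 := eRS; have e2 := bRS; have e3 := bRB; have sT2' := sT2.
have lK : l * K + K <= lam * K by rewrite -mulSnr leq_mul2r ll orbT.
have iMe : iM p = Nc + (lam * K + Nc * LB) by [].
have eBB : aBB = aBA + Nc by [].
apply: runs_le.
  apply: (runs_For (N := K) (tb := 31)
    (Inv := fun m s' => (forall i, i < m -> memory s' (base + 3 + S + i) = nth 0 (draws p om T l) i) /\
       same (base + 3 + S) K (memory s) (memory s'))) => //.
  - by lia.
  - by lia.
  - by move=> s' fr _; rewrite /= !fr // !g.
  move=> m s' mN r40 fr _ _ [I1 I2].
  have g' : glob s' by apply: (glob_fr fr).
  have iv' : ivl s' by apply: (ivl_fr fr).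
  have mR' : memR (memory s') by move=> i iM; rewrite I2 ?mR //; lia.
  have r37' : regs s' 37 = l by rewrite fr.
  have r35' : regs s' 35 = size T by rewrite fr.
  pose v := om (Nc + l * K + m) %% size T.
  have vT : v < size T by rewrite ltn_pmod.
  apply: runs_le.
    apply: (@runs_set _ _ _ _ _ _ _ _ v).
      rewrite /= r40 r37' r35' !g'; mds.
      have -> : aBB + l * K + m = aBA + (Nc + l * K + m) by lia.
      by rewrite mR' //; lia.
    apply: (@runs_put1 _ _ _ _ _ _ _ _ (base + 3 + S + m) (nth 0 T v)).
    - by rewrite /= r40 !iv' !g'; mds.
    - rewrite /= !g'; mds; rewrite I2 ?T1 //; lia.
    split.
    + move=> i; rewrite ltnS leq_eqVlt memory_set_reg memory_set => /orP[/eqP->|im].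
        by rewrite eqxx (nth_map 0) ?size_iota // nth_iota.
      rewrite ifF; last by apply/eqP; lia.
      by rewrite memory_set_reg I1.
    + move=> a ha; rewrite memory_set_reg memory_set ifF; last by apply/eqP; lia.
      by rewrite memory_set_reg I2.
  by [].
by rewrite /=; lia.
Qed.

Section WithU.
Variable U : seq nat.
Hypothesis sU : size U = K.
Hypothesis UT : forall z, z \in U -> z \in T.

Lemma cnt_ok s sg : glob s -> ivl s -> regs s 40 = sg -> sg < S -> regs s 34 = s0 ->
  Trep T (memory s) -> Urep U (memory s) ->
  runs c_cnt s (K * 40 + 20) (fun s' => regs s' 42 = cntU p om k pw T U sg).
Proof.
move=> g iv r40 sgS r34 [T1 T2] Um.
have [[_ w1 w2 w3] [w4 w5 w6 w7]] := bd; have HB' := HB.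
have e1 := eRS; have e2 := bRS; have e3 := bRB; have s0S' := s0S; have lZ' := lZ.
have eTM : aTM = 64 by [].
pose P z := z + sg - s0 \in T.
apply: runs_le; first apply: (@runs_set _ _ _ _ _ _ _ _ 0); first by rewrite /= mod0n.
  apply: (@runs_weaken _ _ _ _ _ _ _ _ _ (fun s' => regs s' 42 = count P (take K U))); first last.
  - by move=> s' _ ->; rewrite -sU take_size.
  - exact: leqnn.
  apply: (runs_For (N := K) (tb := 27) (Inv := fun m s' => regs s' 42 = count P (take m U))) => //.
  - by lia.
  - by lia.
  - by rewrite !regs_set /= take0.
  - by move=> s' fr _; rewrite /= !fr // !regs_set /= !g.
  move=> m s' mN r43 fr _ /(_ isT) me I.
  have g' : glob s' by apply: (glob_fr fr) => //; exact: glob_set.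
  have iv' : ivl s' by apply: (ivl_fr fr) => //; exact: ivl_set.
  have r40' : regs s' 40 = sg by rewrite fr // regs_set.
  have r34' : regs s' 34 = s0 by rewrite fr // regs_set.
  have mU : m < size U by rewrite sU.
  have zT := UT (mem_nth 0 mU).
  have [z1 z2] : Z <= nth 0 U m + 2 * W * l /\ nth 0 U m <= Z + 2 * W * l by exact: bT zT.
  have cP : count P (take m U) <= m.
    by apply: leq_trans (count_size _ _) _; rewrite size_take; case: ifP; lia.
  have cS : count P (take m.+1 U) = count P (take m U) + P (nth 0 U m).
    by rewrite take_nthS // -cats1 count_cat /= addn0.
  apply: runs_le.
    apply: (@runs_ifb _ _ _ _ _ _ _ _ _ (P (nth 0 U m))).
    - rewrite /= r43 r40' r34' !iv' !g' me /=.
      rewrite (_ : (((base + 3 %% 2 ^ b) %% 2 ^ b + S) %% 2 ^ b + m) %% 2 ^ b = base + 3 + S + m); last by mds.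
      rewrite Um // (@modn_small (nth 0 U m + sg)); last by lia.
      by mds; rewrite T2 //; lia.
    - move=> Pm; apply: (@runs_set1 _ _ _ _ _ _ _ _ (count P (take m U) + 1)).
        by rewrite /= I; mds.
      by rewrite !regs_set /= cS Pm.
    - by move=> Pm; apply: runs_skip; rewrite !regs_set /= cS (negbTE Pm) addn0.
  by [].
by rewrite /=; lia.
Qed.

Lemma sel_ok s : glob s -> ivl s -> regs s 34 = s0 -> Trep T (memory s) -> Urep U (memory s) ->
  (forall sg, sg < S -> memory s (base + 3 + sg) = fl sg) ->
  runs c_sel s (S * (K * 40 + 70) + 20) (fun s' => regs s' 41 = last S (low p om k pw T U)).
Proof.
move=> g iv r34 Tm Um Fm.
have [[_ w1 w2 w3] [w4 w5 w6 w7]] := bd; have HB' := HB.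
have e1 := eRS; have e2 := bRS; have e3 := bRB.
pose P sg := fl sg && (2 * cntU p om k pw T U sg < K).
apply: runs_le; first apply: (@runs_set _ _ _ _ _ _ _ _ S); first by rewrite /= !g.
  apply: (runs_For (N := S) (tb := K * 40 + 50)
     (Inv := fun m s' => regs s' 41 = last S [seq sg <- iota 0 m | P sg])) => //.
  - by lia.
  - by lia.
  - by move=> s' fr _; rewrite /= !fr // !regs_set /= !g.
  move=> m s' mN r40 fr _ /(_ isT) me I.
  have g' : glob s' by apply: (glob_fr fr) => //; exact: glob_set.
  have iv' : ivl s' by apply: (ivl_fr fr) => //; exact: ivl_set.
  have r34' : regs s' 34 = s0 by rewrite fr // regs_set.
  have cU : cntU p om k pw T U m <= K by rewrite -sU /cntU count_size.
  have K2 := twoK_le.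
  apply: runs_le.
    apply: (@runs_ifb _ _ _ _ _ _ _ _ _ (fl m)).
    - by rewrite /= r40 !iv'; mds; rewrite me /= Fm.
    - move=> fm.
      have cr : runs c_cnt s' (K * 40 + 20) (fun s' => regs s' 42 = cntU p om k pw T U m).
        by apply: cnt_ok => //; rewrite me.
      apply: runs_seqw cr _ => s1 [f1 _ _] h1.
      have g1 : glob s1 by apply: (glob_fr f1).
      apply: (@runs_ifb _ _ _ _ _ _ _ _ _ (2 * cntU p om k pw T U m < K)).
      + by rewrite /= h1 !g1; mds; rewrite mul2n -addnn.
      + move=> cm; apply: (@runs_set1 _ _ _ _ _ _ _ _ m); first by rewrite /= f1.
        by rewrite filter_iotaSr !regs_set /= /P fm cm last_cat.
      + move=> cm; apply: runs_skip; rewrite filter_iotaSr !regs_set /= f1 // I /P fm (negbTE cm) /=.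
        by rewrite cats0.
    - move=> fm; apply: runs_skip; rewrite filter_iotaSr !regs_set /= I /P (negbTE fm) /=.
      by rewrite cats0.
  by rewrite /=; lia.
by rewrite /=; lia.
Qed.

End WithU.

Lemma grow_ok s sg : glob s -> ivl s -> regs s 34 = s0 -> regs s 41 = sg -> sg < S ->
  regs s 35 = size T -> Trep T (memory s) ->
  runs c_grow s ((2 * Z + 1) * 60 + 20) (fun s' =>
    [/\ regs s' 35 = size (grow p om k pw T sg), Trep (grow p om k pw T sg) (memory s') &
        same aTM (4 * Z + 2) (memory s) (memory s')]).
Proof.
move=> g iv r34 r41 sgS r35 Tm.
have [[_ w1 w2 w3] [w4 w5 w6 w7]] := bd; have HB' := HB.
have e1 := eRS; have e2 := bRS; have e3 := bRB; have s0S' := s0S; have lZ' := lZ.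
have eTM : aTM = 64 by []. have sT2' := sT2.
pose N m := [seq z <- [seq z + sg - s0 | z <- take m T] | z \notin T].
apply: runs_le; first apply: (@runs_set _ _ _ _ _ _ _ _ (size T)); first by rewrite /= r35.
  apply: (@runs_weaken _ _ _ _ _ _ _ _ _ (fun s' => [/\ regs s' 35 = size (T ++ N (size T)),
      Trep (T ++ N (size T)) (memory s') & same aTM (4 * Z + 2) (memory s) (memory s')])); first last.
  - by move=> s' _; rewrite /N take_size.
  - exact: leqnn.
  apply: (runs_For (N := size T) (tb := 45)
    (Inv := fun m s' => [/\ regs s' 35 = size (T ++ N m),
      Trep (T ++ N m) (memory s') & same aTM (4 * Z + 2) (memory s) (memory s')])) => //.
  - by lia.
  - by lia.
  - by rewrite /N take0 cats0 ?regs_set.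
  - by move=> s' fr _; rewrite /= !fr // ?regs_set.
  move=> m s' mN r40 fr _ _ [I1 [I2a I2b] I3].
  have g' : glob s' by apply: (glob_fr fr) => //; exact: glob_set.
  have r34' : regs s' 34 = s0 by rewrite fr // regs_set.
  have r41' : regs s' 41 = sg by rewrite fr // regs_set.
  have zT := mem_nth 0 mN.
  have [z1 z2] : Z <= nth 0 T m + 2 * W * l /\ nth 0 T m <= Z + 2 * W * l by exact: bT zT.
  pose z := nth 0 T m + sg - s0.
  have zZ : z <= 2 * Z by rewrite /z; lia.
  have NS : N m.+1 = N m ++ (if z \notin T then [:: z] else [::]).
    by rewrite /N take_nthS // -cats1 map_cat filter_cat.
  have sTN : size T <= size (T ++ N m) by rewrite size_cat leq_addr.
  (* The table already contains what the loop has added so far; by injectivity none of that equals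
     the present translate. *)
  have zN : (z \in T ++ N m) = (z \in T).
    rewrite mem_cat; case: (boolP (z \in T)) => //= nz; apply/negbTE/negP.
    rewrite mem_filter nz /= => /mapP[z' z'T ez].
    have z'T2 := mem_take z'T; have [z3 z4] := bT z'T2.
    have : nth 0 T m = z' by move: ez; rewrite /z; lia.
    move=> em; move: z'T; rewrite -em => /(nthP 0)[i]; rewrite size_take mN /= => im.
    have iT : i < size T by lia.
    rewrite nth_take // => /eqP; rewrite nth_uniq //.
    by move/eqP; lia.
  have sz : z \notin T -> size (T ++ N m) <= 2 * Z.
    move=> nz; have : uniq (z :: (T ++ N m)).
      rewrite /= zN nz cat_uniq uT /=; apply/andP; split.
        by apply/hasPn => y; rewrite mem_filter => /andP[].
      rewrite filter_uniq // map_inj_in_uniq ?take_uniq // => y1 y2 /mem_take/bT[? _] /mem_take/bT[? _].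
      by lia.
    move=> uz; suff : size (z :: (T ++ N m)) <= 2 * Z + 1 by rewrite /=; lia.
    rewrite -(size_iota 0 (2 * Z + 1)); apply: uniq_leq_size uz _ => y.
    rewrite inE mem_cat mem_iota => /or3P[/eqP->|/TZ|]; [lia | lia |].
    by rewrite mem_filter => /andP[_ /mapP[y' /mem_take/bT[? ?] ->]]; lia.
  apply: runs_le.
    apply: (@runs_set _ _ _ _ _ _ _ _ z).
      rewrite /= r40 r34' r41' !g' (modn_small (_ : aTL + m < _)); last by lia.
      by rewrite I2a ?nth_cat ?mN; [mds | lia].
    apply: (@runs_ifb _ _ _ _ _ _ _ _ _ (z \in T)).
    - by rewrite /= !g'; mds; rewrite I2b // zN.
    - move=> zT'; apply: runs_skip; rewrite ?regs_set /= ?memory_set_reg NS zT' /= cats0.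
      by split.
    - move=> nz; have sz' := sz nz.
      apply: (@runs_put _ _ _ _ _ _ _ _ (aTM + z) 1).
      + by rewrite /= !g'; mds.
      + by rewrite /=; mds.
      apply: (@runs_put _ _ _ _ _ _ _ _ (aTL + size (T ++ N m)) z).
      + by rewrite /= I1 !g'; mds.
      + by [].
      apply: (@runs_set1 _ _ _ _ _ _ _ _ (size (T ++ N m)).+1).
        by rewrite /= I1; mds; rewrite addn1.
      have -> : T ++ N m.+1 = rcons (T ++ N m) z by rewrite NS nz catA cats1.
      split.
      + by rewrite ?regs_set /= size_rcons.
      + split.
          move=> i; rewrite size_rcons ltnS ?memory_set_reg ?memory_set nth_rcons leq_eqVlt.
          move=> /orP[/eqP->|im]; first by rewrite !eqxx ltnn.
          rewrite im ifF; last by apply/eqP; lia.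
          rewrite ifF; last by apply/eqP; lia.
          by rewrite ?memory_set_reg I2a.
        move=> z' z'Z; rewrite ?memory_set_reg ?memory_set mem_rcons inE.
        rewrite ifF; last by apply/eqP; lia.
        by rewrite eqn_add2l; case: eqP => //= _; rewrite ?memory_set_reg I2b.
      + move=> a ha; rewrite ?memory_set_reg !memory_set.
        rewrite ifF; last by apply/eqP; lia.
        by rewrite ifF ?memory_set_reg ?I3 //; apply/eqP; lia.
  by [].
by rewrite /=; nia.
Qed.

End Round.

Definition same2 (m m' : nat -> nat) : Prop :=
  forall a, (a < aTM) || (aBA <= a) -> (a < base + 3 + S) || (base + 3 + S + K <= a) -> m' a = m a.

(** Before the first round no draws are in memory, hence the guard [0 < l]. *)
Definition trep l (s : state) : Prop := let: (T, U, dn) := trun p om k pw l in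
  [/\ regs s 35 = size T, regs s 36 = dn, Trep T (memory s) & 0 < l -> Urep U (memory s)].

Lemma round_ok s l : l < lam -> glob s -> ivl s -> memR (memory s) -> regs s 37 = l -> regs s 34 = s0 ->
  (forall sg, sg < S -> memory s (base + 3 + sg) = fl sg) -> trep l s ->
  runs c_round s (S * (K * 40 + 70) + K * 40 + (2 * Z + 1) * 60 + 90) (fun s' =>
    trep l.+1 s' /\ same2 (memory s) (memory s')).
Proof.
move=> ll g iv mR r37 r34 Fm; rewrite /trep.
have [[_ w1 w2 w3] [w4 w5 w6 w7]] := bd; have HB' := HB.
have e1 := eRS; have e2 := bRS; have e3 := bRB; have eTM : aTM = 64 by [].
have := trun_inv om wfp val (ltnW ll); rewrite [trun _ _ _ _ l.+1]/=.
case E : (trun p om k pw l) => [[T U] dn] /= [uT sT bT] [r35 r36 Tm Um].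
case: dn E r36 => E r36.
  apply: runs_le.
    apply: (@runs_ifb _ _ _ _ _ _ _ _ _ false 0 1); [by rewrite /= r36 mod0n | by [] |].
    move=> _; apply: runs_skip; rewrite /tstep; split=> //; split=> // _.
    by case: (l) ll E Um => [|l'] ll' E Um; [case: E | exact: Um].
  by rewrite /=; lia.
apply: runs_le.
  apply: (@runs_ifb _ _ _ _ _ _ _ _ _ true _ 0); [by rewrite /= r36 mod0n | | by []].
  - move=> _; rewrite /tstep.
    have dr := draw_ok ll uT sT bT g iv mR r37 r35 Tm.
    apply: runs_seqw dr _ => s1 [f1 _ _] [U1 sm1].
    have g1 : glob s1 by apply: (glob_fr f1).
    have iv1 : ivl s1 by apply: (ivl_fr f1).
    have Tm1 : Trep T (memory s1).
      case: Tm => t1 t2; split=> [i iT|z zZ]; rewrite sm1 ?t1 ?t2 //.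
        have : size T <= 2 * Z + 1.
          rewrite -(size_iota 0 (2 * Z + 1)); apply: uniq_leq_size => // z /bT.
          have : 2 * W * l <= Z by rewrite /iZ leq_mul2l; apply/orP; right; lia.
          by rewrite mem_iota; lia.
        by lia.
      by lia.
    have Fm1 sg : sg < S -> memory s1 (base + 3 + sg) = fl sg by move=> sS; rewrite sm1 ?Fm //; lia.
    have r34' : regs s1 34 = s0 by rewrite f1.
    set U' := draws p om T l in U1 *.
    have sU' : size U' = K by rewrite size_draws.
    have UT' z : z \in U' -> z \in T by apply: draws_sub.
    have sl : runs c_sel s1 (S * (K * 40 + 70) + 20) (fun s' => regs s' 41 = last S (low p om k pw T U')).
      by apply: (sel_ok (l := l)).
    apply: runs_seqw sl _ => s2 [f2 _ /(_ isT) m2] h2.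
    have g2 : glob s2 by apply: (glob_fr f2).
    have iv2 : ivl s2 by apply: (ivl_fr f2).
    have r35' : regs s2 35 = size T by rewrite f2 // f1.
    have lw : if low p om k pw T U' is [::] then regs s2 41 = S
              else regs s2 41 = last 0 (low p om k pw T U') /\ regs s2 41 < S.
      rewrite h2; have al : forall sg, sg \in low p om k pw T U' -> sg < S.
        by move=> sg; rewrite mem_filter mem_iota => /andP[].
      case: (low _ _ _ _ _ _) al => [//|a r] al /=; split=> //; apply: al; exact: mem_last.
    apply: (@runs_ifb _ _ _ _ _ _ _ _ _ (regs s2 41 == S)).
    + by rewrite /= !g2.
    + move=> eS; apply: (@runs_set1 _ _ _ _ _ _ _ _ 1); first by rewrite /=; mds.
      move: lw; case: (low _ _ _ _ _ _) => [_|a r [_]]; last by rewrite (eqP eS) ltnn.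
      split; first by split; rewrite ?regs_set ?memory_set_reg ?m2.
      by move=> a h1 h3; rewrite ?memory_set_reg m2 sm1.
    + move=> nS; move: lw; case: (low _ _ _ _ _ _) => [eS|a r [e41 l41]].
        by rewrite eS eqxx in nS.
      have Tm2 : Trep T (memory s2) by rewrite m2.
      have r34'' : regs s2 34 = s0 by rewrite f2.
      have l41' : last 0 (a :: r) < S by rewrite -e41.
      have gr : runs c_grow s2 ((2 * Z + 1) * 60 + 20) (fun s' =>
         [/\ regs s' 35 = size (grow p om k pw T (last 0 (a :: r))),
             Trep (grow p om k pw T (last 0 (a :: r))) (memory s') &
             same aTM (4 * Z + 2) (memory s2) (memory s')]).
        by apply: (grow_ok (l := l)).
      apply: (runs_weaken gr (leqnn _)) => s3 [f3 _ _] [h1 h3 h4]; split.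
        split=> //.
          by rewrite f3 // f2 // f1 // r36.
        by move=> _ i iK; rewrite h4 ?m2 ?U1 //; lia.
      by move=> a' ha1 ha2; rewrite h4 ?m2 ?sm1 //; lia.
by rewrite /=; lia.
Qed.

Definition t_tests := lam * (S * (K * 40 + 70) + K * 40 + (2 * Z + 1) * 60 + 100) + (2 * Z + 1) * 20 + 60.

Lemma tests_ok s : glob s -> ivl s -> memR (memory s) -> regs s 34 = s0 ->
  (forall sg, sg < S -> memory s (base + 3 + sg) = fl sg) ->
  runs c_tests s t_tests (fun s' =>
    Urep (tU p om k pw) (memory s') /\ same2 (memory s) (memory s')).
Proof.
move=> g iv mR r34 Fm.
have [[_ w1 w2 w3] [w4 w5 w6 w7]] := bd; have HB' := HB.
have e1 := eRS; have e2 := bRS; have e3 := bRB; have eTM : aTM = 64 by [].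
have lK : lam <= iM p.
  apply: leq_trans (_ : lam * K <= _); last by rewrite /iM; lia.
  by rewrite leq_pmulr // /iK; case: wfp => -[l0 _ _ _ _] [_ _ _ c0 _]; nia.
have lam0 : 0 < lam by rewrite /ilam; case: wfp => -[]; lia.
apply: runs_le.
  apply: runs_seqw (init_ok g iv) _ => s1 [f1 _ _] [i1 i2 i3 i4].
  have sm1 : same2 (memory s) (memory s1) by move=> a h1 h2; apply: i4; lia.
  have g1 : glob s1 by apply: (glob_fr f1).
  apply: (@runs_weaken _ _ _ _ _ _ _ _ _ (fun s' => trep lam s' /\ same2 (memory s) (memory s'))); first last.
  - move=> s' _ [tr sm]; split=> //; move: tr; rewrite /trep /tU.
    by case: (trun _ _ _ _ _) => [[T U] dn] [_ _ _]; apply.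
  - exact: leqnn.
  apply: (runs_For (N := lam) (Inv := fun m s' => trep m s' /\ same2 (memory s) (memory s'))) => //.
  - by lia.
  - by lia.
  - by move=> s' fr _; rewrite /= !fr // !g1.
  move=> m s' mN r37 fr _ _ [I1 I2].
  have g' : glob s' by apply: (glob_fr fr).
  have iv' : ivl s' by apply: (ivl_fr fr) => //; apply: (ivl_fr f1).
  have mR' : memR (memory s') by move=> i iM; rewrite I2 ?mR //; lia.
  have Fm' sg : sg < S -> memory s' (base + 3 + sg) = fl sg by move=> sS; rewrite I2 ?Fm //; lia.
  have r34' : regs s' 34 = s0 by rewrite fr // f1.
  apply: (runs_weaken (round_ok mN g' iv' mR' r37 r34' Fm' I1) (leqnn _)) => s2 _ [tr sm].
  split; last by move=> a h1 h2; rewrite ?memory_set_reg sm // I2.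
  by move: tr; rewrite /trep; case: (trun _ _ _ _ _) => [[T U] dn].
by rewrite /t_tests /=; nia.
Qed.

Section Lists.
Variables (rd : expr -> expr) (rf : nat -> nat) (U : seq nat) (off : nat).
Hypothesis rdE : forall s e, eval s (rd e) = rf (eval s e).
Hypothesis rdC : forall e, expr_cost (rd e) = (expr_cost e).+1.
Hypothesis sU : size U = K.
Hypothesis offB : off <= 2 * Z.

Lemma hv_ok s i : glob s -> ivl s -> regs s 41 = i -> i < Nc * L -> regs s 48 = off -> Urep U (memory s) ->
  runs (c_hv rd) s (K * 40 + 20) (fun s' =>
    regs s' 42 = has (fun z => rf i != nth 0 Y (i + off - z)) U).
Proof.
move=> g iv r41 iN r48 Um.
have [[_ w1 w2 w3] [w4 w5 w6 w7]] := bd; have HB' := HB; have [k2 kN kL NX NY] := vb.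
have e1 := eRS; have e2 := bRS; have e3 := bRB.
pose P z := rf i != nth 0 Y (i + off - z).
apply: runs_le; first apply: (@runs_set _ _ _ _ _ _ _ _ 0); first by rewrite /= mod0n.
  apply: (@runs_weaken _ _ _ _ _ _ _ _ _ (fun s' => regs s' 42 = has P (take K U))); first last.
  - by move=> s' _ ->; rewrite -sU take_size.
  - exact: leqnn.
  apply: (runs_For (N := K) (tb := 27) (Inv := fun m s' => regs s' 42 = has P (take m U))) => //.
  - by lia.
  - by lia.
  - by rewrite ?regs_set /= take0.
  - by move=> s' fr _; rewrite /= !fr // ?regs_set /= !g.
  move=> m s' mN r43 fr _ /(_ isT) me I.
  have g' : glob s' by apply: (glob_fr fr) => //; exact: glob_set.
  have iv' : ivl s' by apply: (ivl_fr fr) => //; exact: ivl_set.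
  have r41' : regs s' 41 = i by rewrite fr // regs_set.
  have r48' : regs s' 48 = off by rewrite fr // regs_set.
  have mU : m < size U by rewrite sU.
  have hS : has P (take m.+1 U) = has P (take m U) || P (nth 0 U m).
    by rewrite take_nthS // has_rcons orbC.
  apply: runs_le.
    apply: (@runs_ifb _ _ _ _ _ _ _ _ _ (~~ P (nth 0 U m))).
    - rewrite /= rdE /= r43 r41' r48' !iv' !g' me /=; mds.
      by rewrite Um // /P negbK.
    - by move=> Pm; apply: runs_skip; rewrite hS ?regs_set /= I (negbTE Pm) orbF.
    - rewrite negbK => Pm; apply: (@runs_set1 _ _ _ _ _ _ _ _ 1); first by rewrite /=; mds.
      by rewrite hS ?regs_set /= Pm orbT.
  by rewrite /= rdC.
by rewrite /=; lia.
Qed.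

Lemma list_ok s a0 cnt dst : glob s -> ivl s -> memR (memory s) -> regs s 48 = off ->
  regs s 49 = a0 -> regs s 50 = cnt -> regs s 51 = dst -> a0 + cnt <= Nc * LB ->
  base + 3 + S + K <= dst -> dst + cnt < 2 ^ b -> Urep U (memory s) ->
  let lst := [seq i <- [seq posD p om bb | bb <- iota a0 cnt] |
                has (fun z => rf i != nth 0 Y (i + off - z)) U] in
  runs (c_list rd) s (cnt * (K * 40 + 90) + 20) (fun s' =>
    [/\ regs s' 46 = size lst, forall t, t < size lst -> memory s' (dst + t) = nth 0 lst t &
        forall a, (a < dst) || (dst + size lst <= a) -> memory s' a = memory s a]).
Proof.
move=> g iv mR r48 r49 r50 r51 aN dB dcB Um.
have [[_ w1 w2 w3] [w4 w5 w6 w7]] := bd; have HB' := HB; have [k2 kN kL NX NY] := vb.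
have e1 := eRS; have e2 := bRS; have e3 := bRB.
pose P i := has (fun z => rf i != nth 0 Y (i + off - z)) U.
pose ls m := [seq i <- [seq posD p om bb | bb <- iota a0 m] | P i].
have lsS m : ls m.+1 = ls m ++ (if P (posD p om (a0 + m)) then [:: posD p om (a0 + m)] else [::]).
  by rewrite /ls -addn1 iotaD map_cat filter_cat.
have lsz m : size (ls m) <= m.
  by rewrite size_filter; apply: leq_trans (count_size _ _) _; rewrite size_map size_iota.
have b0 : 0 < bet by case: wfp => _ [].
have LBb : LB * bet = L by rewrite /iLB divnK //; case: wfp => _ [].
have iMe : iM p = Nc + (lam * K + Nc * LB) by [].
have eBD : aBD = aBA + (Nc + lam * K) by rewrite /aBD /aBB; lia.
apply: runs_le; first apply: (@runs_set _ _ _ _ _ _ _ _ 0); first by rewrite /= mod0n.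
  apply: (runs_For (N := cnt) (tb := K * 40 + 75) (Inv := fun m s' =>
    [/\ regs s' 46 = size (ls m), forall t, t < size (ls m) -> memory s' (dst + t) = nth 0 (ls m) t &
        forall a, (a < dst) || (dst + size (ls m) <= a) -> memory s' a = memory s a])) => //.
  - by lia.
  - by lia.
  - by move=> s' fr _; rewrite /= !fr // ?regs_set /= r50.
  move=> m s' mN r40 fr _ _ [I1 I2 I3].
  have g' : glob s' by apply: (glob_fr fr) => //; exact: glob_set.
  have iv' : ivl s' by apply: (ivl_fr fr) => //; exact: ivl_set.
  have [r48' r49' r51'] : [/\ regs s' 48 = off, regs s' 49 = a0 & regs s' 51 = dst].
    by split; rewrite fr ?regs_set.
  have mR' : memR (memory s') by move=> i iM; rewrite I3 ?mR //; lia.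
  have Um' : Urep U (memory s') by move=> i iM; rewrite I3 ?Um //; lia.
  pose bb := a0 + m; pose v := posD p om bb.
  have bN : bb < Nc * LB by rewrite /bb; lia.
  have rb := ltn_pmod (om (Nc + lam * K + bb)) b0.
  have bbL : bb * bet + bet <= Nc * L by rewrite -mulSnr -LBb mulnA leq_mul2r bN orbT.
  have vN : v < Nc * L by rewrite /v /posD; lia.
  have ms := lsz m.
  apply: runs_le.
    apply: (@runs_set _ _ _ _ _ _ _ _ v).
      rewrite /= r40 r49' !g' -/bb.
      rewrite (@modn_small bb) ?(@modn_small (aBD + bb)); [|lia|lia].
      have -> : aBD + bb = aBA + (Nc + lam * K + bb) by lia.
      rewrite mR'; last by lia.
      by mds.
    have r41 : regs (set_reg s' 41 v) 41 = v by rewrite regs_set.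
    have Um2 : Urep U (memory (set_reg s' 41 v)) by [].
    have r48'' : regs (set_reg s' 41 v) 48 = off by [].
    apply: runs_seqw (hv_ok (glob_set v (isT : 29 < 41) g') (ivl_set v (isT : 33 < 41) iv') r41 vN r48'' Um2) _.
    move=> s1 [f1 _ /(_ isT) m1] h1.
    have f1' r : r \notin [:: 40; 41; 42; 43] -> regs s1 r = regs s' r.
      rewrite !inE !negb_or => /and4P[n0 n1 n2 n3]; rewrite f1 ?regs_set ?(negbTE n1) //.
      by rewrite /c_hv /= !inE !negb_or n2 n3.
    have r41' : regs s1 41 = v by rewrite f1 // regs_set.
    apply: (@runs_ifb _ _ _ _ _ _ _ _ _ (P v)).
    - by rewrite /= h1.
    - move=> Pv; apply: (@runs_put _ _ _ _ _ _ _ _ (dst + size (ls m)) v).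
      + by rewrite /= !f1' // r51' I1; mds.
      + by rewrite /= r41'.
      apply: (@runs_set1 _ _ _ _ _ _ _ _ (size (ls m) + 1)).
        by rewrite /= f1' // I1; mds.
      rewrite lsS -/bb -/v Pv size_cat /=; split.
      + by rewrite ?regs_set.
      + move=> t; rewrite addn1 ltnS leq_eqVlt ?memory_set_reg ?memory_set nth_cat => /orP[/eqP->|tm].
          by rewrite eqxx ltnn subnn.
        rewrite tm ifF; last by apply/eqP; lia.
        by rewrite m1 ?memory_set_reg I2.
      + move=> a ha; rewrite ?memory_set_reg ?memory_set ifF; last by apply/eqP; lia.
        by rewrite m1 ?memory_set_reg I3 //; lia.
    - move=> Pv; apply: runs_skip; rewrite lsS -/bb -/v (negbTE Pv) cats0 ?regs_set /= f1' // m1.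
      by split.
  by rewrite /=; lia.
by rewrite /= -/(ls cnt); lia.
Qed.

End Lists.

Definition rec (m : nat -> nat) : Prop :=
  [/\ m base = s0, m (base + 1) = size (listX p om k pw), m (base + 2) = size (listY p om k pw),
      forall sg, sg < S -> m (base + 3 + sg) = fl sg & Urep (tU p om k pw) m] /\
  (forall t, t < size (listX p om k pw) -> m (base + 3 + S + K + t) = nth 0 (listX p om k pw) t) /\
  (forall t, t < size (listY p om k pw) ->
     m (base + 3 + S + K + size (listX p om k pw) + t) = nth 0 (listY p om k pw) t).

Definition t_process :=
  S * ((pw + 2) * 50 + 60) + t_tests + (2 * pw + 2) * LB * (K * 40 + 90) + 300.

Hypothesis sUK : size (tU p om k pw) = K.

Lemma process_ok s : glob s -> regs s 30 = j -> regs s 31 = pw -> regs s 32 = k -> memR (memory s) ->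
  runs c_process s t_process (fun s' => rec (memory s') /\
    (forall a, (a < aTM) || (aBA <= a < base) -> memory s' a = memory s a)).
Proof.
move=> g r30 r31 r32 mR.
have [[_ w1 w2 w3] [w4 w5 w6 w7]] := bd; have HB' := HB; have [k2 kN kL NX NY] := vb.
have e1 := eRS; have e2 := bRS; have e3 := bRB; have eTM : aTM = 64 by [].
have [ab1 ab2] := ab.
have s0S : s0 < S by exact: sg0_lt.
have kLB : k * LB + pw * LB + 2 * LB <= Nc * LB by rewrite -!mulnDl leq_mul2r kN orbT.
have k1LB : k * LB = k.-1 * LB + LB by case: (k) k2 => //= k' _; rewrite mulSnr.
have NLB : Nc * LB <= iM p by rewrite /iM; lia.
have pwLB : LB <= pw * LB by rewrite leq_pmull.
have pwRS : pw * iRS = pw * (3 + S + K) + 4 * (pw * LB) by rewrite e1; nia.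
have pw3 : 3 + S + K <= pw * (3 + S + K) by rewrite leq_pmull.
have sX : size (listX p om k pw) <= pw * LB.
  by rewrite size_filter; apply: leq_trans (count_size _ _) _; rewrite size_map size_iota.
have ba : (j * (Nc + 1) + k) * iRS <= aTOP by move: ab1; rewrite /abase; lia.
have bb1 : j * (Nc + 1) + k <= (j * (Nc + 1) + k) * iRS by rewrite leq_pmulr // e1.
apply: runs_le.
  apply: (@runs_set _ _ _ _ _ _ _ _ base).
    rewrite /= r30 r32 !g.
    by have eb : base = aRB + (j * (Nc + 1) + k) * iRS; [by [] | mds].
  have g0 := glob_set base (isT : 29 < 33) g.
  have iv0 : ivl (set_reg s 33 base) by rewrite /ivl ?regs_set /= r30 r31 r32.
  apply: runs_seqw (flags_ok g0 iv0 mR) _ => s1 [f1 _ _] [h1 h2 h3].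
  have g1 : glob s1 by apply: (glob_fr f1).
  have iv1 : ivl s1 by apply: (ivl_fr f1).
  have mR1 : memR (memory s1) by move=> i iM; rewrite h3 ?mR //; lia.
  apply: runs_seqw (tests_ok g1 iv1 mR1 h1 h2) _ => st [f2 _ _] [h4 h5].
  have g2 : glob st by apply: (glob_fr f2).
  have iv2 : ivl st by apply: (ivl_fr f2).
  have mR2 : memR (memory st) by move=> i iM; rewrite h5 ?mR1 //; lia.
  have r34 : regs st 34 = s0 by rewrite f2.
  have F2 sg : sg < S -> memory st (base + 3 + sg) = fl sg by move=> sS; rewrite h5 ?h2 //; lia.
  have fr2 a : (a < aTM) || (aBA <= a < base) -> memory st a = memory s a.
    by move=> ha; rewrite h5 ?h3 //; lia.
  apply: (@runs_set _ _ _ _ _ _ _ _ (W + Z - s0)); first by rewrite /= r34 !g2; mds.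
  apply: (@runs_set _ _ _ _ _ _ _ _ (k * LB)); first by rewrite /= !iv2 !g2; mds.
  apply: (@runs_set _ _ _ _ _ _ _ _ (pw * LB)); first by rewrite /= !iv2 !g2; mds.
  apply: (@runs_set _ _ _ _ _ _ _ _ (base + 3 + S + K)); first by rewrite /= !iv2 !g2; mds.
  set sa := set_reg _ 51 _.
  have ga : glob sa by do 4 apply: glob_set => //.
  have iva : ivl sa by do 4 apply: ivl_set => //.
  have offX : W + Z - s0 <= 2 * Z by lia.
  apply: runs_seqw (list_ok (rd := ReadX) (rf := nth 0 X) (fun _ _ => erefl) (fun _ => erefl) sUK offX
    ga iva mR2 (erefl _) (erefl (k * LB)) (erefl (pw * LB)) (erefl (base + 3 + S + K)) _ _ _ h4) _ => //; [lia|lia|].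
  have -> : [seq i <- [seq posD p om bb | bb <- iota (k * LB) (pw * LB)] |
      has (fun z => nth 0 X i != nth 0 Y (i + (W + Z - s0) - z)) (tU p om k pw)] = listX p om k pw.
    apply: eq_filter => i; apply: eq_has => z; congr (_ != nth 0 Y _); lia.
  move=> s3 [f3 _ _] [l1 l2 l3].
  have g3 : glob s3 by apply: (glob_fr f3).
  have iv3 : ivl s3 by apply: (ivl_fr f3).
  have r34' : regs s3 34 = s0 by rewrite f3 // /sa ?regs_set /=.
  have r51 : regs s3 51 = base + 3 + S + K by rewrite f3.
  apply: (@runs_put _ _ _ _ _ _ _ _ base s0); [by rewrite /= !iv3 | by rewrite /= r34' |].
  apply: (@runs_put _ _ _ _ _ _ _ _ (base + 1) (size (listX p om k pw))).
  - by rewrite /= !iv3; mds.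
  - by rewrite /= l1.
  apply: (@runs_set _ _ _ _ _ _ _ _ Z); first by rewrite /= !g3.
  apply: (@runs_set _ _ _ _ _ _ _ _ (k.-1 * LB)).
    by rewrite /= !iv3 !g3; mds; rewrite subn1; mds.
  apply: (@runs_set _ _ _ _ _ _ _ _ ((pw + 2) * LB)).
    have p2 : (pw + 2) * LB = pw * LB + 2 * LB by lia.
    by rewrite /= !iv3 !g3; mds.
  apply: (@runs_set _ _ _ _ _ _ _ _ (base + 3 + S + K + size (listX p om k pw))).
    by rewrite /= r51 l1; mds.
  set sb := set_reg _ 51 _.
  have gb : glob sb by do 4 apply: glob_set => //.
  have ivb : ivl sb by do 4 apply: ivl_set => //.
  have mb a : memory sb a = if a == base + 1 then size (listX p om k pw) else if a == base then s0 else memory s3 a.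
    by [].
  have mbo a : a != base -> a != base + 1 -> memory sb a = memory s3 a.
    by move=> n0 n1; rewrite mb (negbTE n0) (negbTE n1).
  have mR3 : memR (memory sb).
    by move=> i iM; rewrite mbo ?l3 ?mR2 //; lia.
  have U3 : Urep (tU p om k pw) (memory sb).
    by move=> i iK; rewrite mbo ?l3 ?h4 //; lia.
  have p2 : (pw + 2) * LB = pw * LB + 2 * LB by lia.
  have offY : Z <= 2 * Z by lia.
  apply: runs_seqw (list_ok (rd := ReadY) (rf := nth 0 Y) (fun _ _ => erefl) (fun _ => erefl) sUK offY
    gb ivb mR3 (erefl _) (erefl (k.-1 * LB)) (erefl ((pw + 2) * LB))
    (erefl (base + 3 + S + K + size (listX p om k pw))) _ _ _ U3) _ => //; [lia|lia|lia|].
  rewrite -/(listY p om k pw).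
  move=> s4 [f4 _ _] [l4 l5 l6].
  have iv4 : ivl s4 by apply: (ivl_fr f4).
  apply: (@runs_put1 _ _ _ _ _ _ _ _ (base + 2) (size (listY p om k pw))).
  - by rewrite /= !iv4; mds.
  - by rewrite /= l4.
  have fin a : a != base + 2 -> memory (set_mem s4 (base + 2) (size (listY p om k pw))) a = memory s4 a.
    by move=> n; rewrite memory_set (negbTE n).
  split; last first.
    by move=> a ha; rewrite fin ?l6 ?mbo ?l3 ?fr2 //; lia.
  split; first split.
  - rewrite fin ?l6 ?mb; [|lia|lia].
    by rewrite ifF ?eqxx //; apply/eqP; lia.
  - rewrite fin ?l6 ?mb ?eqxx //; lia.
  - by rewrite memory_set eqxx.
  - by move=> sg sS; rewrite fin ?l6 ?mbo ?l3 ?F2 //; lia.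
  - by move=> i iK; rewrite fin ?l6 ?U3 //; lia.
  split=> t tl.
  - by rewrite fin ?l6 ?mbo ?l2 //; lia.
  - by rewrite fin ?l5 //; lia.
rewrite /t_process.
have -> : (2 * pw + 2) * LB * (K * 40 + 90) = pw * LB * (K * 40 + 90) + (pw + 2) * LB * (K * 40 + 90).
  by rewrite -!mulnDl; congr (_ * _ * _); lia.
move: (S * _) t_tests (pw * LB * _) ((pw + 2) * LB * _) => u1 u2 u3 u4 /=; lia.
Qed.

End Interval.
End Pre.

(** * Preprocessing of all levels *)

Definition c_rand : cmd := For 41 %40 (Rand 42 ;; StoreMem (%22 +' %41) %42).
(** A query inherits memory but no registers. Register [r] goes to cell [r], so that the saved
    values satisfy [glob] with the memory in the place of the registers. *)
Definition c_save : cmd := foldr (fun r c => StoreMem (Const r) (Reg r) ;; c) Skip (iota 6 20).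
Definition c_level : cmd :=
  While (%32 +' %31 +' #1 <' %12) (If (#1 <' %32) c_process Skip ;; 32 <~ %32 +' %31).
Definition c_levels : cmd :=
  30 <~ #0 ;; 31 <~ #1 ;;
  While (%31 <' %12 +' #1)
    (32 <~ %31 ;; c_level ;; 31 <~ %31 +' %31 ;; 30 <~ %30 +' #1).

Lemma lt_Jn p j : (j < Jn p) = (2 ^ j <= iNc p).
Proof.
rewrite /Jn; case: eqP => [->|/eqP N0]; first by rewrite ltn0 leqn0 expn_eq0.
have N1 : 0 < iNc p by lia.
apply/idP/idP => h; last by rewrite ltnS trunc_log_max.
by apply: leq_trans (trunc_logP (isT : 1 < 2) N1); rewrite leq_exp2l.
Qed.

(** Unlike [size_tU], this holds for arbitrary random words: the preprocessing has to terminate on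
    every tape. *)
Lemma size_tU_all p om k pw : 0 < ilg p -> size (tU p om k pw) = iK p.
Proof.
move=> l0; rewrite /tU; have : 0 < ilam p by rewrite /ilam; lia.
have tsz (st : seq nat * seq nat * bool) l : (st.2 -> size st.1.2 = iK p) -> size (tstep p om k pw l st).1.2 = iK p.
  case: st => [[T U] dn] /=; case: dn => /= h; first exact: h.
  by case: (low p om k pw T (draws p om T l)) => [|sg r] /=; rewrite size_draws.
case: (ilam p) => // l _; elim: l => [|l IH]; apply: tsz => //.
Qed.

Section Levels.
Variables (R : realType) (b : nat) (eps : R) (p : inst) (om : nat -> nat).
Local Notation X := (iX p). Local Notation Y := (iY p).
Local Notation lg := (ilg p). Local Notation Nc := (iNc p). Local Notation K := (iK p).
Local Notation S := (iS p). Local Notation LB := (iLB p).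
Local Notation runs := (runs b X Y eps).
Hypothesis wfp : wf p.
Hypothesis HB : aTOP p < 2 ^ b.
Hypothesis nlg : size X + size Y < 2 ^ lg.

Lemma rec_ext j k pw m m' : 0 < pw ->
  (forall a, abase p j k <= a < abase p j k + pw * iRS p -> m' a = m a) ->
  rec p om j k pw m -> rec p om j k pw m'.
Proof.
move=> pw0 e [[h1 h2 h3 h4 h5] [h6 h7]].
have sX : size (listX p om k pw) <= pw * LB.
  by rewrite size_filter; apply: leq_trans (count_size _ _) _; rewrite size_map size_iota.
have sY : size (listY p om k pw) <= (pw + 2) * LB.
  by rewrite size_filter; apply: leq_trans (count_size _ _) _; rewrite size_map size_iota.
have pwLB : LB <= pw * LB by rewrite leq_pmull.
have p2 : (pw + 2) * LB = pw * LB + 2 * LB by lia.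
have pwRS : pw * iRS p = pw * (3 + S + K) + 4 * (pw * LB) by rewrite /iRS; nia.
have pw3 : 3 + S + K <= pw * (3 + S + K) by rewrite leq_pmull.
move: (pw * (3 + S + K)) (pw * iRS p) pwRS pw3 e => u v pwRS pw3 e.
split; first split.
- by rewrite e //; lia.
- by rewrite e //; lia.
- by rewrite e //; lia.
- by move=> sg sS; rewrite e ?h4 //; lia.
- by move=> i iK; rewrite e ?h5 //; lia.
by split=> t tl; rewrite e ?h6 ?h7 //; lia.
Qed.

(** [Q] delimits the intervals processed so far. *)
Definition recs (Q : nat -> nat -> Prop) (m : nat -> nat) : Prop :=
  forall j k, Q j k -> valid p k (2 ^ j) -> 2 ^ j %| k -> rec p om j k (2 ^ j) m.

Lemma valid_lg k j : valid p k (2 ^ j) -> j < lg.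
Proof.
move=> /andP[_ kN]; rewrite -(ltn_exp2l _ _ (isT : 1 < 2)).
apply: leq_ltn_trans nlg; have : Nc <= minn (size X) (size Y) by exact: leq_div.
by lia.
Qed.

Lemma abase_le j k j' k' : valid p k' (2 ^ j') -> j' < j \/ j' = j /\ k' + 2 ^ j' <= k ->
  abase p j' k' + 2 ^ j' * iRS p <= abase p j k.
Proof.
move=> /andP[_ kN] h; rewrite /abase -addnA -mulnDl leq_add2l leq_mul2r; apply/orP; right.
case: h => [jj|[-> kk]]; last by lia.
have : j'.+1 * (Nc + 1) <= j * (Nc + 1) by rewrite leq_mul2r jj orbT.
by rewrite mulSn; lia.
Qed.

(** An interval costs at most this much per chunk, so every level costs about [Nc * t_chunk]. *)
Definition t_chunk := S * 210 + t_tests p + 4 * LB * (K * 40 + 90) + 300.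

Lemma t_process_le pw : 0 < pw -> t_process p pw <= pw * t_chunk.
Proof.
move=> pw0; rewrite /t_process /t_chunk.
have h1 : S * ((pw + 2) * 50 + 60) <= pw * (S * 210).
  by rewrite mulnCA leq_mul2l; apply/orP; right; lia.
have h2 : t_tests p <= pw * t_tests p by rewrite leq_pmull.
have h3 : (2 * pw + 2) * LB * (K * 40 + 90) <= pw * (4 * LB * (K * 40 + 90)).
  by rewrite mulnA leq_mul2r; apply/orP; right; rewrite mulnA leq_mul2r; apply/orP; right; lia.
have h4 : 300 <= pw * 300 by rewrite leq_pmull.
rewrite (mulnDr pw _ 300) (mulnDr pw _ (4 * LB * (K * 40 + 90))) (mulnDr pw (S * 210) (t_tests p)).
exact: leq_add (leq_add (leq_add h1 h2) h3) h4.
Qed.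

Lemma level_ok s j : j < lg -> 2 ^ j <= Nc -> glob p s -> regs s 30 = j -> regs s 31 = 2 ^ j ->
  regs s 32 = 2 ^ j -> memR p om (memory s) -> recs (fun j' _ => j' < j) (memory s) ->
  runs c_level s (Nc * (t_chunk + 60) + 20) (fun s' =>
    [/\ memR p om (memory s'), recs (fun j' _ => j' < j.+1) (memory s') &
        forall a, a < aTM -> memory s' a = memory s a]).
Proof.
move=> jl pN g r30 r31 r32 mR rc.
have [[B64 w1 w2 w3] [w4 w5 w6 w7]] := bnd HB.
have NM : Nc <= iM p by rewrite /iM leq_addr.
have HB' := HB.
have Nm : Nc <= minn (size X) (size Y) by exact: leq_div.
set pw := 2 ^ j in r31 r32 pN *; have pw0 : 0 < pw by rewrite expn_gt0.
(* The number of multiples [k >= pw] of [pw] with [k + pw + 2 <= Nc]. *)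
pose N := (Nc - 2) %/ pw - 1.
have ltN m : (m < N) = (m.+1 * pw + pw + 2 <= Nc).
  rewrite /N ltn_subRL add1n leq_divRL // [m.+2 * pw]mulSnr.
  by apply/idP/idP; lia.
have NP : N * pw <= Nc.
  apply: leq_trans (_ : (Nc - 2) %/ pw * pw <= _); first by rewrite /N leq_mul2r leq_subr orbT.
  by apply: leq_trans (leq_divM _ _) _; lia.
have pc : t_process p pw <= pw * t_chunk by exact: t_process_le.
apply: runs_le.
  apply: (runs_weaken (runs_while (N := N) (tb := t_process p pw + 20) (Inv := fun m s' =>
    [/\ regs s' 32 = m.+1 * pw, memR p om (memory s'),
      recs (fun j' k' => j' < j \/ j' = j /\ k' < m.+1 * pw) (memory s') &
      forall a, a < aTM -> memory s' a = memory s a]) _ _ _) (leqnn _)); first last.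
  - move=> s' _ [r32' mR' rc' fr']; split=> // j' k' jj v dv.
    apply: rc' => //; move: jj; rewrite ltnS leq_eqVlt => /orP[/eqP jj|jj]; last by left.
    right; split=> //; have := ltnn N; rewrite {2}/N => _.
    have := ltN N; rewrite ltnn => /esym/negbT; rewrite -ltnNge => nN.
    have /andP[_ kN] := v; move: dv kN; rewrite jj -/pw => /dvdnP[c ->] kN.
    rewrite ltn_mul2r pw0 /= ltnNge; apply/negP => cN.
    have : N.+1 * pw <= c * pw by rewrite leq_mul2r cN orbT.
    by lia.
  - move=> s' [r32' _ _ _] [f1 _ _].
    have g' : glob p s' by apply: (glob_fr f1).
    have r31' : regs s' 31 = pw by rewrite f1.
    have := ltN N; rewrite ltnn => /esym/negbT; rewrite -ltnNge => nN.
    have le : N.+1 * pw <= Nc + pw by rewrite mulSnr; lia.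
    rewrite /= r32' r31' !g'; mds.
    by apply/eqP; rewrite eqb0 -leqNgt; lia.
  - move=> m s' mN [r32' mR' rc' fr'] [f1 _ _]; right.
    have g' : glob p s' by apply: (glob_fr f1).
    have r31' : regs s' 31 = pw by rewrite f1.
    have r30' : regs s' 30 = j by rewrite f1.
    have mN' : m.+1 * pw + pw + 2 <= Nc by rewrite -ltN.
    split.
      by rewrite /= r32' r31' !g'; mds; rewrite eqb0 negbK; lia.
    have m2 : m.+2 * pw = m.+1 * pw + pw by rewrite mulSnr.
    set k := m.+1 * pw in r32' rc' mN' m2 *.
    apply: runs_le.
      apply: runs_seq; apply: (@runs_weaken _ _ _ _ _ _ _ _ _ (fun s2 =>
        [/\ memR p om (memory s2),
          recs (fun j' k' => j' < j \/ j' = j /\ k' < m.+2 * pw) (memory s2) &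
          forall a, a < aTM -> memory s2 a = memory s a])); first last.
      + move=> s2 [f2 _ _] [q1 q2 q3]; apply: (@runs_set1 _ _ _ _ _ _ _ _ (m.+2 * pw)).
          by rewrite /= !f2 // r32' r31'; mds; rewrite m2.
        by split.
      + exact: leqnn.
      apply: (@runs_ifb _ _ _ _ _ _ _ _ _ (1 < k)).
      + by rewrite /= r32'; mds.
      + move=> k1; have v : valid p k pw by rewrite /valid k1 mN'.
        have l0 : 0 < lg by case: wfp => -[].
        have pr : runs c_process s' (t_process p pw) (fun s2 => rec p om j k pw (memory s2) /\
            (forall a, (a < aTM) || (aBA p <= a < abase p j k) -> memory s2 a = memory s' a)).
          by apply: process_ok => //; exact: size_tU_all.
        apply: runs_weaken pr (leqnn _) _ => s2 _ [q1 q2].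
        have bRB : aBA p + iM p <= abase p j k by rewrite -w5 /abase leq_addr.
        split.
        - by move=> i iM; rewrite q2 ?mR' //; lia.
        - move=> j' k' jj v' dv'.
          (* Any other finished record ends below the present one, in the part of memory that
             [c_process] leaves alone. *)
          have [[jj1 kk1]|jj1] : (j' = j /\ k' = k) \/ (j' < j \/ j' = j /\ k' + 2 ^ j' <= k).
            case: jj => [jj|[jj kk]]; [by right; left | ].
            have [e|ne] := eqVneq k' k; first by left.
            right; right; split=> //; move: dv' kk ne; rewrite jj -/pw /k => /dvdnP[c ->].
            by rewrite ltn_mul2r pw0 /= ltnS eqn_mul2r -mulSnr leq_mul2r => ? ?; lia.
          - by rewrite jj1 kk1.
          apply: (rec_ext (m := memory s')); first by rewrite expn_gt0.
            move=> a ha; apply: q2; have := abase_le v' jj1.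
            have : aRB p <= abase p j' k' by rewrite /abase leq_addr.
            by rewrite w5; lia.
          apply: rc' => //; case: jj1 => [|[ej kk]]; [by left | right; split=> //].
          have p0 : 0 < 2 ^ j' by rewrite expn_gt0.
          by lia.
        - by move=> a ha; rewrite q2 ?fr' // ha.
      + move=> k1; apply: runs_skip; split=> // j' k' jj v' dv'; apply: rc' => //.
        case: jj => [|[jj kk]]; [by left | right; split=> //].
        have /andP[k2 _] := v'; move: dv' k2 kk; rewrite jj -/pw m2 => /dvdnP[c ->].
        move: k1; rewrite -leqNgt => k1 k2 kk.
        have : pw <= k by rewrite /k leq_pmull.
        by lia.
    by rewrite /=; lia.
  - split=> //; first by rewrite mul1n.
    move=> j' k' jj v' dv'; apply: rc => //; case: jj => // -[jj kk].
    by have /andP[k2 _] := v'; move: dv' k2 kk; rewrite jj -/pw mul1n => /dvdnP[[|c] ->] //; rewrite mulSn; lia.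
rewrite /=; apply: leq_trans (_ : N * (pw * (t_chunk + 50)) + 20 <= _); last first.
  by rewrite mulnA; apply: leq_add => //; apply: leq_mul => //; lia.
have : N * (8 + (t_process p pw + 20)) <= N * (pw * (t_chunk + 50)).
  by rewrite leq_mul2l; apply/orP; right; rewrite mulnDr; lia.
lia.
Qed.

Definition t_levels := lg * (Nc * (t_chunk + 60) + 60) + 30.

Lemma levels_ok s : glob p s -> memR p om (memory s) ->
  runs c_levels s t_levels (fun s' =>
    recs (fun _ _ => True) (memory s') /\ forall a, a < aTM -> memory s' a = memory s a).
Proof.
move=> g mR.
have [[B64 w1 w2 w3] [w4 w5 w6 w7]] := bnd HB.
have NM : Nc <= iM p by rewrite /iM leq_addr.
have HB' := HB.
have Nlg : Nc < 2 ^ lg.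
  apply: leq_ltn_trans nlg; have : Nc <= minn (size X) (size Y) by exact: leq_div.
  by lia.
have Jlg : Jn p <= lg.
  rewrite leqNgt; apply/negP; rewrite lt_Jn; lia.
have j2 j : 2 ^ j <= Nc -> 2 ^ j.+1 < 2 ^ b.
  move=> h; rewrite expnS; have : Nc <= minn (size X) (size Y) by exact: leq_div.
  by lia.
apply: runs_le.
  apply: (@runs_set _ _ _ _ _ _ _ _ 0); first by rewrite /= mod0n.
  apply: (@runs_set _ _ _ _ _ _ _ _ 1); first by rewrite /=; mds.
  apply: (runs_weaken (runs_while (N := Jn p) (tb := Nc * (t_chunk + 60) + 40) (Inv := fun j s' =>
    [/\ regs s' 30 = j, regs s' 31 = 2 ^ j, memR p om (memory s'),
      recs (fun j' _ => j' < j) (memory s') &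
      forall a, a < aTM -> memory s' a = memory s a]) _ _ _) (leqnn _)); first last.
  - move=> s' _ [_ _ _ rc fr]; split=> // j k _ v dv; apply: rc => //.
    by rewrite lt_Jn; have /andP[] := v; lia.
  - move=> s' [_ r31 _ _ _] [f1 _ _].
    have g' : glob p s' by apply: (glob_fr f1) => //; do 2 apply: glob_set => //.
    by rewrite /= r31 !g'; mds; apply/eqP; rewrite eqb0 -leqNgt; have := Jn_gt p; lia.
  - move=> j s' jJ [r30 r31 mR' rc fr] [f1 _ _]; right.
    have g' : glob p s' by apply: (glob_fr f1) => //; do 2 apply: glob_set => //.
    have pN : 2 ^ j <= Nc by rewrite -lt_Jn.
    split; first by rewrite /= r31 !g'; mds; rewrite eqb0 negbK; lia.
    apply: runs_le.
      apply: (@runs_set _ _ _ _ _ _ _ _ (2 ^ j)); first by rewrite /= r31.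
      have lv := @level_ok (set_reg s' 32 (2 ^ j)) j (leq_trans jJ Jlg) pN (glob_set _ (isT : 29 < 32) g') r30 r31 (erefl _) mR' rc.
      apply: runs_seqw lv _ => s2 [f2 _ _] [q1 q2 q3].
      have r31' : regs s2 31 = 2 ^ j by rewrite f2 // regs_set.
      have r30' : regs s2 30 = j by rewrite f2 // regs_set.
      apply: (@runs_set _ _ _ _ _ _ _ _ (2 ^ j.+1)).
        by have := j2 _ pN; rewrite /= r31' expnS => ?; mds; lia.
      apply: (@runs_set1 _ _ _ _ _ _ _ _ j.+1).
        by rewrite /= r30'; have := ltn_expl j (isT : 1 < 2) => ?; mds; rewrite addn1.
      split=> // a ha; rewrite ?memory_set_reg q3 // fr //.
    by rewrite /=; lia.
  - by split.
rewrite /t_levels /=.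
have : Jn p * (6 + (Nc * (t_chunk + 60) + 40)) <= lg * (Nc * (t_chunk + 60) + 60).
  by apply: leq_mul => //; lia.
lia.
Qed.

End Levels.

Section RandSave.
Variables (R : realType) (b : nat) (eps : R) (X Y : seq nat).
Local Notation runs := (runs b X Y eps).

Lemma rand_ok s M A : regs s 40 = M -> regs s 22 = A -> M <= size (tape s) -> A + M < 2 ^ b -> 1 < 2 ^ b ->
  runs c_rand s (M * 30 + 10) (fun s' =>
    (forall i, i < M -> memory s' (A + i) = nth 0 (tape s) i) /\
    (forall a, (a < A) || (A + M <= a) -> memory s' a = memory s a)).
Proof.
move=> r40 r22 Ms AB B1; apply: runs_le.
  apply: (runs_weaken (runs_For (N := M) (tb := 10) (Inv := fun m s' =>
    [/\ tape s' = drop m (tape s), forall i, i < m -> memory s' (A + i) = nth 0 (tape s) i &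
     forall a, (a < A) || (A + M <= a) -> memory s' a = memory s a]) _ _ _ _ _ _) (leqnn _)) => //.
  - by lia.
  - by split; rewrite ?drop0.
  - by move=> s' fr _; rewrite /= fr.
  - move=> m s' mM r41 fr _ _ [I1 I2 I3].
    have mt : m < size (tape s) by lia.
    apply: runs_le.
      apply: runs_seq; apply: (@runs_rand _ _ _ _ _ _ _ (nth 0 (tape s) m) (drop m.+1 (tape s))).
        by rewrite I1 (drop_nth 0 mt).
      apply: (@runs_put1 _ _ _ _ _ _ _ _ (A + m) (nth 0 (tape s) m)).
      - by rewrite /= r41 fr //= r22; mds.
      - by [].
      split=> //.
      - move=> i; rewrite ltnS leq_eqVlt /= => /orP[/eqP->|im]; first by rewrite eqxx.
        by rewrite ifF ?I2 //; apply/eqP; lia.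
      - by move=> a ha /=; rewrite ifF ?I3 //; apply/eqP; lia.
    by [].
  - by move=> s' _ [_ ? ?]; split.
by rewrite /=; lia.
Qed.

Lemma save_seq_ok s rs : all (gtn (2 ^ b)) rs ->
  runs (foldr (fun r c => StoreMem (Const r) (Reg r) ;; c) Skip rs) s (3 * size rs + 1) (fun s' =>
  [/\ forall r, r \in rs -> memory s' r = regs s r, regs s' = regs s &
      forall a, a \notin rs -> memory s' a = memory s a]).
Proof.
elim: rs s => [|r rs IH] s /=; first by move=> _; apply: runs_skip; split.
move=> /andP[rB al]; apply: runs_le.
  apply: (@runs_put _ _ _ _ _ _ _ _ r (regs s r)); [by rewrite /= modn_small | by [] |].
  apply: (runs_weaken (IH _ al) (leqnn _)) => s' _ [h1 h2 h3]; split=> //.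
    move=> r'; rewrite inE; case: (boolP (r' \in rs)) => [/h1 -> //|nr].
    by rewrite orbF => /eqP er; subst r'; rewrite h3 //= eqxx.
  move=> a; rewrite inE negb_or => /andP[na nar]; rewrite h3 //=.
  by rewrite (negbTE na).
by rewrite /=; lia.
Qed.

Lemma save_ok s : 26 < 2 ^ b -> runs c_save s 61 (fun s' =>
  [/\ forall r, 6 <= r < 26 -> memory s' r = regs s r, regs s' = regs s &
      forall a, 26 <= a -> memory s' a = memory s a]).
Proof.
move=> B26; have al : all (gtn (2 ^ b)) (iota 6 20).
  by apply/allP => r; rewrite mem_iota /=; lia.
apply: (runs_weaken (save_seq_ok s al) (leqnn _)) => s' _ [h1 h2 h3]; split=> // a ha.
  by apply: h1; rewrite mem_iota.
by apply: h3; rewrite mem_iota; lia.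
Qed.

End RandSave.

(** * Small auxiliary programs *)

Definition c_min (r : nat) (e1 e2 : expr) : cmd := If (e1 <' e2) (r <~ e1) (r <~ e2).

(** The exponent at which doubling from 1 stops; [q], [bet] and [L] are all found this way. *)
Definition dexp (P : pred nat) N := find (fun v => ~~ P (2 ^ v)) (iota 0 N.+1).

Lemma dexpP P N : ~~ P (2 ^ N) ->
  [/\ dexp P N <= N, ~~ P (2 ^ dexp P N) & forall u, u < dexp P N -> P (2 ^ u)].
Proof.
move=> nP; have hs : has (fun v => ~~ P (2 ^ v)) (iota 0 N.+1).
  by apply/hasP; exists N => //; rewrite mem_iota add0n ltnS leqnn.
have lt : dexp P N < N.+1 by move: hs; rewrite has_find size_iota.
split=> //.
  by have := nth_find 0 hs; rewrite -/(dexp P N) nth_iota // add0n.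
move=> u ud; have := before_find 0 ud; rewrite nth_iota; last exact: ltn_trans ud lt.
by rewrite add0n => /negbFE.
Qed.

Section Loops.
Variables (R : realType) (b : nat) (eps : R) (X Y : seq nat).
Local Notation runs := (runs b X Y eps).
Local Notation eval := (eval b X Y eps).

Lemma min_ok s r e1 e2 v1 v2 (Q : state -> Prop) : eval s e1 = v1 -> eval s e2 = v2 ->
  Q (set_reg s r (minn v1 v2)) -> runs (c_min r e1 e2) s (2 * expr_cost e1 + 2 * expr_cost e2 + 10) Q.
Proof.
move=> <- <-; rewrite /minn => q; apply: runs_le.
  apply: (runs_ifb (v := eval s e1 < eval s e2)) => //= [lt|/negbTE lt]; apply: runs_assign; by move: q; rewrite lt.
by rewrite /=; lia.
Qed.

Lemma runs_min s r e1 e2 v1 v2 c2 t (Q : state -> Prop) : eval s e1 = v1 -> eval s e2 = v2 ->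
  runs c2 (set_reg s r (minn v1 v2)) t Q ->
  runs (Seq (c_min r e1 e2) c2) s (2 * expr_cost e1 + 2 * expr_cost e2 + 10 + t) Q.
Proof. by move=> h1 h2 h; apply: runs_seq; apply: min_ok h1 h2 h. Qed.

Lemma loads_ok s l : all (fun r => r < 2 ^ b) l ->
  runs (foldr (fun r c => Seq (Assign r (LoadMem (Const r))) c) Skip l) s (size l * 3 + 1) (fun s' =>
    (forall r, regs s' r = if r \in l then memory s r else regs s r) /\ memory s' = memory s).
Proof.
elim: l s => [|a l IH] s /=; first by move=> _; exact: runs_skip.
move=> /andP[ab al]; apply: runs_le.
  apply: (@runs_set _ _ _ _ _ _ _ _ (memory s a)); first by rewrite /= modn_small.
  apply: (runs_weaken (IH _ al) (leqnn _)) => s' _ [h1 h2]; split=> // r.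
  by rewrite h1 inE regs_set memory_set_reg; case: eqP => [->|_] /=; case: (_ \in l).
by rewrite /=; lia.
Qed.

(** The guard has to agree with [P] only up to [2 ^ N], a range in which doubling does not wrap
    around. *)
Lemma dbl_ok r N e s (P : pred nat) : regs s r = 1 -> 2 ^ N < 2 ^ b ->
  (forall s' v, (forall r', r' != r -> regs s' r' = regs s r') -> regs s' r = v -> 0 < v ->
     v <= 2 ^ N -> eval s' e = P v) -> ~~ P (2 ^ N) ->
  runs (While e (r <~ %r +' %r)) s (N * (expr_cost e + 5) + expr_cost e + 1)
    (fun s' => regs s' r = 2 ^ dexp P N).
Proof.
move=> r1 NB ev nP; have [vN nPv Pv] := dexpP nP.
apply: runs_le.
  apply: (runs_while (N := dexp P N) (tb := 4) (Inv := fun k s' => regs s' r = 2 ^ k)).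
  - by rewrite r1 expn0.
  - move=> k s' kN rk [f1 _ _]; right.
    have kN2 : 2 ^ k.+1 <= 2 ^ N by rewrite leq_exp2l //; exact: leq_trans kN vN.
    have kk : 2 ^ k.+1 = 2 ^ k + 2 ^ k by rewrite expnS mul2n addnn.
    have fr r' : r' != r -> regs s' r' = regs s r' by move=> h; apply: f1; rewrite /= inE.
    split; first by rewrite (ev s' (2 ^ k)) // ?expn_gt0 ?Pv //; lia.
    apply: (@runs_set1 _ _ _ _ _ _ _ _ (2 ^ k.+1)).
      by rewrite /= rk -kk modn_small //; exact: leq_ltn_trans kN2 NB.
    by rewrite regs_set eqxx.
  - move=> s' rk [f1 _ _].
    have fr r' : r' != r -> regs s' r' = regs s r' by move=> h; apply: f1; rewrite /= inE.
    by rewrite (ev s' (2 ^ dexp P N)) ?expn_gt0 ?leq_exp2l // (negbTE nPv).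
have := leq_mul vN (leqnn (expr_cost e + 5)); rewrite !mulnDr; lia.
Qed.

End Loops.

(** * Bounds by powers of a common base *)

Section Powers.
Variable V : nat.
Hypothesis V2 : 1 < V.

Lemma pow_le x a e : x <= V ^ a -> a <= e -> x <= V ^ e.
Proof. by move=> h ae; apply: leq_trans h _; rewrite leq_exp2l. Qed.
Lemma const_pow k a e : k <= 2 ^ a -> a <= e -> k <= V ^ e.
Proof. by move=> h ae; apply: leq_trans h _; apply: (@leq_trans (V ^ a)); [case: (a) => // a'; rewrite leq_exp2r | rewrite leq_exp2l]. Qed.
Lemma constp k e : k <= 2 ^ e -> k <= V ^ e.
Proof. by move=> h; apply: (const_pow h). Qed.
Lemma mul_pow U x y a c e : x <= V ^ a * U -> y <= V ^ c -> a + c <= e -> x * y <= V ^ e * U.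
Proof.
move=> h1 h2 ace; apply: leq_trans (leq_mul h1 h2) _; rewrite mulnAC -expnD leq_mul2r leq_exp2l //.
by rewrite ace orbT.
Qed.
(** As [V >= 2], a sum costs one exponent. This bookkeeping is used with [V = 2 ^ lg] for word sizes
    and with a logarithmic [V] for running times. *)
Lemma add_pow U x y a c e : x <= V ^ a * U -> y <= V ^ c * U -> a < e -> c < e -> x + y <= V ^ e * U.
Proof.
move=> h1 h2 ae ce; case: e ae ce => // e ae ce.
have g z f : z <= V ^ f * U -> f < e.+1 -> z <= V ^ e * U.
  by move=> h fe; apply: leq_trans h _; rewrite leq_mul2r leq_exp2l // -ltnS fe orbT.
have k1 := g _ _ h1 ae; have k2 := g _ _ h2 ce.
apply: (@leq_trans (2 * (V ^ e * U))); first by rewrite mul2n -addnn leq_add.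
by rewrite mulnA expnS leq_mul2r; apply/orP; right; rewrite leq_mul2r V2 orbT.
Qed.
Lemma unit_pow U x a e : 0 < U -> x <= V ^ a -> a <= e -> x <= V ^ e * U.
Proof. by move=> U0 h ae; apply: leq_trans (pow_le h ae) _; rewrite leq_pmulr. Qed.
Lemma mulp x y a c e : x <= V ^ a -> y <= V ^ c -> a + c <= e -> x * y <= V ^ e.
Proof. by move=> h1 h2 h3; rewrite -[V ^ e]muln1; apply: mul_pow h2 h3; rewrite muln1. Qed.
Lemma addp x y a c e : x <= V ^ a -> y <= V ^ c -> a < e -> c < e -> x + y <= V ^ e.
Proof. by move=> h1 h2 h3 h4; rewrite -[V ^ e]muln1; apply: (@add_pow 1 _ _ a c); rewrite ?muln1. Qed.
End Powers.

(** * The query program *)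

Definition c_load : cmd := foldr (fun r c => r <~ LoadMem (Const r) ;; c) Skip (iota 7 19).

(* Registers: 60 position, 61 count, 62 stop flag, 63 limit, 64 end of the overlap, 65 sigma *)
Definition c_scan : cmd :=
  While (%62 <' (%60 <' %63))
    (If (ReadX %60 =' ReadY (%60 +' %8 -' %65))
        (60 <~ %60 +' #1)
        (If (%2 *' (#2 *' %9 +' #1) <' #2 *' %9 *' (%61 +' #1)) (62 <~ #1)
            (61 <~ %61 +' #1 ;; 60 <~ %60 +' #1))).

(* Registers: 32 k, 31 pw, 33 base, 34 sg0, 66 estimate, 48 offset of the tests *)
Definition c_lx : cmd :=
  For 40 (LoadMem (%33 +' #1))
    (41 <~ LoadMem (%33 +' #3 +' %17 +' %13 +' %40) ;;
     If (ReadX %41 =' ReadY (%41 +' %8 -' %65)) Skip (66 <~ %66 +' #1)).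

(** Evaluates [ymis] with the cheap conditions first, so that the [K] tests are run at mismatches
    only. *)
Definition c_ly : cmd :=
  For 40 (LoadMem (%33 +' #2))
    (41 <~ LoadMem (%33 +' #3 +' %17 +' %13 +' LoadMem (%33 +' #1) +' %40) +' %65 -' %8 ;;
     If (%41 <' %32 *' %11) Skip
     (If (%41 <' (%32 +' %31) *' %11)
       (If (ReadX %41 =' ReadY (%41 +' %8 -' %65)) Skip
         (c_hv ReadX ;; If %42 Skip (66 <~ %66 +' #1))) Skip)).

Definition c_pass : cmd :=
  If (%32 +' %31 +' #1 <' %12)
    (33 <~ %19 +' (%30 *' (%12 +' #1) +' %32) *' %18 ;;
     If (LoadMem (%33 +' #3 +' %65))
       (48 <~ %8 +' %16 -' LoadMem %33 ;; 66 <~ #0 ;; c_lx ;; c_ly ;; 66 <~ %66 *' %10 ;;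
        If (%2 *' (#2 *' %9 +' #1) <' #2 *' %9 *' (%61 +' %66)) Skip
           (32 <~ %32 +' %31 ;; 61 <~ %61 +' %66)) Skip) Skip.

Definition c_up : cmd :=
  30 <~ #0 ;; 31 <~ #1 ;;
  While (%31 <' %12 +' #1)
    (If (%32 %%' %31) Skip (If (%32 %%' (%31 +' %31)) c_pass Skip) ;;
     31 <~ %31 +' %31 ;; 30 <~ %30 +' #1).

Definition c_dn : cmd :=
  While (#0 <' %30)
    (30 <~ %30 -' #1 ;; 31 <~ %31 /' #2 ;;
     If (%32 %%' %31) Skip c_pass).

(** The first interval starts at chunk [x %/ L + 2], leaving a full chunk after [x] for the enlarged
    interval of the flags. *)
Definition qry : cmd :=
  If (%2 <' %0 +' %1)
    (c_load ;;
     c_min 64 %0 (%1 +' %4 -' %5) ;;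
     65 <~ %4 +' %8 -' %5 ;; 60 <~ %4 ;; 61 <~ #0 ;; 62 <~ #0 ;;
     32 <~ %4 /' %11 +' #2 ;;
     c_min 63 %64 (%32 *' %11) ;;
     c_scan ;;
     If %62 Skip
      (If (%60 <' %64)
        (c_up ;; c_dn ;; 60 <~ %32 *' %11 ;; c_min 63 %64 ((%32 +' #4) *' %11) ;; c_scan) Skip) ;;
     0 <~ %60 -' %4)
    (c_min 0 (%0 -' %4) (%1 -' %5)).

Lemma qry_rand_free : rand_free qry. Proof. by []. Qed.

Section QueryRun.
Variables (R : realType) (b : nat) (eps : R) (p : inst) (om : nat -> nat) (x y : nat).
Local Notation X := (iX p). Local Notation Y := (iY p).
Local Notation d := (idd p). Local Notation W := (iW p).
Local Notation lg := (ilg p). Local Notation q := (iq p).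
Local Notation bet := (ibet p). Local Notation L := (iL p).
Local Notation Nc := (iNc p). Local Notation K := (iK p). Local Notation Z := (iZ p).
Local Notation S := (iS p). Local Notation LB := (iLB p). Local Notation lam := (ilam p).
Local Notation runs := (runs b X Y eps).
Local Notation eval := (eval b X Y eps).
Local Notation sg := (qsg p x y).
Local Notation E := (qE p x y).
Local Notation F := (qF p x y).
Variable m0 : nat -> nat.
Hypothesis wfp : wf p.
Hypothesis HB : aTOP p < 2 ^ b.
Hypothesis HQ : (2 * q + 2) * (2 * d + 8 * (size X + size Y) + 8) + (size X + size Y) + 8 * L < 2 ^ b.
Hypothesis nlg : size X + size Y < 2 ^ lg.
Hypothesis dn : d < size X + size Y.
Hypothesis rc : recs p om (fun _ _ => True) m0.
Hypothesis gd : forall k j, 2 ^ j %| k -> valid p k (2 ^ j) -> good p om k (2 ^ j).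
Hypothesis hx : x <= size X.
Hypothesis hy : y <= size Y.
Hypothesis hxy : x <= y + W.
Hypothesis hyx : y <= x + W.

Let q0 : 0 < q. Proof. by case: wfp => _ []. Qed.
Let d0 : 0 < d. Proof. by case: wfp => -[]. Qed.
Let lg0 : 0 < lg. Proof. by case: wfp => -[]. Qed.
Let W0 : 0 < W. Proof. by case: wfp => -[]. Qed.
Let LW : 2 * W <= L.
Proof.
case: wfp => -[] l0 w0 d0' _ LL _; apply: leq_trans LL.
by rewrite leq_mul2r; apply/orP; right; nia.
Qed.
Let L0 : 0 < L. Proof. by move: LW W0; lia. Qed.
Let b0 : 0 < bet. Proof. by case: wfp => _ []. Qed.
Let LBb : LB * bet = L.
Proof. by rewrite /iLB divnK //; case: wfp => _ []. Qed.
Let NX : Nc * L <= size X /\ Nc * L <= size Y.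
Proof. by have := leq_divM (minn (size X) (size Y)) L; rewrite -/(iNc p); lia. Qed.
Let Wb : 2 * W + 2 * Z < 2 ^ b /\ 64 < 2 ^ b.
Proof. by have [[? ? ? ?] [? ? ? ?]] := bnd HB; have := HB; lia. Qed.
Let HQ1 : (2 * q + 2) * (2 * d + 8 * (size X + size Y) + 8) < 2 ^ b. Proof. by move: HQ; lia. Qed.
Let HQ2 : size X + size Y + 8 * L < 2 ^ b. Proof. by move: HQ; lia. Qed.

Lemma qmul_bnd u : u <= 2 * d + 8 * (size X + size Y) + 8 -> 2 * q * u < 2 ^ b /\ u < 2 ^ b.
Proof.
move=> h; have : (2 * q + 2) * u <= (2 * q + 2) * (2 * d + 8 * (size X + size Y) + 8).
  by rewrite leq_mul2l h orbT.
by move: HQ1; rewrite mulnDl; lia.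
Qed.

Lemma dq_bnd : d * (2 * q + 1) < 2 ^ b.
Proof. by have [] := @qmul_bnd d; [lia|]; have [] := @qmul_bnd (d + d); [lia|]; rewrite mulnDr; lia. Qed.

Lemma acc_bnd acc : 2 * q * acc <= (2 * q + 1) * d -> acc <= 2 * d.
Proof.
move=> h; rewrite -(leq_pmul2l (_ : 0 < 2 * q)); last by move: q0; lia.
by apply: leq_trans h _; rewrite (_ : 2 * q * (2 * d) = (4 * q) * d) ?leq_mul2r; move: q0; lia.
Qed.

Definition gq (s : state) : Type := glob p s * (regs s 2 = d) * (regs s 65 = sg) * (memory s = m0).

Lemma gq_fr s s' l : (forall r, r \notin l -> regs s' r = regs s r) ->
  all (fun r => (30 <= r) && (r != 65)) l -> memory s' = memory s -> gq s -> gq s'.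
Proof.
move=> fr /allP al me [[[g r2] r65] mm]; split; last by rewrite me.
have al30 : all (leq 30) l by apply/allP => r /al /andP[].
split; last by rewrite fr //; apply/negP => /al.
split; first exact: glob_fr fr al30 g.
by rewrite fr //; apply/negP => /al.
Qed.

Lemma gq_set s r v : (30 <= r) && (r != 65) -> gq s -> gq (set_reg s r v).
Proof.
move=> h; apply: (@gq_fr _ _ [:: r]) => //=; last by rewrite h.
by move=> r' /=; rewrite inE => /negbTE ->.
Qed.

Lemma sg_lt : sg < S. Proof. by rewrite /qsg /iS; lia. Qed.
Lemma E_le : E <= size X /\ E <= size Y + W.
Proof. by rewrite /qE; lia. Qed.

Lemma scan_ok s pos0 acc0 lim : gq s -> regs s 60 = pos0 -> regs s 61 = acc0 -> regs s 62 = 0 ->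
  regs s 63 = lim -> x <= pos0 -> pos0 <= lim -> lim <= E -> 2 * q * acc0 <= (2 * q + 1) * d ->
  runs c_scan s ((lim - pos0) * 60 + 10) (fun s' => exists pos acc (st : bool),
    [/\ regs s' 60 = pos, regs s' 61 = acc & regs s' 62 = st] /\
    [/\ pos0 <= pos <= lim, acc = acc0 + (F pos - F pos0), 2 * q * acc <= (2 * q + 1) * d &
        if st then (pos < lim) && mis p sg pos && ((2 * q + 1) * d < 2 * q * acc.+1) else pos == lim]).
Proof.
move=> g r60 r61 r62 r63 xp pl lE th0.
have [E1 E2] := E_le; have [Wb1 Wb2] := Wb; have sgl := sg_lt.
have HQ2' := HQ2; have dqb := dq_bnd; have LW' := LW.
apply: runs_le.
  apply: (runs_weaken (runs_while (N := lim - pos0) (tb := 50) (Inv := fun m s' => exists pos acc (st : bool),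
    [/\ regs s' 60 = pos, regs s' 61 = acc & regs s' 62 = st] /\
    [/\ pos0 <= pos <= lim, acc = acc0 + (F pos - F pos0), 2 * q * acc <= (2 * q + 1) * d &
        if st then (pos < lim) && mis p sg pos && ((2 * q + 1) * d < 2 * q * acc.+1) else pos == pos0 + m]) _ _ _) (leqnn _)); first last.
  - move=> s' _ [pos [acc [st [h1 [h2 h3 h4 h5]]]]]; exists pos, acc, st; split=> //; split=> //.
    by case: (st) h5 => // /eqP ->; apply/eqP; lia.
  - move=> s' [pos [acc [st [[h60 h61 h62] [h2 h3 h4 h5]]]]] [f1 _ _].
    have r63' : regs s' 63 = lim by rewrite f1.
    (* The guard compares truth values: it holds iff the stop flag is 0 and the position is below
       the limit. *)
    rewrite /= h60 h62 r63'; case: (st) h5 => [|/eqP ->]; first by case: (_ < lim).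
    by rewrite (_ : _ < lim = false) //; apply/negbTE; lia.
  - move=> m s' mN [pos [acc [st [[h60 h61 h62] [h2 h3 h4 h5]]]]] [f1 _ /(_ isT) me].
    have r63' : regs s' 63 = lim by rewrite f1.
    have g' : gq s' by apply: (gq_fr f1).
    case: st h62 h5 => h62 h5.
      left; split; first by rewrite /= h62; case: (regs s' 60 < regs s' 63).
      by exists pos, acc, true.
    right; have pm : pos < lim by rewrite (eqP h5); lia.
    have ab := acc_bnd h4.
    have [u1 u2] : 2 * q * (acc + 1) < 2 ^ b /\ acc + 1 < 2 ^ b by apply: qmul_bnd; lia.
    have [u3 u4] : 2 * q * 1 < 2 ^ b /\ 1 < 2 ^ b by apply: qmul_bnd; lia.
    have [u5 u6] : 2 * q * 2 < 2 ^ b /\ 2 < 2 ^ b by apply: qmul_bnd; lia.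
    split; first by rewrite /= h60 h62 r63' pm.
    have FS : F (pos.+1) = F pos + mis p sg pos.
      by rewrite -addn1 qF_add /= ?addn0 //; lia.
    have FM : F pos0 <= F pos by case/andP: h2 => h2 _; apply: qF_le.
    apply: runs_le.
      apply: (@runs_ifb _ _ _ _ _ _ _ _ _ (~~ mis p sg pos)).
      + by rewrite /= h60 !g'; mds; rewrite /mis negbK.
      + move=> nm; apply: (@runs_set1 _ _ _ _ _ _ _ _ (pos + 1)); first by rewrite /= h60; mds.
        exists (pos + 1), acc, false; rewrite !regs_set /=; split=> //; split=> //; [lia | | ].
          by rewrite addn1 FS (negbTE nm) addn0.
        by apply/eqP; rewrite (eqP h5); lia.
      + rewrite negbK => ms.
        apply: (@runs_ifb _ _ _ _ _ _ _ _ _ ((2 * q + 1) * d < 2 * q * acc.+1)).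
        * by rewrite /= h61 !g'; mds; rewrite -[acc.+1]addn1 [d * _]mulnC.
        * move=> st; apply: (@runs_set1 _ _ _ _ _ _ _ _ 1); first by rewrite /=; mds.
          exists pos, acc, true; rewrite !regs_set /=; split=> //; split=> //.
          by rewrite pm ms st.
        * rewrite -leqNgt => st; apply: (@runs_set _ _ _ _ _ _ _ _ (acc + 1)); first by rewrite /= h61; mds.
          apply: (@runs_set1 _ _ _ _ _ _ _ _ (pos + 1)); first by rewrite /= h60; mds.
          exists (pos + 1), (acc + 1), false; rewrite !regs_set /=; split=> //; split=> //; [lia | | | ].
          - by rewrite addn1 addn1 FS ms; lia.
          - by rewrite addn1.
          - by apply/eqP; rewrite (eqP h5); lia.
    by [].
  - exists pos0, acc0, false; split=> //; split=> //; [lia | by rewrite subnn addn0 | by rewrite addn0].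
by rewrite /=; lia.
Qed.

Section Pass.
Variables (j k : nat).
Hypothesis val : valid p k (2 ^ j).
Hypothesis jk : 2 ^ j %| k.
Local Notation pw := (2 ^ j).
Local Notation base := (abase p j k).

Let jlg : j < lg. Proof. exact: (valid_lg HB nlg val). Qed.
Let pw0 : 0 < pw. Proof. by rewrite expn_gt0. Qed.
Let gk := gd jk val.
Let rk : rec p om j k pw m0. Proof. exact: rc. Qed.
Let sUK : size (tU p om k pw) = K. Proof. exact: size_tU_all. Qed.
Let s0S : sg0 p om k pw < S. Proof. exact: sg0_lt. Qed.

Lemma posD_lt bb : bb < Nc * LB -> posD p om bb < Nc * L.
Proof.
move=> h; have := ltn_pmod (om (Nc + lam * K + bb)) b0.
have : bb.+1 * bet <= Nc * LB * bet by rewrite leq_mul2r h orbT.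
by rewrite -mulnA LBb /posD mulSn; lia.
Qed.

Lemma listX_lt i : i \in listX p om k pw -> i < Nc * L.
Proof.
rewrite mem_filter => /andP[_ /mapP[bb]]; rewrite mem_iota => h ->; apply: posD_lt.
have /andP[k2 kN] := val; have : (k + pw + 2) * LB <= Nc * LB by rewrite leq_mul2r kN orbT.
by rewrite !mulnDl; lia.
Qed.

Lemma listY_lt i : i \in listY p om k pw -> i < Nc * L.
Proof.
rewrite mem_filter => /andP[_ /mapP[bb]]; rewrite mem_iota => h ->; apply: posD_lt.
have /andP[k2 kN] := val; have : (k + pw + 2) * LB <= Nc * LB by rewrite leq_mul2r kN orbT.
have : k.-1 * LB + LB = k * LB by case: (k) k2 => //= k' _; rewrite mulSnr.
by move: h; rewrite !mulnDl; lia.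
Qed.

Let bs : base + pw * iRS p <= aTOP p /\ aRB p <= base.
Proof. exact: (abase_bnd HB val jlg pw0). Qed.

Let sX : size (listX p om k pw) <= pw * LB.
Proof. by rewrite size_filter; apply: leq_trans (count_size _ _) _; rewrite size_map size_iota. Qed.
Let sY : size (listY p om k pw) <= (pw + 2) * LB.
Proof. by rewrite size_filter; apply: leq_trans (count_size _ _) _; rewrite size_map size_iota. Qed.

Lemma rec_bnd : base + 3 + S + K + size (listX p om k pw) + size (listY p om k pw) < 2 ^ b.
Proof.
have [h1 h2] := bs; have HB' := HB.
have pwLB : LB <= pw * LB by rewrite leq_pmull.
have p2 : (pw + 2) * LB = pw * LB + 2 * LB by lia.
have pwRS : pw * iRS p = pw * (3 + S + K) + 4 * (pw * LB) by rewrite /iRS; nia.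
have pw3 : 3 + S + K <= pw * (3 + S + K) by rewrite leq_pmull.
have [sX' sY'] : size (listX p om k pw) <= pw * LB /\ size (listY p om k pw) <= (pw + 2) * LB by split.
move: (pw * (3 + S + K)) (pw * iRS p) pwRS pw3 h1 => u v pwRS pw3 h1; lia.
Qed.

(** Bounds both lists of a good interval independently of [pw]; this is what makes long intervals
    affordable. *)
Definition tl := iK p * (2 * lam + 1) * iH p + 2 * L.

Lemma lx_ok s : gq s -> ivl p j k pw s -> flag p om k pw sg -> regs s 66 = 0 ->
  runs c_lx s (tl * 50 + 20) (fun s' => regs s' 66 = count (mis p sg) (listX p om k pw)).
Proof.
move=> g iv fl r66; have [[h1 h2 h3 h4 h5] [h6 h7]] := rk.
have [Wb1 Wb2] := Wb; have rb := rec_bnd; have [NX1 NX2] := NX; have HQ2' := HQ2.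
have sgl := sg_lt.
have sl : size (listX p om k pw) <= tl.
  by apply: leq_trans (size_listX wfp val gk (ex_intro2 _ _ sg sgl fl)) _; rewrite /tl leq_addr.
apply: runs_le.
  apply: (@runs_weaken _ _ _ _ _ _ _ _ _ (fun s' => regs s' 66 = count (mis p sg) (take (size (listX p om k pw)) (listX p om k pw)))); first last.
  - by move=> s' _ ->; rewrite take_size.
  - exact: leqnn.
  apply: (runs_For (N := size (listX p om k pw)) (tb := 35) (Inv := fun m s' => regs s' 66 = count (mis p sg) (take m (listX p om k pw)))) => //.
  - by lia.
  - by lia.
  - by rewrite take0.
  - move=> s' fr /(_ isT) me; have iv' : ivl p j k pw s' by apply: (ivl_fr fr).
    by rewrite /= !iv'; mds; rewrite me g h2.
  move=> m s' mN r40 fr _ /(_ isT) me I.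
  have g' : gq s' by apply: (gq_fr fr).
  have iv' : ivl p j k pw s' by apply: (ivl_fr fr).
  pose i := nth 0 (listX p om k pw) m.
  have iN : i < Nc * L by apply: listX_lt; exact: mem_nth.
  have cS : count (mis p sg) (take m.+1 (listX p om k pw)) = count (mis p sg) (take m (listX p om k pw)) + mis p sg i.
    by rewrite take_nthS // -cats1 count_cat /= addn0.
  have cs : count (mis p sg) (take m (listX p om k pw)) <= m.
    by apply: leq_trans (count_size _ _) _; rewrite size_take; case: ifP; lia.
  apply: runs_le.
    apply: (@runs_set _ _ _ _ _ _ _ _ i).
      by rewrite /= r40 !iv' !g'; mds; rewrite h6.
    apply: (@runs_ifb _ _ _ _ _ _ _ _ _ (~~ mis p sg i)).
    - by rewrite /= !g'; mds; rewrite /mis negbK.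
    - by move=> nm; apply: runs_skip; rewrite cS !regs_set /= I (negbTE nm) addn0.
    - rewrite negbK => ms; apply: (@runs_set1 _ _ _ _ _ _ _ _ (count (mis p sg) (take m (listX p om k pw)) + 1)).
        by rewrite /= I; mds.
      by rewrite cS !regs_set /= ms.
  by [].
have := leq_mul sl (leqnn 50); rewrite /=; lia.
Qed.

Lemma ly_ok s c0 : gq s -> ivl p j k pw s -> flag p om k pw sg -> regs s 66 = c0 ->
  c0 <= size (listX p om k pw) -> regs s 48 = W + Z - sg0 p om k pw ->
  runs c_ly s (tl * (K * 40 + 130) + 30) (fun s' => regs s' 66 = c0 + count (ymis p om k pw sg) (listY p om k pw)).
Proof.
move=> g iv fl r66 c0l r48; have [[h1 h2 h3 h4 h5] [h6 h7]] := rk.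
have [Wb1 Wb2] := Wb; have rb := rec_bnd; have [NX1 NX2] := NX; have HQ2' := HQ2.
have sgl := sg_lt; have s0S' := s0S; have LW' := LW.
have SW : S = 2 * W + 1 by [].
have WZ : 2 * W <= Z by rewrite /iZ; nia.
have sl : size (listY p om k pw) <= tl.
  exact: (size_listY wfp val gk (ex_intro2 _ _ sg sgl fl)).
have /andP[k2 kN] := val.
have kL : (k + pw) * L <= Nc * L by rewrite leq_mul2r; lia.
have kL1 : k * L <= (k + pw) * L by rewrite leq_mul2r; lia.
pose P := ymis p om k pw sg.
apply: runs_le.
  apply: (@runs_weaken _ _ _ _ _ _ _ _ _ (fun s' => regs s' 66 = c0 + count P (take (size (listY p om k pw)) (listY p om k pw)))); first last.
  - by move=> s' _ ->; rewrite take_size.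
  - exact: leqnn.
  apply: (runs_For (N := size (listY p om k pw)) (tb := K * 40 + 110) (Inv := fun m s' => regs s' 66 = c0 + count P (take m (listY p om k pw)))) => //.
  - by lia.
  - by lia.
  - by rewrite take0 addn0.
  - move=> s' fr /(_ isT) me; have iv' : ivl p j k pw s' by apply: (ivl_fr fr).
    by rewrite /= !iv'; mds; rewrite me g h3.
  move=> m s' mN r40 fr _ /(_ isT) me I.
  have g' : gq s' by apply: (gq_fr fr).
  have iv' : ivl p j k pw s' by apply: (ivl_fr fr).
  have r48' : regs s' 48 = W + Z - sg0 p om k pw by rewrite fr.
  pose jj := nth 0 (listY p om k pw) m; pose i := jj + sg - W.
  have jN : jj < Nc * L by apply: listY_lt; exact: mem_nth.
  have cS : count P (take m.+1 (listY p om k pw)) = count P (take m (listY p om k pw)) + P jj.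
    by rewrite take_nthS // -cats1 count_cat /= addn0.
  have cs : count P (take m (listY p om k pw)) <= m.
    by apply: leq_trans (count_size _ _) _; rewrite size_take; case: ifP; lia.
  apply: runs_le.
    apply: (@runs_set _ _ _ _ _ _ _ _ i).
      by rewrite /= r40 !iv' !g'; mds; rewrite h2; mds; rewrite h7 //; mds.
    apply: (@runs_ifb _ _ _ _ _ _ _ _ _ (i < k * L)).
    - by rewrite /= !iv' !g'; mds.
    - move=> ik; apply: runs_skip; rewrite cS !regs_set /= I /P /ymis /inI -/i leqNgt ik /=.
      by rewrite addn0.
    rewrite -leqNgt => ik.
    apply: (@runs_ifb _ _ _ _ _ _ _ _ _ (i < (k + pw) * L)).
    - have kp : k + pw < 2 ^ b by have : k + pw <= (k + pw) * L; [rewrite leq_pmulr | lia].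
      by rewrite /= !iv' !g'; mds.
    - move=> ik2.
      apply: (@runs_ifb _ _ _ _ _ _ _ _ _ (~~ mis p sg i)).
      + by rewrite /= !g'; mds; rewrite /mis negbK.
      + move=> nm; apply: runs_skip; rewrite cS !regs_set /= I /P /ymis -/i (negbTE nm) andbF.
        by rewrite addn0.
      rewrite negbK => ms.
      have iN : i < Nc * L by lia.
      have Um : Urep p j k (tU p om k pw) (memory (set_reg s' 41 i)) by rewrite memory_set_reg g'.
      have hv : runs (c_hv ReadX) (set_reg s' 41 i) (K * 40 + 20) (fun s2 => regs s2 42 =
          has (fun z => nth 0 X i != nth 0 Y (i + (W + Z - sg0 p om k pw) - z)) (tU p om k pw)).
        apply: (hv_ok wfp HB val jlg pw0 (rd := ReadX) (rf := nth 0 X)) => //;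
          first [exact: ivl_set | by apply: glob_set => //; case: g' => [[[]]] | exact: sUK | by lia].
      apply: runs_seqw hv _ => s2 [f2 _ _] hv2.
      have hvE : regs s2 42 = hvX p om k pw (tU p om k pw) i.
        rewrite hv2; congr (nat_of_bool _); apply: eq_has => z; congr (_ != nth 0 Y _); lia.
      apply: (@runs_ifb _ _ _ _ _ _ _ _ _ (hvX p om k pw (tU p om k pw) i)).
      + by rewrite /= hvE.
      + move=> hh; apply: runs_skip; rewrite cS !regs_set /= f2 //= I /P /ymis -/i hh !andbF.
        by rewrite addn0.
      + move=> hh; apply: (@runs_set1 _ _ _ _ _ _ _ _ (c0 + count P (take m (listY p om k pw)) + 1)).
          by rewrite /= f2 //= I; mds.
        rewrite cS !regs_set /= /P /ymis -/i hh ms /inI ik ik2 /=; lia.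
    - move=> ik2; apply: runs_skip; rewrite cS !regs_set /= I /P /ymis /inI -/i (negbTE ik2) andbF /=.
      by rewrite addn0.
  by rewrite /=; lia.
have := leq_mul sl (leqnn (K * 40 + 130)); rewrite /=; lia.
Qed.

End Pass.

Definition t_pass := tl * (K * 40 + 180) + 300.

Lemma pass_ok s j k acc : gq s -> regs s 30 = j -> regs s 31 = 2 ^ j -> regs s 32 = k -> regs s 61 = acc ->
  2 <= k -> 2 ^ j %| k -> k * L <= E -> 2 ^ j <= Nc -> 2 * q * acc <= (2 * q + 1) * d ->
  runs c_pass s t_pass (fun s' => (regs s' 32, regs s' 61) = qstep p om x y k (2 ^ j) acc).
Proof.
move=> g r30 r31 r32 r61 k2 jk kE jN th.
have [Wb1 Wb2] := Wb; have [NX1 NX2] := NX; have HQ2' := HQ2; have [E1 E2] := E_le.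
have kk : k <= k * L by rewrite leq_pmulr.
have NN : Nc <= Nc * L by rewrite leq_pmulr.
have sgl := sg_lt; have ab := acc_bnd th; have dqb := dq_bnd.
have W2 : 2 * W <= L := LW.
rewrite /qstep /qpass; apply: runs_le.
  apply: (@runs_ifb _ _ _ _ _ _ _ _ _ (valid p k (2 ^ j))).
  - by rewrite /= r31 r32 !g /valid k2; mds; congr (nat_of_bool _); apply/idP/idP; lia.
  - move=> v; rewrite v /=.
    have pj0 : 0 < 2 ^ j by rewrite expn_gt0.
    have [bs1 bs2] := abase_bnd HB v (valid_lg HB nlg v) pj0.
    have HB' := HB; have [[h1 h2 h3 h4 h5] [h6 h7]] := rc I v jk.
    have rb := rec_bnd v.
    have RS1 : 0 < iRS p by rewrite /iRS; lia.
    have eb : abase p j k = aRB p + (j * (Nc + 1) + k) * iRS p by [].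
    have bb1 : j * (Nc + 1) + k <= (j * (Nc + 1) + k) * iRS p by rewrite leq_pmulr.
    apply: (@runs_set _ _ _ _ _ _ _ _ (abase p j k)).
      by rewrite /= r30 r32 !g; mds.
    have g1 := gq_set (abase p j k) (isT : (29 < 33) && (33 != 65)) g.
    have iv1 : ivl p j k (2 ^ j) (set_reg s 33 (abase p j k)) by rewrite /ivl !regs_set /= r30 r31 r32.
    apply: (@runs_ifb _ _ _ _ _ _ _ _ _ (flag p om k (2 ^ j) sg)).
    + by rewrite /= !g; mds; rewrite h4.
    + move=> fl; rewrite fl /=.
      have s0S := sg0_lt om wfp v.
      apply: (@runs_set _ _ _ _ _ _ _ _ (W + Z - sg0 p om k (2 ^ j))).
        by rewrite /= !g h1; mds.
      apply: (@runs_set _ _ _ _ _ _ _ _ 0); first by rewrite /= mod0n.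
      set s2 := set_reg _ 66 0.
      have g2 : gq s2 by do 2 apply: gq_set => //.
      have iv2 : ivl p j k (2 ^ j) s2 by do 2 apply: ivl_set => //.
      apply: runs_seqw (lx_ok v jk g2 iv2 fl (erefl 0)) _ => s3 [f3 _ /(_ isT) m3] c3.
      have g3 : gq s3 by apply: (gq_fr f3).
      have iv3 : ivl p j k (2 ^ j) s3 by apply: (ivl_fr f3).
      have r48 : regs s3 48 = W + Z - sg0 p om k (2 ^ j) by rewrite f3.
      apply: runs_seqw (ly_ok v jk g3 iv3 fl c3 (count_size _ _) r48) _ => s4 [f4 _ /(_ isT) m4] c4.
      have g4 : gq s4 by apply: (gq_fr f4).
      have rr r : r \notin [:: 33; 40; 41; 42; 43; 48; 66] -> regs s4 r = regs s r.
        rewrite !inE !negb_or => /andP[n1 /andP[n2 /andP[n3 /andP[n4 /andP[n5 /andP[n6 n7]]]]]].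
        rewrite f4; last by rewrite /= !inE !negb_or n2 n3 n4 n5 n7.
        rewrite f3; last by rewrite /= !inE !negb_or n2 n3 n7.
        by rewrite /s2 !regs_set (negbTE n1) (negbTE n6) (negbTE n7).
      have r32' : regs s4 32 = k by rewrite rr.
      have r31' : regs s4 31 = 2 ^ j by rewrite rr.
      have r61' : regs s4 61 = acc by rewrite rr.
      set e := count _ (listX _ _ _ _) + count _ _ in c4.
      (* Counting all sampled blocks bounds the estimate linearly in the length of the strings, so
         the comparison with the threshold cannot overflow. *)
      have eb2 : e * bet <= 3 * (Nc * L).
        have se : e <= (2 * 2 ^ j + 2) * LB.
          apply: leq_trans (leq_add (count_size _ _) (count_size _ _)) _.
          rewrite !size_filter; apply: leq_trans (leq_add (count_size _ _) (count_size _ _)) _.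
          by rewrite !size_map !size_iota; lia.
        apply: leq_trans (leq_mul se (leqnn bet)) _; rewrite -mulnA LBb mulnA leq_mul2r.
        by apply/orP; right; have /andP[] := v; lia.
      have eE : est p om k (2 ^ j) sg = e * bet by rewrite /est mulnC.
      have [u1 u2] : 2 * q * (acc + e * bet) < 2 ^ b /\ acc + e * bet < 2 ^ b by apply: qmul_bnd; lia.
      have [u3 u4] : 2 * q * 2 < 2 ^ b /\ 2 < 2 ^ b by apply: qmul_bnd; lia.
      apply: (@runs_set _ _ _ _ _ _ _ _ (e * bet)).
        by rewrite /= c4 !g4; mds.
      apply: (@runs_ifb _ _ _ _ _ _ _ _ _ ((2 * q + 1) * d < 2 * q * (acc + e * bet))).
      * by rewrite /= r61' !g4; mds; rewrite mulnC.
      * by move=> lt; apply: runs_skip; rewrite eE leqNgt lt /= r32' r61'.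
      * rewrite -leqNgt => le; rewrite eE le.
        apply: (@runs_set _ _ _ _ _ _ _ _ (k + 2 ^ j)); first by rewrite /= r32' r31'; mds.
        apply: (@runs_set1 _ _ _ _ _ _ _ _ (acc + e * bet)); first by rewrite /= r61'; mds.
        by rewrite !regs_set.
    + by move=> fl; apply: runs_skip; rewrite (negbTE fl) /= r32 r61.
  - by move=> nv; apply: runs_skip; rewrite (negbTE nv) /= r32 r61.
by rewrite /t_pass /= !mulnDr; lia.
Qed.

Let Jlg : Jn p <= lg.
Proof.
rewrite leqNgt; apply/negP; rewrite lt_Jn => h.
have : Nc <= minn (size X) (size Y) by exact: leq_div.
by move: nlg; lia.
Qed.

Definition qst (t : nat) (P : nat -> Prop) (s : state) : Prop := exists t' k acc,
  [/\ regs s 32 = k, regs s 61 = acc, t' <= t & 2 <= k] /\ qacc p x y t' k acc /\ P k.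

(** Common to both directions: [c] tells whether a step is tried at this level, and [cm] is what the
    program runs accordingly. *)
Lemma upd_ok s (c : bool) j k acc t (P : nat -> Prop) :
  gq s -> regs s 30 = j -> regs s 31 = 2 ^ j -> regs s 32 = k -> regs s 61 = acc ->
  2 <= k -> 2 ^ j <= Nc -> qacc p x y t k acc -> (c -> 2 ^ j %| k) ->
  (let: (k', acc') := if c then qstep p om x y k (2 ^ j) acc else (k, acc) in
    [/\ 2 <= k', exists2 t', t' <= t.+1 & qacc p x y t' k' acc' & P k']) ->
  forall cm, (c -> cm = c_pass) -> (~~ c -> cm = Skip) -> runs cm s t_pass (qst t.+1 P).
Proof.
move=> g r30 r31 r32 r61 k2 jN [a1 a2 a3 a4 a5] cj h cm h1 h2; case: c cj h h1 h2 => cj h h1 h2.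
  rewrite h1 //; apply: (runs_weaken (pass_ok g r30 r31 r32 r61 k2 (cj isT) a2 jN a5) (leqnn _)) => s' _ e.
  move: h; rewrite -e => -[k2' [t' tt q'] Pk].
  by exists t', (regs s' 32), (regs s' 61).
rewrite h2 //; apply: runs_le; first apply: runs_skip.
  by case: h => k2' [t' tt q'] Pk; exists t', k, acc.
by rewrite /t_pass; lia.
Qed.

Lemma up_ok s k acc : gq s -> regs s 32 = k -> regs s 61 = acc -> 2 <= k -> qacc p x y 0 k acc ->
  runs c_up s (Jn p * (t_pass + 60) + 20) (fun s' =>
    [/\ regs s' 30 = Jn p, regs s' 31 = 2 ^ Jn p & qst (Jn p) (qdninv p x y (Jn p)) s']).
Proof.
move=> g r32 r61 k2 qa; have [Wb1 Wb2] := Wb; have [NX1 NX2] := NX; have HQ2' := HQ2; have [E1 E2] := E_le.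
have NN : Nc <= Nc * L by rewrite leq_pmulr.
have Jlg' := Jlg.
apply: runs_le.
  apply: (@runs_set _ _ _ _ _ _ _ _ 0); first by rewrite /= mod0n.
  apply: (@runs_set _ _ _ _ _ _ _ _ 1); first by rewrite /=; mds.
  apply: (runs_weaken (runs_while (N := Jn p) (tb := t_pass + 45) (Inv := fun j s' =>
    [/\ regs s' 30 = j, regs s' 31 = 2 ^ j & qst j (qupinv p x y j) s']) _ _ _) (leqnn _)); first last.
  - move=> s' _ [h1 h2 [t' [k' [acc' [[e1 e2 e3 e4] [e5 e6]]]]]]; split=> //.
    exists t', k', acc'; split=> //; split=> //; exact: (qtop_inv wfp).
  - move=> s' [_ r31 _] [f1 _ /(_ isT) me].
    have g' : gq s' by apply: (gq_fr f1) => //; do 2 apply: gq_set => //.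
    by rewrite /= r31 !g'; mds; apply/eqP; rewrite eqb0 -leqNgt; have := Jn_gt p; lia.
  - move=> j s' jJ [r30' r31' [t' [k' [acc' [[e1 e2 e3 e4] [e5 e6]]]]]] [f1 _ /(_ isT) me]; right.
    have g' : gq s' by apply: (gq_fr f1) => //; do 2 apply: gq_set => //.
    have jN : 2 ^ j <= Nc by rewrite -lt_Jn.
    split; first by rewrite /= r31' !g'; mds; rewrite eqb0 negbK; lia.
    have tl2 : t' < 2 * lg by lia.
    have m2 : (2 ^ j + 2 ^ j) %% 2 ^ b = 2 ^ j.+1 by rewrite modn_small ?expnS ?mul2n ?addnn //; lia.
    have inv := qup_inv wfp gd hx hy hxy hyx e4 e5 tl2 e6.
    pose qc := (2 ^ j %| k') && ~~ (2 ^ j.+1 %| k').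
    have cj : qc -> 2 ^ j %| k' by case/andP.
    have V cm : (qc -> cm = c_pass) -> (~~ qc -> cm = Skip) -> runs cm s' t_pass (qst j.+1 (qupinv p x y j.+1)).
      move=> c1 c2; apply: (runs_weaken (upd_ok (c := qc) g' r30' r31' e1 e2 e4 jN e5 cj inv c1 c2) (leqnn _)).
      by move=> s3 _ [t2 [k3 [acc3 [[d1 d2 d3 d4] d5]]]]; exists t2, k3, acc3; split=> //; split=> //; lia.
    apply: runs_le.
      apply: (runs_seqw (Q1 := qst j.+1 (qupinv p x y j.+1)) (t1 := t_pass + 20)).
        apply: runs_le.
          apply: (@runs_if _ _ _ _ _ _ _ _ _ (t_pass + 10)); rewrite /= e1 r31'.
            move=> nd; apply: runs_le (V Skip _ _) _; [by rewrite /qc /dvdn (negbTE nd) | by [] | lia].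
          move=> /eqP dv; apply: runs_le.
            apply: (@runs_if _ _ _ _ _ _ _ _ _ t_pass); rewrite /= e1 r31' m2 => nd; apply: V => //.
              by rewrite /qc /dvdn dv (negbTE nd).
            by rewrite /qc /dvdn nd eqxx andbF.
          by rewrite /=; lia.
        by rewrite /=; lia.
      move=> s2 [f2 _ _] [t2 [k3 [acc3 [[d1 d2 d3 d4] [d5 d6]]]]].
      apply: (@runs_set _ _ _ _ _ _ _ _ (2 ^ j.+1)).
        by rewrite /= !f2 // r31' expnS; mds; lia.
      apply: (@runs_set1 _ _ _ _ _ _ _ _ j.+1).
        by rewrite /= f2 // r30'; have := ltn_expl j (isT : 1 < 2) => ?; mds; rewrite addn1.
      split=> //; exists t2, k3, acc3; split=> //.
    by rewrite /=; lia.
  - split=> //; exists 0, k, acc; split=> //; split=> //.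
    by left; rewrite expn0 dvd1n.
by rewrite /=; lia.
Qed.

Lemma dn_ok s : gq s -> regs s 30 = Jn p -> regs s 31 = 2 ^ Jn p -> qst (Jn p) (qdninv p x y (Jn p)) s ->
  runs c_dn s (Jn p * (t_pass + 60) + 20) (qst (2 * lg) (qdninv p x y 0)).
Proof.
move=> g r30 r31 qs; have [Wb1 Wb2] := Wb; have [NX1 NX2] := NX; have HQ2' := HQ2; have [E1 E2] := E_le.
have NN : Nc <= Nc * L by rewrite leq_pmulr.
have Jlg' := Jlg.
apply: runs_le.
  apply: (runs_weaken (runs_while (N := Jn p) (tb := t_pass + 45) (Inv := fun m s' =>
    [/\ regs s' 30 = Jn p - m, regs s' 31 = 2 ^ (Jn p - m) & qst (Jn p + m) (qdninv p x y (Jn p - m)) s']) _ _ _) (leqnn _)); first last.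
  - move=> s' _ [_ _]; rewrite subnn => -[t' [k' [acc' [[e1 e2 e3 e4] e5]]]].
    by exists t', k', acc'; split=> //; split=> //; lia.
  - by move=> s' [r30' _ _] _; rewrite /= r30' subnn mod0n.
  - move=> m s' mJ [r30' r31' [t' [k' [acc' [[e1 e2 e3 e4] [e5 e6]]]]]] [f1 _ /(_ isT) me]; right.
    have g' : gq s' by apply: (gq_fr f1).
    have Jm : Jn p - m = (Jn p - m.+1).+1 by lia.
    set j := Jn p - m.+1 in Jm *.
    rewrite Jm in r30' r31' e6.
    have jN : 2 ^ j <= Nc by rewrite -lt_Jn /j; lia.
    split; first by rewrite /= r30' mod0n.
    have tl2 : t' < 2 * lg by lia.
    apply: runs_le.
      apply: (@runs_set _ _ _ _ _ _ _ _ j); first by rewrite /= r30'; mds; lia.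
      apply: (@runs_set _ _ _ _ _ _ _ _ (2 ^ j)).
        by rewrite /= r31' expnS; mds; rewrite mulKn.
      set s2 := set_reg _ 31 _.
      have g2 : gq s2 by do 2 apply: gq_set => //.
      have e1' : regs s2 32 = k' by [].
      have e2' : regs s2 61 = acc' by [].
      have e3' : regs s2 31 = 2 ^ j by [].
      have inv := qdn_inv wfp gd hx hy hxy hyx e4 e5 tl2 e6.
      pose qc := 2 ^ j %| k'.
      have V cm : (qc -> cm = c_pass) -> (~~ qc -> cm = Skip) -> runs cm s2 t_pass (qst (Jn p + m.+1) (qdninv p x y j)).
        move=> c1 c2; apply: (runs_weaken (upd_ok (c := qc) g2 (erefl j) (erefl (2 ^ j)) e1' e2' e4 jN e5 id inv c1 c2) (leqnn _)).
        by move=> s3 _ [t2 [k3 [acc3 [[d1 d2 d3 d4] d5]]]]; exists t2, k3, acc3; split=> //; split=> //; lia.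
      apply: (@runs_weaken _ _ _ _ _ _ _ (t_pass + 20) _ (qst (Jn p + m.+1) (qdninv p x y j)) _ _ (leqnn _)); last first.
        by move=> s3 [f3 _ _] qq; split=> //; rewrite f3.
      apply: runs_le.
        apply: (@runs_if _ _ _ _ _ _ _ _ _ t_pass); rewrite /= ?e1' ?e1 ?e3' => dv; apply: V => //.
          by rewrite /qc /dvdn (negbTE dv).
        by rewrite /qc /dvdn dv.
      by rewrite /=; lia.
    by rewrite /=; lia.
  - by rewrite subn0 addn0; split.
by rewrite /=; lia.
Qed.

Lemma load_ok s : 26 < 2 ^ b -> runs c_load s 58 (fun s' =>
  (forall r, 7 <= r < 26 -> regs s' r = memory s r) /\ memory s' = memory s).
Proof.
move=> b26; apply: (runs_weaken (loads_ok (l := iota 7 19) eps X Y s _)) => //.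
  by apply/allP => r; rewrite mem_iota; lia.
by move=> s' _ [h1 h2]; split=> // r hr; rewrite h1 mem_iota ifT //; lia.
Qed.

Definition t_qry := 2 * (Jn p * (t_pass + 60) + 20) + 6 * L * 60 + 500.

Lemma qry_ok w : (0 < eps)%R -> (1 <= eps * q%:R)%R \/ d < q -> glob p (State m0 m0 [::]) ->
  runs qry (query_state X Y d w m0 x y) t_qry (fun s' => is_approx_LCE X Y d eps x y (regs s' 0)).
Proof.
move=> e0 hq G; have [Wb1 Wb2] := Wb; have HQ2' := HQ2; have [E1 E2] := E_le; have LW' := LW.
have L0' := L0; have hx' := hx; have hy' := hy; have hxy' := hxy; have hyx' := hyx; have dn' := dn.
have [k0 [k0E k02 k0a k0b]] : exists k0, [/\ k0 = x %/ L + 2, 2 <= k0, x + L <= k0 * L & k0 * L <= x + 2 * L].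
  have H u v : x = u * L + v -> v < L -> [/\ 2 <= u + 2, x + L <= (u + 2) * L & (u + 2) * L <= x + 2 * L].
    by rewrite mulnDl => h1 h2; split; lia.
  have [? ? ?] := H _ _ (divn_eq x L) (ltn_pmod x L0).
  by exists (x %/ L + 2); split.
have EE : minn (size X) (size Y + x - y) = E by rewrite /qE; lia.
have xE : x <= E by rewrite /qE leq_addr.
have Fx : F x = 0 by rewrite /qF subnn.
have xd : x %/ L <= x by exact: leq_div.
have b26 : 26 < 2 ^ b by lia.
have w4 : 4 < 2 ^ b by lia.
have EL : E + 4 * L < 2 ^ b by lia.
apply: runs_le.
  apply: (runs_ifb (v := true) (t2 := 0)); [by rewrite /=; mds; rewrite dn' | move=> _ | by []].
  apply: (runs_seqw (load_ok _ b26)) => s1 [f1 _ _] [l1 l2].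
  have g1 : glob p s1 by rewrite /glob !l1 //; exact: G.
  have r0 : regs s1 0 = size X by rewrite f1.
  have r1 : regs s1 1 = size Y by rewrite f1.
  have r2 : regs s1 2 = d by rewrite f1.
  have r4 : regs s1 4 = x by rewrite f1.
  have r5 : regs s1 5 = y by rewrite f1.
  apply: (runs_min (v1 := size X) (v2 := size Y + x - y)).
  - by rewrite /= r0.
  - by rewrite /= r1 r4 r5; mds.
  rewrite EE.
  apply: (@runs_set _ _ _ _ _ _ _ _ sg); first by rewrite /= r4 r5 !g1; mds.
  apply: (@runs_set _ _ _ _ _ _ _ _ x); first by rewrite /= r4.
  apply: (@runs_set _ _ _ _ _ _ _ _ 0); first by rewrite /= mod0n.
  apply: (@runs_set _ _ _ _ _ _ _ _ 0); first by rewrite /= mod0n.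
  apply: (@runs_set _ _ _ _ _ _ _ _ k0); first by rewrite /= r4 !g1 k0E; mds.
  apply: (runs_min (v1 := E) (v2 := k0 * L)).
  - by rewrite /=.
  - by rewrite /= !g1; mds.
  set s2 := set_reg _ 63 _.
  have g2 : gq s2.
    split; last by rewrite /s2 /= l2.
    split; last by [].
    split; last by rewrite /s2 /= r2.
    by rewrite /s2; repeat apply: glob_set => //.
  have h1 : x <= minn E (k0 * L) by lia.
  have h2 : minn E (k0 * L) <= E by exact: geq_minl.
  have h3 : 2 * q * 0 <= (2 * q + 1) * d by rewrite muln0.
  have sc := @scan_ok s2 x 0 (minn E (k0 * L)) g2 erefl erefl erefl erefl (leqnn x) h1 h2 h3.
  apply: (runs_seqw sc) => s3 [f3 _ /(_ isT) me3] [pos [acc [st [[r60 r61 r62] [pp accE th stc]]]]].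
  have g3 : gq s3 by apply: (gq_fr f3).
  have r4' : regs s3 4 = x by rewrite f3 // /s2 /= r4.
  have r32 : regs s3 32 = k0 by rewrite f3.
  have r64 : regs s3 64 = E by rewrite f3.
  have accF : acc = F pos by rewrite accE Fx subn0.
  have A1 : x <= pos <= E by lia.
  have A2 : 4 * q * (acc - F pos) <= d by rewrite accF subnn muln0.
  have A3 : 4 * q * (F pos - acc) <= d by rewrite accF subnn muln0.
  apply: (runs_seqw (Q1 := fun s' => is_approx_LCE X Y d eps x y (regs s' 60 - x))
    (t1 := 2 * (Jn p * (t_pass + 60) + 20) + 4 * L * 60 + 200)); last first.
    move=> s4 [f4 _ _] q4; apply: (@runs_set1 _ _ _ _ _ _ _ _ (regs s4 60 - x)).
      by rewrite /= (f4 4) // r4'.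
    by rewrite regs_set eqxx.
  apply: runs_le.
    apply: (runs_ifb (v := st)); first by rewrite /= r62.
    + move=> sT; apply: runs_skip; rewrite r60.
      have A4 : (pos < E) && mis p sg pos && ((2 * q + 1) * d < 2 * q * acc.+1).
        by move: stc; rewrite sT => /andP[/andP[c1 ->] ->]; rewrite !andbT; lia.
      exact: (query_correct wfp hx hy hxy hyx (k := 0) (stop := true) e0 hq A1 A2 A3 th A4 (or_introl isT)).
    + move=> sF; have posE : pos = minn E (k0 * L) by move: stc; rewrite (negbTE sF) => /eqP.
      apply: (runs_ifb (v := pos < E) (t2 := 1)); first by rewrite /= r60 r64.
      * move=> pE; have pk : pos = k0 * L by clear - posE pE; lia.
        have qa : qacc p x y 0 k0 acc by split=> //; rewrite -?pk ?accF ?subnn ?muln0 //; lia.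
        apply: (runs_seqw (up_ok g3 r32 r61 k02 qa)) => s4 [f4 _ /(_ isT) me4] [u30 u31 uq].
        have g4 : gq s4 by apply: (gq_fr f4).
        apply: (runs_seqw (dn_ok g4 u30 u31 uq)) => s5 [f5 _ /(_ isT) me5].
        move=> [t5 [k5 [acc5 [[v32 v61 t5l k52] [qa5 [a a0 [adv qf]]]]]]].
        have g5 : gq s5 by apply: (gq_fr f5).
        have [b1 b2 b3 b4 b5] := qa5.
        (* At level 0 the distance [2 ^ a + 3] becomes the four chunks of the last scan. *)
        have qf4 : qfail p x y (k5 + 4).
          by move: a0 qf; rewrite leqn0 => /eqP ->; rewrite expn0 -addnA.
        have r64' : regs s5 64 = E by rewrite f5 // f4.
        have r62' : regs s5 62 = 0 by rewrite f5 // f4 // r62 (negbTE sF).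
        have kk : (k5 + 4) * L = k5 * L + 4 * L by rewrite mulnDl.
        have k5b : k5 <= k5 * L by rewrite leq_pmulr.
        have k4b : (k5 + 4) * L < 2 ^ b by rewrite kk; apply: leq_ltn_trans EL; rewrite leq_add2r.
        have k4c : k5 + 4 < 2 ^ b by exact: leq_ltn_trans (leq_pmulr _ L0) k4b.
        have k5c : k5 * L < 2 ^ b by apply: leq_ltn_trans k4b; rewrite leq_mul2r leq_addr orbT.
        apply: (@runs_set _ _ _ _ _ _ _ _ (k5 * L)); first by rewrite /= v32 !g5 modn_small.
        apply: (runs_min (v1 := E) (v2 := (k5 + 4) * L)).
        - by rewrite /= r64'.
        - by rewrite /= v32 !g5 (modn_small w4) (modn_small k4c) modn_small.
        set s6 := set_reg _ 63 _.
        have g6 : gq s6 by rewrite /s6; do 2 apply: gq_set => //.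
        have B1 : x <= k5 * L by exact: leq_trans (leq_addr _ _) b1.
        have B2 : k5 * L <= minn E ((k5 + 4) * L) by rewrite leq_min b2 leq_mul2r leq_addr orbT.
        have B3 : minn E ((k5 + 4) * L) <= E by exact: geq_minl.
        have sc6 := @scan_ok s6 (k5 * L) acc5 (minn E ((k5 + 4) * L)) g6 erefl v61 r62' erefl B1 B2 B3 b5.
        have tb : (minn E ((k5 + 4) * L) - k5 * L) * 60 + 10 <= 4 * L * 60 + 10.
          by rewrite leq_add2r leq_mul2r leq_subLR; apply/orP; right; rewrite -kk geq_minr.
        apply: (runs_weaken sc6 tb) => s7 _ [pos' [acc' [st' [[w60 w61 w62] [pp' accE' th' stc']]]]].
        have kp : k5 * L <= pos' by case/andP: pp'.
        have [er1 er2] : 4 * q * (acc' - F pos') <= d /\ 4 * q * (F pos' - acc') <= d.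
          rewrite accE'; first [exact: (qacc_err wfp t5l qa5 kp) | exact: (qacc_err wfp hx hy hxy hyx t5l qa5 kp)].
        have C1 : x <= pos' <= E by rewrite (leq_trans B1 kp) /=; case/andP: pp' => _ h; exact: leq_trans h B3.
        have C4 : if st' then (pos' < E) && mis p sg pos' && ((2 * q + 1) * d < 2 * q * acc'.+1) else pos' == minn E ((k5 + 4) * L).
          by move: stc'; case: (st') => // /andP[/andP[c1 ->] ->]; rewrite !andbT; exact: leq_trans c1 B3.
        by rewrite w60; exact: (query_correct wfp hx hy hxy hyx (k := k5) (stop := st') e0 hq C1 er1 er2 th' C4 (or_intror qf4)).
      * move=> pE; apply: runs_skip; rewrite r60.
        have kk : (k0 + 4) * L = k0 * L + 4 * L by rewrite mulnDl.
        have A4 : pos == minn E ((k0 + 4) * L) by apply/eqP; clear - posE pE kk; lia.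
        have qf4 : qfail p x y (k0 + 4) by left; clear - posE pE kk; lia.
        exact: (query_correct wfp hx hy hxy hyx (k := k0) (stop := false) e0 hq A1 A2 A3 th A4 (or_intror qf4)).
  by rewrite /=; lia.
by rewrite /t_qry /=; lia.
Qed.

End QueryRun.

Lemma qry_small (R : realType) b X Y (eps : R) d w m0 x y : x <= size X -> y <= size Y ->
  size X + size Y <= d -> size X + size Y < 2 ^ b -> (0 < eps)%R ->
  runs b X Y eps qry (query_state X Y d w m0 x y) 100 (fun s' => is_approx_LCE X Y d eps x y (regs s' 0)).
Proof.
move=> hx hy nd nb e0; apply: runs_le.
  apply: (runs_ifb (v := false) (t1 := 0)); [by rewrite /= modn_small // ltnNge nd | by [] | move=> _].
  apply: (min_ok (v1 := size X - x) (v2 := size Y - y)) => //.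
  rewrite regs_set eqxx; apply: is_approx_LCE_count => //; last by rewrite ltnn.
  apply: (@le_trans _ _ (d%:R)%R); last by rewrite mulrDl mul1r lerDl mulr_ge0 // ltW.
  rewrite ler_nat; apply: leq_trans (count_size _ _) _; rewrite size_iota.
  by apply: leq_trans (geq_minl _ _) _; lia.
by [].
Qed.

(** * Computing the parameters *)

Definition c_lg : cmd :=
  26 <~ #1 ;; 7 <~ #0 ;; While (%26 <' %6 +' #1) (26 <~ %26 +' %26 ;; 7 <~ %7 +' #1).

(** The first loop is where eps enters; it continues while [1 <= eps * q] fails and [q <= d]. The
    cap keeps [q] within a word for tiny eps, and once [q > d] the answers are exact. *)
Definition c_qbl (c1 : nat) : cmd :=
  c_min 8 %3 %6 ;;
  9 <~ #1 ;; While (EpsGe #1 %9 <' (%9 <' %2 +' #1)) (9 <~ %9 +' %9) ;;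
  27 <~ #(64 * 128 * c1) *' %9 *' %9 *' %7 *' %7 *' %7 ;;
  10 <~ #1 ;; While (%10 +' %10 <' %2 /' %27 +' #1) (10 <~ %10 +' %10) ;;
  28 <~ #(32 * 64) *' %7 *' %2 *' %8 ;;
  11 <~ #1 ;; While (%11 <' %28) (11 <~ %11 +' %11).

Definition c_derive (c1 : nat) : cmd :=
  25 <~ %11 /' %10 ;; c_min 26 %0 %1 ;; 12 <~ %26 /' %11 ;;
  13 <~ #(64 * c1) *' %7 ;; 14 <~ #c1 *' %7 ;; 15 <~ #224 *' %7 ;;
  16 <~ #2 *' %8 *' (%15 +' #1) ;; 17 <~ #2 *' %8 +' #1 ;;
  18 <~ #3 +' %17 +' %13 +' #4 *' %25 ;;
  20 <~ #64 ;; 21 <~ %20 +' (#2 *' %16 +' #1) ;; 22 <~ %21 +' (#2 *' %16 +' #1) ;;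
  23 <~ %22 +' %12 ;; 24 <~ %23 +' %15 *' %13 ;; 19 <~ %24 +' %12 *' %25 ;; 40 <~ %19 -' %22.

Definition pre (c1 : nat) : cmd :=
  6 <~ %0 +' %1 ;;
  If (%2 <' %6)
    (c_lg ;; c_qbl c1 ;; c_derive c1 ;; c_rand ;; c_save ;; c_levels) Skip.

Definition Pq (R : realType) (eps : R) d t := ~~ (1 <= eps * t%:R)%R && (t < d + 1).
(** Doubling continues while [2 t <= d / v], so it ends at the largest power of two not above
    [d / v], or at 1. *)
Definition Pbet d v t := t + t < d %/ v + 1.
Definition PL m t := t < m.

Section Inst.
Variables (R : realType) (b : nat) (eps : R) (c1 : nat) (X Y : seq nat) (d w : nat).
Let n := size X + size Y.
Let lg := logn2 n.
Definition pW := minn w n.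
Definition pq := 2 ^ dexp (Pq eps d) lg.
Definition pv := 64 * 128 * c1 * pq ^ 2 * lg ^ 3.
Definition pbet := 2 ^ dexp (Pbet d pv) lg.
Definition pm := 32 * 64 * lg * d * pW.
Definition pL := 2 ^ dexp (PL pm) (lg * 14).
Definition pinst := Inst X Y d pW lg pq pbet pL c1.

Hypothesis c12 : 1 < c1.
Hypothesis dn : d < n.
Hypothesis d0 : 0 < d.
Hypothesis w0 : 0 < w.
Hypothesis kb : (c1 + 40) * lg <= b.
Local Notation p := pinst.
Local Notation V := (2 ^ lg).

Lemma lg_gt0 : 0 < lg. Proof. by []. Qed.
Lemma lt_nV : n < V. Proof. exact: trunc_log_ltn. Qed.
Lemma V_gt1 : 1 < V. Proof. by move: lt_nV; lia. Qed.
Lemma pW_gt0 : 0 < pW. Proof. by rewrite /pW; lia. Qed.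
Lemma pW_le : pW <= n. Proof. exact: geq_minr. Qed.
Lemma pq_gt0 : 0 < pq. Proof. by rewrite expn_gt0. Qed.
Lemma pv_gt0 : 0 < pv.
Proof.
rewrite /pv muln_gt0; apply/andP; split; last by rewrite expn_gt0.
rewrite muln_gt0; apply/andP; split; last by rewrite expn_gt0; apply/orP; left; exact: pq_gt0.
by rewrite !muln_gt0 /= (ltnW c12).
Qed.

Lemma nPq : ~~ Pq eps d (2 ^ lg).
Proof. by rewrite /Pq negb_and; apply/orP; right; rewrite -leqNgt; move: lt_nV dn; lia. Qed.
Lemma nPbet : ~~ Pbet d pv (2 ^ lg).
Proof. by rewrite /Pbet -leqNgt; have := leq_div d pv; move: lt_nV dn; lia. Qed.

Let V2 := V_gt1.
Lemma le_pow1 u : u <= V -> u <= V ^ 1. Proof. by rewrite expn1. Qed.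
Lemma lgV : lg <= V. Proof. exact: ltnW (ltn_expl _ _). Qed.
Lemma lg_pow : lg <= V ^ 1. Proof. exact: le_pow1 lgV. Qed.
Lemma d_pow : d <= V ^ 1. Proof. by apply: le_pow1; move: lt_nV dn; lia. Qed.
Lemma n_pow : n <= V ^ 1. Proof. by apply: le_pow1; exact: ltnW lt_nV. Qed.
Lemma pW_pow : pW <= V ^ 1. Proof. exact: leq_trans pW_le n_pow. Qed.
Lemma pqV : pq <= V.
Proof. by rewrite /pq leq_exp2l //; case: (dexpP nPq). Qed.
Lemma pq_pow : pq <= V ^ 1. Proof. exact: le_pow1 pqV. Qed.
Lemma c1_pow : c1 <= V ^ c1.
Proof. by apply: leq_trans (ltnW (ltn_expl c1 V2)) _. Qed.
Lemma k2 : 2 <= V ^ 1. Proof. exact: le_pow1. Qed.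
Lemma pm_pow : pm <= V ^ 14.
Proof.
apply: (mulp V2 (a := 13) _ pW_pow) => //; apply: (mulp V2 (a := 12) _ d_pow) => //.
apply: (mulp V2 (a := 11) _ lg_pow) => //.
apply: (mulp V2 (a := 5) (c := 6)) => //; exact: (constp V2).
Qed.
Lemma nPL : ~~ PL pm (2 ^ (lg * 14)).
Proof. by rewrite /PL -leqNgt expnM; exact: pm_pow. Qed.
Lemma pL_pow : pL <= V ^ 14.
Proof. by rewrite -expnM /pL leq_exp2l //; case: (dexpP nPL). Qed.
Lemma pv_pow : pv <= V ^ (c1 + 18).
Proof.
apply: (mulp V2 (a := c1 + 15) (c := 3)); [ | by rewrite leq_exp2r //; exact: lgV | lia].
apply: (mulp V2 (a := c1 + 13) (c := 2)); [ | by rewrite leq_exp2r //; exact: pqV | lia].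
apply: (mulp V2 (a := 13) (c := c1)); [ | exact: c1_pow | lia].
apply: (mulp V2 (a := 6) (c := 7)) => //; exact: (constp V2).
Qed.
(** Words of [(c1 + 40) * lg] bits hold all powers of [V] below [c1 + 40]; addresses and products
    are kept within these. *)
Lemma pow_lt_word e : e < c1 + 40 -> V ^ e < 2 ^ b.
Proof.
move=> h; rewrite -expnM ltn_exp2l //; apply: leq_trans kb; rewrite mulnC ltn_pmul2r //.
Qed.

Lemma pq_spec : (1 <= eps * pq%:R)%R \/ d < pq.
Proof.
have [_] := dexpP nPq; rewrite -/pq /Pq negb_and negbK => /orP[h|h] _; first by left.
by right; move: h; rewrite -leqNgt; lia.
Qed.
(** For the running time: [q] is below [2 / eps] unless it is 1. *)
Lemma pq_le : pq = 1 \/ (eps * pq%:R < 2)%R.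
Proof.
have [_ _] := dexpP nPq; rewrite /pq; case: (dexp _ _) => [|u] h; first by left.
right; have /andP[h1 _] := h u (ltnSn u).
have h1' : (eps * (2 ^ u)%:R < 1)%R by rewrite ltNge.
by rewrite expnS natrM mulrCA; move: (eps * _)%R h1' => z hz; lra.
Qed.
(** [bet] is not small either, so the number n / bet of samples is at most [2 * pv * n / d]. *)
Lemma pbet_lt : d < pv * (2 * pbet).
Proof.
have [_] := dexpP nPbet; rewrite -/pbet /Pbet -leqNgt => h _.
rewrite mulnC -ltn_divLR ?pv_gt0 //; move: h; lia.
Qed.
Lemma pbet_spec : pbet = 1 \/ pv * pbet <= d.
Proof.
have [_ _] := dexpP nPbet; rewrite /pbet; case: (dexp _ _) => [|u] h; first by left.
right; have := h u (ltnSn u); rewrite /Pbet mulnC -leq_divRL ?pv_gt0 // expnS mul2n -addnn; lia.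
Qed.
Lemma pm_gt0 : 0 < pm.
Proof. by rewrite /pm !muln_gt0 lg_gt0 d0 pW_gt0. Qed.
Lemma pL_ge : pm <= pL.
Proof. by have [_] := dexpP nPL; rewrite -/pL /PL -leqNgt. Qed.
Lemma pL_le : pL <= 2 * pm.
Proof.
have [_ _] := dexpP nPL; rewrite /pL; have := pm_gt0; case: (dexp _ _) => [|u] m0 h; first by rewrite expn0; lia.
by have := h u (ltnSn u); rewrite /PL expnS leq_mul2l => /ltnW ->.
Qed.
Lemma pbet_le : pbet <= pL.
Proof.
have mL := pL_ge; case: pbet_spec => [->|h]; first by rewrite expn_gt0.
have dm : d <= pm by rewrite /pm -mulnA mulnCA leq_pmulr // !muln_gt0 pW_gt0.
apply: leq_trans mL; apply: leq_trans dm; apply: leq_trans h; rewrite leq_pmull // pv_gt0 //.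
Qed.

Lemma pinst_wf : wf p.
Proof.
split; split => //.
- exact: pW_gt0.
- exact: leq_ltn_trans pW_le lt_nV.
- exact: pL_ge.
- by rewrite expn_gt0.
- by apply: dvdn_exp2l; rewrite -(leq_exp2l _ _ (isT : 1 < 2)); exact: pbet_le.
- exact: pq_gt0.
- exact: pbet_spec.
Qed.

Lemma pL_dvd : iL p %| 2 ^ b.
Proof.
apply: dvdn_exp2l; have [h _ _] := dexpP nPL; apply: leq_trans h _; apply: leq_trans kb.
by rewrite mulnC leq_mul2r; apply/orP; right; lia.
Qed.

Lemma iNc_pow : iNc p <= V ^ 1.
Proof. by apply: leq_trans n_pow; apply: leq_trans (leq_div _ _) _; rewrite /=; apply: leq_trans (geq_minl _ _) _; rewrite /n leq_addr. Qed.
Lemma iLB_pow : iLB p <= V ^ 14.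
Proof. by apply: leq_trans pL_pow; exact: leq_div. Qed.
Lemma ilam_pow : ilam p <= V ^ 9.
Proof. apply: (mulp V2 (a := 8) _ lg_pow) => //; exact: (constp V2). Qed.
Lemma iK_pow : iK p <= V ^ (c1 + 7).
Proof.
apply: (mulp V2 (a := c1 + 6) _ lg_pow); last by lia.
apply: (mulp V2 (a := 6) _ c1_pow); [exact: (constp V2) | lia].
Qed.
Lemma iZ_pow : iZ p <= V ^ 12.
Proof.
apply: (mulp V2 (a := 2) (c := 10)) => //; first exact: (mulp V2 k2 pW_pow).
by rewrite -addn1; apply: (addp V2 ilam_pow (c := 0)).
Qed.
Lemma iS_pow : iS p <= V ^ 3.
Proof. by apply: (addp V2 (a := 2) (c := 0)) => //; exact: (mulp V2 k2 pW_pow). Qed.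
Lemma iRS_pow : iRS p <= V ^ (c1 + 17).
Proof.
have a1 : 3 + iS p <= V ^ 4 by apply: (addp V2 (a := 2) _ iS_pow) => //; exact: (constp V2).
have a2 : 3 + iS p + iK p <= V ^ (c1 + 8) by apply: (addp V2 a1 iK_pow); lia.
have a3 : 4 * iLB p <= V ^ 16 by apply: (mulp V2 (a := 2) _ iLB_pow) => //; exact: (constp V2).
by apply: (addp V2 a2 a3); lia.
Qed.
Lemma iZ1_pow : 2 * iZ p + 1 <= V ^ 14.
Proof. by apply: (addp V2 (a := 13) (c := 0)) => //; exact: (mulp V2 k2 iZ_pow). Qed.
Lemma aRB_pow : aRB p <= V ^ (c1 + 19).
Proof.
have a1 : aTL p <= V ^ 15 by apply: (addp V2 (a := 6) _ iZ1_pow) => //; exact: (constp V2).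
have a2 : aBA p <= V ^ 16 by apply: (addp V2 a1 iZ1_pow).
have a3 : aBB p <= V ^ 17 by apply: (addp V2 a2 iNc_pow).
have a4 : ilam p * iK p <= V ^ (c1 + 16) by apply: (mulp V2 ilam_pow iK_pow); lia.
have a5 : aBD p <= V ^ (c1 + 18) by apply: (addp V2 a3 a4); lia.
have a6 : iNc p * iLB p <= V ^ 15 by apply: (mulp V2 iNc_pow iLB_pow).
by apply: (addp V2 a5 a6); lia.
Qed.

Lemma aTOP_lt : aTOP p < 2 ^ b.
Proof.
apply: (@leq_ltn_trans (V ^ (c1 + 26))); last by apply: pow_lt_word; lia.
have a1 : iNc p + 1 <= V ^ 2 by apply: (addp V2 iNc_pow (c := 0)).
have a2 : lg * (iNc p + 1) <= V ^ 3 by apply: (mulp V2 lg_pow a1).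
have a3 : lg * (iNc p + 1) + (iNc p + 1) <= V ^ 4 by apply: (addp V2 a2 a1).
have a4 : (lg * (iNc p + 1) + (iNc p + 1)) * iRS p <= V ^ (c1 + 21) by apply: (mulp V2 a3 iRS_pow); lia.
have a5 : aRB p + (lg * (iNc p + 1) + (iNc p + 1)) * iRS p <= V ^ (c1 + 22) by apply: (addp V2 aRB_pow a4); lia.
have a6 : aRB p + (lg * (iNc p + 1) + (iNc p + 1)) * iRS p + n <= V ^ (c1 + 23) by apply: (addp V2 a5 n_pow); lia.
have a7 : 4 * iZ p <= V ^ 14 by apply: (mulp V2 (a := 2) _ iZ_pow) => //; exact: (constp V2).
have a8 := addp V2 a6 a7 (e := c1 + 24); have a9 : aRB p + (lg * (iNc p + 1) + (iNc p + 1)) * iRS p + n + 4 * iZ p <= V ^ (c1 + 24) by apply: a8; lia.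
have a10 : aRB p + (lg * (iNc p + 1) + (iNc p + 1)) * iRS p + n + 4 * iZ p + pL <= V ^ (c1 + 25) by apply: (addp V2 a9 pL_pow); lia.
by apply: (addp V2 a10 d_pow); lia.
Qed.

Lemma HQ_lt : (2 * pq + 2) * (2 * d + 8 * n + 8) + n + 8 * pL < 2 ^ b.
Proof.
apply: (@leq_ltn_trans (V ^ 18)); last by apply: pow_lt_word; lia.
have a1 : 2 * pq + 2 <= V ^ 3 by apply: (addp V2 (a := 2) _ k2) => //; exact: (mulp V2 k2 pq_pow).
have k8 : 8 <= V ^ 3 by exact: (constp V2).
have a2 : 2 * d + 8 * n <= V ^ 5 by apply: (addp V2 (a := 2) (c := 4)) => //; [exact: (mulp V2 k2 d_pow) | exact: (mulp V2 k8 n_pow)].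
have a3 : 2 * d + 8 * n + 8 <= V ^ 6 by apply: (addp V2 a2 k8).
have a4 : (2 * pq + 2) * (2 * d + 8 * n + 8) <= V ^ 9 by apply: (mulp V2 a1 a3).
have a5 := addp V2 a4 n_pow (e := 10) isT isT.
by apply: (addp V2 a5 (c := 17)) => //; exact: (mulp V2 k8 pL_pow).
Qed.

Lemma pv_lt : pv < 2 ^ b.
Proof. by apply: leq_ltn_trans pv_pow _; apply: pow_lt_word; lia. Qed.
Lemma pm_lt : pm < 2 ^ b.
Proof. by apply: leq_ltn_trans pm_pow _; apply: pow_lt_word; lia. Qed.
Lemma V2_lt : 2 * V < 2 ^ b /\ 1024 < 2 ^ b.
Proof.
split; first by apply: (@leq_ltn_trans (V ^ 2)); [rewrite leq_mul2r V2 orbT | apply: pow_lt_word; lia].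
by apply: (@leq_ltn_trans (V ^ 10)); [exact: (constp V2) | apply: pow_lt_word; lia].
Qed.
Lemma PL_lt : 2 ^ (lg * 14) < 2 ^ b.
Proof. by rewrite expnM; apply: pow_lt_word; lia. Qed.

Local Notation runs := (runs b X Y eps).

Lemma lg_ok s : regs s 6 = n -> runs c_lg s (lg * 20 + 30) (fun s' => regs s' 7 = lg).
Proof.
move=> r6; have [B1 B2] := V2_lt; have nV := lt_nV.
apply: runs_le.
  apply: (@runs_set _ _ _ _ _ _ _ _ 1); first by rewrite /=; mds.
  apply: (@runs_set _ _ _ _ _ _ _ _ 0); first by rewrite /= mod0n.
  apply: (runs_weaken (runs_while (N := lg) (tb := 8) (Inv := fun k s' => regs s' 26 = 2 ^ k /\ regs s' 7 = k) _ _ _) (leqnn _)); first last.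
  - by move=> s' _ [].
  - move=> s' [r26 r7] [f1 _ _]; have r6' : regs s' 6 = n by rewrite f1.
    by rewrite /= r26 r6'; mds; rewrite ltnNge addn1 nV.
  - move=> k s' kl [r26 r7] [f1 _ _]; right; have r6' : regs s' 6 = n by rewrite f1.
    have kV : 2 ^ k <= n.
      have n0 : 0 < n by move: dn; lia.
      apply: leq_trans (trunc_logP (isT : 1 < 2) n0); rewrite leq_exp2l //.
    have kk : 2 ^ k.+1 = 2 ^ k + 2 ^ k by rewrite expnS mul2n addnn.
    have klt : k < 2 ^ k by exact: ltn_expl.
    split; first by rewrite /= r26 r6'; mds; rewrite addn1 ltnS kV.
    apply: (@runs_set _ _ _ _ _ _ _ _ (2 ^ k.+1)); first by rewrite /= r26 -kk; mds.
    by apply: (@runs_set1 _ _ _ _ _ _ _ _ k.+1); first by rewrite /= r7; mds; rewrite addn1.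
  - by [].
by rewrite /=; lia.
Qed.

Lemma qbl_ok s : regs s 2 = d -> regs s 3 = w -> regs s 6 = n -> regs s 7 = lg ->
  runs (c_qbl c1) s (lg * 300 + 300) (fun s' =>
    [/\ regs s' 8 = pW, regs s' 9 = pq, regs s' 10 = pbet & regs s' 11 = pL]).
Proof.
move=> r2 r3 r6 r7; have [B1 B2] := V2_lt; have nV := lt_nV; have vlt := pv_lt; have mlt := pm_lt.
have dn' := dn; have lg0 : 0 < lg by [].
have [a aE] : exists a, a = 64 * 128 * c1 by exists (64 * 128 * c1).
have [a2 a2E] : exists a2, a2 = 32 * 64 by exists (32 * 64).
have pvE : pv = a * pq * pq * lg * lg * lg.
  by rewrite /pv -aE -(mulnn pq) (expnS lg 2) -(mulnn lg) !mulnA.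
have pmE : pm = a2 * lg * d * pW by rewrite /pm a2E.
have W0 := pW_gt0; have d0' := d0; have q0 := pq_gt0.
have u5 : a * pq * pq * lg * lg <= pv by rewrite pvE leq_pmulr.
have u4 : a * pq * pq * lg <= pv by apply: leq_trans u5; rewrite leq_pmulr.
have u3 : a * pq * pq <= pv by apply: leq_trans u4; rewrite leq_pmulr.
have u2 : a * pq <= pv by apply: leq_trans u3; rewrite leq_pmulr.
have u1 : a <= pv by apply: leq_trans u2; rewrite leq_pmulr.
have m3 : a2 * lg * d <= pm by rewrite pmE leq_pmulr.
have m2 : a2 * lg <= pm by apply: leq_trans m3; rewrite leq_pmulr.
have m1 : a2 <= pm by apply: leq_trans m2; rewrite leq_pmulr.
apply: runs_le.
  apply: (runs_min (v1 := w) (v2 := n)); [by rewrite /= r3 | by rewrite /= r6 | rewrite -/pW].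
  apply: (@runs_set _ _ _ _ _ _ _ _ 1); first by rewrite /=; mds.
  apply: (runs_seqw (t1 := lg * 14 + 9 + 1) (Q1 := fun s' => regs s' 9 = pq)).
    apply: (dbl_ok (P := Pq eps d) (N := lg)) => //; [by lia | | exact: nPq].
    move=> s' v fr r9 v0 vV.
    have r2' : regs s' 2 = d by rewrite fr.
    rewrite /= r9 r2'; mds; rewrite /Pq; case: (1 <= eps * v%:R)%R => /=; first by case: (v < d + 1).
    by case: (v < d + 1).
  move=> s1 [f1 _ _] r9.
  have r7' : regs s1 7 = lg by rewrite f1 //= r7.
  have r2' : regs s1 2 = d by rewrite f1 //= r2.
  have r8' : regs s1 8 = pW by rewrite f1.
  apply: (@runs_set _ _ _ _ _ _ _ _ pv).
    rewrite /= r9 r7' -aE (modn_small (leq_ltn_trans u1 vlt)) (modn_small (leq_ltn_trans u2 vlt)).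
    rewrite (modn_small (leq_ltn_trans u3 vlt)) (modn_small (leq_ltn_trans u4 vlt)).
    by rewrite (modn_small (leq_ltn_trans u5 vlt)) -pvE modn_small.
  apply: (@runs_set _ _ _ _ _ _ _ _ 1); first by rewrite /=; mds.
  apply: (runs_seqw (t1 := lg * 14 + 9 + 1) (Q1 := fun s' => regs s' 10 = pbet)).
    apply: (dbl_ok (P := Pbet d pv) (N := lg)) => //; [by lia | | exact: nPbet].
    move=> s' v fr r10 v0 vV.
    have r2'' : regs s' 2 = d by rewrite fr //= r2'.
    have r27 : regs s' 27 = pv by rewrite fr.
    have := leq_div d pv => dd.
    by rewrite /= r10 r2'' r27; mds.
  move=> s2 [f2 _ _] r10.
  have r7'' : regs s2 7 = lg by rewrite f2 //= r7'.
  have r2'' : regs s2 2 = d by rewrite f2 //= r2'.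
  have r8'' : regs s2 8 = pW by rewrite f2 //= r8'.
  have r9'' : regs s2 9 = pq by rewrite f2 //= r9.
  apply: (@runs_set _ _ _ _ _ _ _ _ pm).
    rewrite /= r7'' r2'' r8'' -a2E (modn_small (leq_ltn_trans m1 mlt)) (modn_small (leq_ltn_trans m2 mlt)).
    by rewrite (modn_small (leq_ltn_trans m3 mlt)) -pmE modn_small.
  apply: (@runs_set _ _ _ _ _ _ _ _ 1); first by rewrite /=; mds.
  apply: (runs_weaken (t := lg * 14 * 8 + 3 + 1) (Q := fun s' => regs s' 11 = pL) _ (leqnn _)).
    apply: (dbl_ok (P := PL pm) (N := lg * 14)) => //; [exact: PL_lt | | exact: nPL].
    move=> s' v fr r11 v0 vV.
    have r28 : regs s' 28 = pm by rewrite fr.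
    by rewrite /= r11 r28.
  move=> s3 [f3 _ _] r11; split=> //.
  - by rewrite f3 //= r8''.
  - by rewrite f3 //= r9''.
  - by rewrite f3 //= r10.
by rewrite /=; lia.
Qed.

(** [glob] lives in [Type]; the existential turns it into a proposition. *)
Lemma derive_ok s : regs s 0 = size X -> regs s 1 = size Y -> regs s 7 = lg ->
  regs s 8 = pW -> regs s 9 = pq -> regs s 10 = pbet -> regs s 11 = pL ->
  runs (c_derive c1) s 200 (fun s' => (exists _ : glob p s', True) /\ regs s' 40 = iM p).
Proof.
move=> r0 r1 r7 r8 r9 r10 r11; have [B1 B2] := V2_lt; have HB := aTOP_lt.
have [[w1 w2 w3 w4] [w5 w6 w7 w8]] := bnd HB; have lg0 : 0 < lg by [].
have W0 := pW_gt0.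
have eK : iK p = 64 * c1 * lg by []. have et : itau p = c1 * lg by [].
have el : ilam p = 224 * lg by []. have eZ : iZ p = 2 * pW * (ilam p).+1 by [].
have eZ' : iZ p = 2 * pW * (ilam p + 1) by rewrite eZ addn1.
have eRS : iRS p = 3 + iS p + iK p + 4 * iLB p by [].
have eM : iM p = iNc p + (ilam p * iK p + iNc p * iLB p) by [].
have eS : iS p = 2 * pW + 1 by [].
have eTL : aTL p = 64 + (2 * iZ p + 1) by [].
have eBA : aBA p = aTL p + (2 * iZ p + 1) by [].
have eBB : aBB p = aBA p + iNc p by [].
have eBD : aBD p = aBB p + ilam p * iK p by [].
have eRB : aRB p = aBD p + iNc p * iLB p by [].
have lZ : (ilam p).+1 <= iZ p by rewrite eZ leq_pmull //; lia.
have cK : 64 * c1 <= iK p by rewrite eK leq_pmulr.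
have tK : itau p <= iK p by rewrite eK et -mulnA leq_pmull.
apply: runs_le.
  apply: (@runs_set _ _ _ _ _ _ _ _ (iLB p)); first by rewrite /= r10 r11.
  apply: (runs_min (v1 := size X) (v2 := size Y)); [by rewrite /= r0 | by rewrite /= r1 | ].
  apply: (@runs_set _ _ _ _ _ _ _ _ (iNc p)); first by rewrite /= r11.
  apply: (@runs_set _ _ _ _ _ _ _ _ (iK p)); first by rewrite /= r7 eK; mds.
  apply: (@runs_set _ _ _ _ _ _ _ _ (itau p)); first by rewrite /= r7 et; mds.
  apply: (@runs_set _ _ _ _ _ _ _ _ (ilam p)); first by rewrite /= r7 el; mds.
  apply: (@runs_set _ _ _ _ _ _ _ _ (iZ p)); first by rewrite /= r8 eZ'; mds.
  apply: (@runs_set _ _ _ _ _ _ _ _ (iS p)); first by rewrite /= r8 eS; mds.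
  apply: (@runs_set _ _ _ _ _ _ _ _ (iRS p)); first by rewrite /= eRS; mds.
  apply: (@runs_set _ _ _ _ _ _ _ _ 64); first by rewrite /=; mds.
  apply: (@runs_set _ _ _ _ _ _ _ _ (aTL p)); first by rewrite /= eTL; mds.
  apply: (@runs_set _ _ _ _ _ _ _ _ (aBA p)); first by rewrite /= eBA; mds.
  apply: (@runs_set _ _ _ _ _ _ _ _ (aBB p)); first by rewrite /= eBB; mds.
  apply: (@runs_set _ _ _ _ _ _ _ _ (aBD p)); first by rewrite /= eBD; mds.
  apply: (@runs_set _ _ _ _ _ _ _ _ (aRB p)); first by rewrite /= eRB; mds.
  apply: (@runs_set1 _ _ _ _ _ _ _ _ (iM p)); first by rewrite /=; lia.
  by split=> //; unshelve eexists => //; rewrite /glob /=; repeat split => //=.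
by rewrite /=.
Qed.

Definition t_pre := lg * 320 + 900 + iM p * 30 + t_levels p.

Lemma pre_ok (tp : seq nat) : iM p <= size tp ->
  runs (pre c1) (State (nth 0 [:: size X; size Y; d; w]) (fun=> 0) tp) t_pre (fun s' =>
    recs p (nth 0 (take (iM p) tp)) (fun _ _ => True) (memory s') /\
    (exists _ : glob p (State (memory s') (memory s') [::]), True)).
Proof.
move=> tpM; have [B1 B2] := V2_lt; have HB := aTOP_lt; have nV := lt_nV; have dn' := dn.
have [[w1 w2 w3 w4] [w5 w6 w7 w8]] := bnd HB.
apply: runs_le.
  apply: (@runs_set _ _ _ _ _ _ _ _ n); first by rewrite /=; mds.
  apply: (runs_ifb (v := true) (t2 := 0)); [by rewrite /= dn' | move=> _ | by []].
  apply: (runs_seqw (lg_ok _)) => // s1 [f1 t1 m1] r7.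
  apply: (runs_seqw (qbl_ok _ _ _ r7)); [by rewrite f1 | by rewrite f1 | by rewrite f1 |].
  move=> s2 [f2 t2 m2] [r8 r9 r10 r11].
  apply: (runs_seqw (derive_ok _ _ _ r8 r9 r10 r11)); [by rewrite f2 // f1 | by rewrite f2 // f1 | by rewrite f2 |].
  move=> s3 [f3 t3 m3] [[g3 _] r40].
  have tp3 : tape s3 = tp by rewrite t3 // t2 // t1.
  have r22 : regs s3 22 = aBA p by rewrite g3.
  have tpM3 : iM p <= size (tape s3) by rewrite tp3.
  have AM : aBA p + iM p < 2 ^ b by lia.
  have b2 : 1 < 2 ^ b by lia.
  apply: (runs_seqw (rand_ok eps X Y r40 r22 tpM3 AM b2)) => s4 [f4 _ _] [h4 h4'].
  have b26 : 26 < 2 ^ b by lia.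
  apply: (runs_seqw (save_ok eps X Y s4 b26)) => s5 _ [h5 e5 h5'].
  have g4 : glob p s4 by apply: (glob_fr f4).
  have g5 : glob p s5 by rewrite /glob e5; exact: g4.
  have mR : memR p (nth 0 (take (iM p) tp)) (memory s5).
    by move=> i iM; rewrite nth_take // h5' ?h4 ?tp3 //; lia.
  apply: (runs_weaken (levels_ok eps pinst_wf HB lt_nV g5 mR) (leqnn _)) => s6 _ [rc lo]; split=> //.
  have lo' r : 6 <= r < 26 -> memory s6 r = regs s4 r.
    by move=> hr; rewrite lo ?h5 // /aTM; lia.
  by unshelve eexists => //; rewrite /glob /= !lo' //; exact: g4.
by rewrite /t_pre /=; lia.
Qed.

End Inst.

Lemma pre_small (R : realType) b (eps : R) c1 X Y d w tp : size X + size Y <= d -> size X + size Y < 2 ^ b ->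
  runs b X Y eps (pre c1) (State (nth 0 [:: size X; size Y; d; w]) (fun=> 0) tp) 20 (fun=> True).
Proof.
move=> nd nb; apply: runs_le.
  apply: (@runs_set _ _ _ _ _ _ _ _ (size X + size Y)); first by rewrite /= modn_small.
  apply: (runs_ifb (v := false) (t1 := 0)); [by rewrite /= ltnNge nd | by [] | move=> _].
  exact: runs_skip.
by [].
Qed.

(** * Running times *)

Section Time.
Variables (R : realType) (b : nat) (eps : R) (c1 : nat) (X Y : seq nat) (d w : nat).
Let n := size X + size Y.
Let lg := logn2 n.
Hypothesis c12 : 1 < c1.
Hypothesis dn : d < n.
Hypothesis d0 : 0 < d.
Hypothesis w0 : 0 < w.
Hypothesis kb : (c1 + 40) * lg <= b.
Local Notation p := (pinst eps c1 X Y d w).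
Local Notation W := (pW X Y w).
Local Notation G := (2 * c1 * lg).
Local Notation Nc := (iNc p).
Local Notation LB := (iLB p).

Lemma G_gt1 : 1 < G.
Proof. by apply: (@leq_trans (2 * c1)); [move: c12; lia | rewrite leq_pmulr]. Qed.
Lemma W_gt0 : 0 < W. Proof. exact: (pW_gt0 c12 dn d0 w0 kb). Qed.
Lemma dW_gt0 : 0 < d * W. Proof. by rewrite muln_gt0 d0 W_gt0. Qed.

Lemma g_lg : lg <= G ^ 1. Proof. by rewrite expn1 leq_pmull //; move: c12; lia. Qed.
Lemma g_c1 : c1 <= G ^ 1.
Proof. by rewrite expn1; apply: (@leq_trans (2 * c1)); [lia | rewrite leq_pmulr]. Qed.
Lemma g_lam : ilam p <= G ^ 9.
Proof. by apply: (mulp G_gt1 (a := 8) _ g_lg) => //; exact: (constp G_gt1). Qed.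
Lemma g_K : iK p <= G ^ 8.
Proof.
apply: (mulp G_gt1 (a := 7) _ g_lg) => //; apply: (mulp G_gt1 (a := 6) _ g_c1) => //; exact: (constp G_gt1).
Qed.
Lemma g_tau : itau p <= G ^ 2.
Proof. exact: (mulp G_gt1 g_c1 g_lg). Qed.
Lemma g_K40 c : c <= 2 ^ 8 -> iK p * 40 + c <= G ^ 15.
Proof.
move=> hc; apply: (addp G_gt1 (a := 14) (c := 8)) => //; last exact: (constp G_gt1 hc).
by apply: (mulp G_gt1 g_K (c := 6)) => //; exact: (constp G_gt1).
Qed.
Lemma g_L : iL p <= G ^ 13 * (d * W).
Proof.
apply: leq_trans (pL_le c12 dn d0 w0 kb) _.
have h : 32 * 64 * lg <= G ^ 12.
  apply: (mulp G_gt1 (a := 11) _ g_lg) => //; apply: (mulp G_gt1 (a := 5) (c := 6)) => //; exact: (constp G_gt1).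
have -> : pm X Y d w = 32 * 64 * lg * (d * W) by rewrite mulnA.
rewrite expnS -[G * _ * _]mulnA; apply: leq_mul; first exact: G_gt1.
by apply: leq_mul.
Qed.

Lemma Jn_le : Jn p <= lg.
Proof.
rewrite leqNgt; apply/negP; rewrite lt_Jn => h.
have h2 : Nc <= minn (size X) (size Y) by exact: leq_div.
by have := lt_nV X Y; rewrite -/n -/lg; lia.
Qed.

(** Exponents of [G = 2 * c1 * lg] are tallied without optimisation; the factor [d * W] comes from
    [iL]. *)
Lemma t_qry_le : t_qry p <= G ^ 59 * (d * W).
Proof.
have hH : iH p <= G ^ 17 * (d * W).
  rewrite /iH mulnC; apply: (mul_pow G_gt1 g_L (c := 4)) => //.
  by apply: (mulp G_gt1 (a := 2) _ g_tau) => //; exact: (constp G_gt1).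
have a1 : 2 * ilam p <= G ^ 10 by apply: (mulp G_gt1 (a := 1) _ g_lam) => //; exact: (constp G_gt1).
have a2 : 2 * ilam p + 1 <= G ^ 11 by apply: (addp G_gt1 a1 (c := 0)).
have a3 : iK p * (2 * ilam p + 1) <= G ^ 19 by apply: (mulp G_gt1 g_K a2).
have a4 : iK p * (2 * ilam p + 1) * iH p <= G ^ 36 * (d * W) by rewrite mulnC; apply: (mul_pow G_gt1 hH a3).
have a5 : 2 * iL p <= G ^ 14 * (d * W) by rewrite mulnC; apply: (mul_pow G_gt1 g_L (c := 1)) => //; exact: (constp G_gt1).
have a6 : tl p <= G ^ 37 * (d * W) by apply: (add_pow G_gt1 a4 a5).
have a7 : tl p * (iK p * 40 + 180) <= G ^ 52 * (d * W) by apply: (mul_pow G_gt1 a6 (g_K40 _)).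
have a8 : t_pass p <= G ^ 53 * (d * W).
  by apply: (add_pow G_gt1 a7 (c := 9)) => //; apply: (unit_pow G_gt1 dW_gt0 (a := 9)) => //; exact: (constp G_gt1).
have a9 : t_pass p + 60 <= G ^ 54 * (d * W).
  by apply: (add_pow G_gt1 a8 (c := 9)) => //; apply: (unit_pow G_gt1 dW_gt0 (a := 6)) => //; exact: (constp G_gt1).
have a10 : Jn p * (t_pass p + 60) <= G ^ 55 * (d * W).
  by rewrite mulnC; apply: (mul_pow G_gt1 a9 (c := 1)) => //; exact: leq_trans Jn_le g_lg.
have a11 : Jn p * (t_pass p + 60) + 20 <= G ^ 56 * (d * W).
  by apply: (add_pow G_gt1 a10 (c := 9)) => //; apply: (unit_pow G_gt1 dW_gt0 (a := 6)) => //; exact: (constp G_gt1).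
have a12 : 2 * (Jn p * (t_pass p + 60) + 20) <= G ^ 57 * (d * W).
  by rewrite mulnC; apply: (mul_pow G_gt1 a11 (c := 1)) => //; exact: (constp G_gt1).
have a13 : 6 * iL p <= G ^ 16 * (d * W) by rewrite mulnC; apply: (mul_pow G_gt1 g_L (c := 3)) => //; exact: (constp G_gt1).
have a14 : 6 * iL p * 60 <= G ^ 22 * (d * W) by apply: (mul_pow G_gt1 a13 (c := 6)) => //; exact: (constp G_gt1).
have a15 := add_pow G_gt1 a12 a14 (e := 58) isT isT.
by apply: (add_pow G_gt1 a15 (c := 9)) => //; apply: (unit_pow G_gt1 dW_gt0 (a := 9)) => //; exact: (constp G_gt1).
Qed.

Lemma t_pre_le : t_pre eps c1 X Y d w <= G ^ 59 * (1 + Nc * (W + LB)).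
Proof.
have [U UE] : exists U, U = W + LB by exists (W + LB).
have U0 : 0 < U by rewrite UE; have := W_gt0; lia.
have cU c e : c <= 2 ^ e -> c <= G ^ e * U by move=> h; apply: (unit_pow G_gt1 U0 (a := e)) => //; exact: (constp G_gt1).
have hW : W <= G ^ 0 * U by rewrite expn0 mul1n UE leq_addr.
have hLB : LB <= G ^ 0 * U by rewrite expn0 mul1n UE leq_addl.
have k2 : 2 <= G ^ 1 by exact: (constp G_gt1).
have b1 : 2 * W <= G ^ 1 * U by rewrite mulnC; apply: (mul_pow G_gt1 hW k2).
have bS : iS p <= G ^ 2 * U by apply: (add_pow G_gt1 b1 (cU 1 0 _)).
have bl : (ilam p).+1 <= G ^ 10 by rewrite -addn1; apply: (addp G_gt1 g_lam (c := 0)).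
have bZ : iZ p <= G ^ 11 * U by apply: (mul_pow G_gt1 b1 bl).
have bZ2 : 2 * iZ p <= G ^ 12 * U by rewrite mulnC; apply: (mul_pow G_gt1 bZ k2).
have bZ3 : 2 * iZ p + 1 <= G ^ 13 * U by apply: (add_pow G_gt1 bZ2 (cU 1 0 _)).
have bK : iK p * 40 <= G ^ 14 * U.
  by apply: (unit_pow G_gt1 U0 (a := 14)) => //; apply: (mulp G_gt1 g_K (c := 6)) => //; exact: (constp G_gt1).
have k6 c : c <= 2 ^ 6 -> c <= G ^ 6 by exact: (constp G_gt1).
have e1 : iS p * (iK p * 40 + 70) <= G ^ 17 * U by apply: (mul_pow G_gt1 bS (g_K40 _)).
have e2 := add_pow G_gt1 e1 bK (e := 18) isT isT.
have e3 : (2 * iZ p + 1) * 60 <= G ^ 19 * U by apply: (mul_pow G_gt1 bZ3 (k6 60 _)).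
have e4 := add_pow G_gt1 e2 e3 (e := 20) isT isT.
have e5 := add_pow G_gt1 e4 (cU 100 7 isT) (e := 21) isT isT.
have e6 := mul_pow G_gt1 e5 g_lam (e := 30) isT; rewrite mulnC in e6.
have e7 : (2 * iZ p + 1) * 20 <= G ^ 19 * U by apply: (mul_pow G_gt1 bZ3 (k6 20 _)).
have e8 := add_pow G_gt1 e6 e7 (e := 31) isT isT.
have eT : t_tests p <= G ^ 32 * U by apply: (add_pow G_gt1 e8 (cU 60 6 isT)).
have f1 : iS p * 210 <= G ^ 10 * U by apply: (mul_pow G_gt1 bS (c := 8)) => //; exact: (constp G_gt1).
have f2 := add_pow G_gt1 f1 eT (e := 33) isT isT.
have f3 : 4 * LB <= G ^ 2 * U by rewrite mulnC; apply: (mul_pow G_gt1 hLB (c := 2)) => //; exact: (constp G_gt1).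
have f4 : 4 * LB * (iK p * 40 + 90) <= G ^ 17 * U by apply: (mul_pow G_gt1 f3 (g_K40 _)).
have f5 := add_pow G_gt1 f2 f4 (e := 34) isT isT.
have f6 : t_chunk p <= G ^ 35 * U by apply: (add_pow G_gt1 f5 (cU 300 9 isT)).
have f7 : t_chunk p + 60 <= G ^ 36 * U by apply: (add_pow G_gt1 f6 (cU 60 6 isT)).
rewrite -UE; have [U' U'E] : exists U', U' = 1 + Nc * U by exists (1 + Nc * U).
have U'0 : 0 < U' by rewrite U'E.
have cU' c e : c <= 2 ^ e -> c <= G ^ e * U' by move=> h; apply: (unit_pow G_gt1 U'0 (a := e)) => //; exact: (constp G_gt1).
have h1 : Nc * (t_chunk p + 60) <= G ^ 36 * U'.
  apply: (@leq_trans (Nc * (G ^ 36 * U))); first by rewrite leq_mul2l f7 orbT.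
  by rewrite mulnCA leq_mul2l U'E leq_addl orbT.
have h2 := add_pow G_gt1 h1 (cU' 60 6 isT) (e := 37) isT isT.
have h3 := mul_pow G_gt1 h2 g_lg (e := 38) isT; rewrite mulnC in h3.
have h4 : t_levels p <= G ^ 39 * U' by apply: (add_pow G_gt1 h3 (cU' 30 5 isT)).
have i1 : Nc <= G ^ 0 * U' by rewrite expn0 mul1n U'E; apply: leq_trans (leq_addl _ _); rewrite leq_pmulr.
have i2 : Nc * LB <= G ^ 0 * U'.
  by rewrite expn0 mul1n U'E; apply: leq_trans (leq_addl _ _); rewrite leq_mul2l UE leq_addl orbT.
have i3 : ilam p * iK p <= G ^ 17 * U' by apply: (unit_pow G_gt1 U'0 (a := 17)) => //; apply: (mulp G_gt1 g_lam g_K).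
have i4 := add_pow G_gt1 i3 i2 (e := 18) isT isT.
have i5 : iM p <= G ^ 19 * U' by apply: (add_pow G_gt1 i1 i4).
have i6 : iM p * 30 <= G ^ 24 * U' by apply: (mul_pow G_gt1 i5 (c := 5)) => //; exact: (constp G_gt1).
have j1 : lg * 320 <= G ^ 10 * U'.
  by apply: (unit_pow G_gt1 U'0 (a := 10)) => //; apply: (mulp G_gt1 g_lg (c := 9)) => //; exact: (constp G_gt1).
have j2 := add_pow G_gt1 j1 (cU' 900 10 isT) (e := 11) isT isT.
have j3 := add_pow G_gt1 j2 i6 (e := 25) isT isT.
rewrite -U'E; apply: (add_pow G_gt1 j3 h4) => //.
Qed.

(** [L >= d * W] pays for the shifts of a chunk, [d < 2 * pv * bet] for its samples, and
    [Nc * L <= n]. *)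
Lemma chunks_le : Nc * (W + LB) * d <= n * (1 + 2 * pv eps c1 X Y d).
Proof.
have NL : Nc * iL p <= n by apply: leq_trans (leq_divM _ _) _; rewrite /=; apply: leq_trans (geq_minl _ _) _; rewrite leq_addr.
have LBb : LB * ibet p = iL p.
  by rewrite /iLB divnK //; case: (pinst_wf eps c12 dn d0 w0 kb) => _ [].
have h1 : Nc * W * d <= n.
  apply: leq_trans NL; rewrite -mulnA leq_mul2l; apply/orP; right.
  apply: leq_trans (pL_ge c12 dn d0 w0 kb); rewrite /pm -mulnA [W * d]mulnC leq_pmull //.
have h2 : Nc * LB * d <= n * (2 * pv eps c1 X Y d).
  have := ltnW (pbet_lt eps c12 dn d0 w0 kb); move=> h.
  apply: leq_trans (leq_mul (leqnn (Nc * LB)) h) _.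
  rewrite (_ : Nc * LB * _ = Nc * (LB * ibet p) * (2 * pv eps c1 X Y d)); last by rewrite /=; lia.
  by rewrite LBb leq_mul2r NL orbT.
by rewrite mulnDr mulnDl mulnDr muln1; exact: leq_add.
Qed.

End Time.

Lemma time_small k c1 d w l : 0 < d -> 0 < w -> 0 < l -> k <= 100 ->
  k <= (100 + (2 * c1) ^ 59) * (d * w) * l ^ 62.
Proof.
move=> d0 w0 l0 /leq_trans; apply; apply: (@leq_trans (100 + (2 * c1) ^ 59)); first exact: leq_addr.
by rewrite -mulnA leq_pmulr // 2!muln_gt0 d0 w0 /= expn_gt0 l0.
Qed.

Lemma time_large c1 d w W l : W <= w -> 0 < l ->
  (2 * c1 * l) ^ 59 * (d * W) <= (100 + (2 * c1) ^ 59) * (d * w) * l ^ 62.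
Proof.
move=> Ww l0; rewrite expnMn -mulnA [l ^ 59 * _]mulnC mulnA; apply: leq_mul.
  by apply: leq_mul; [exact: leq_addl | rewrite leq_mul2l Ww orbT].
by apply: leq_pexp2l.
Qed.


Local Open Scope ring_scope.

(** [pv] contains [q ^ 2], and [(eps * q) ^ 2 <= 4 + eps0 ^ 2]: either [eps * q < 2], or [q = 1] and
    [eps <= eps0] takes over. The factor [lg ^ 3] of [pv] raises the exponent from 59 to 62. *)
Lemma t_pre_real (R : realType) (b : nat) (eps eps0 : R) (c1 : nat) (X Y : seq nat) (d w : nat) :
  let n := (size X + size Y)%N in
  let D := eps0 ^+ 2 + (4 + eps0 ^+ 2) * (2 * (64 * 128 * c1)%N%:R) in
  (1 < c1)%N -> (d < n)%N -> (0 < d)%N -> (0 < w)%N -> ((c1 + 40) * logn2 n <= b)%N -> 0 < eps -> eps <= eps0 ->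
  (t_pre eps c1 X Y d w)%:R <=
  (2 * c1)%N%:R ^+ 59 * (1 + D) * (1 + n%:R / (eps ^+ 2 * d%:R)) * (logn2 n)%:R ^+ 62.
Proof.
move=> n D c12 dn d0 w0 kb e0 ee.
have tp := t_pre_le eps c12 dn d0 w0 kb; have ch := chunks_le eps c12 dn d0 w0 kb.
set A := (iNc _ * (_ + _))%N in tp ch.
set lg := logn2 n in tp *; set l : R := lg%:R; set q : R := (pq eps X Y d)%:R.
set C : R := (64 * 128 * c1)%N%:R; set x := n%:R / (eps ^+ 2 * d%:R).
have dR : 0 < d%:R :> R by rewrite ltr0n.
have C0 : 0 <= C by exact: ler0n.
have x0 : 0 <= x.
  by apply: divr_ge0; [exact: ler0n | apply: mulr_ge0; [apply: exprn_ge0; exact: ltW | exact: ler0n]].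
have l1 : 1 <= l by rewrite ler1n.
have l31 : 1 <= l ^+ 3 by rewrite exprn_ege1.
have e2 : eps ^+ 2 <= eps0 ^+ 2 by rewrite lerXn2r // nnegrE ltW // (lt_le_trans e0 ee).
have e20 : 0 <= eps0 ^+ 2 by exact: le_trans (ltW (exprn_gt0 2 e0)) e2.
have eq2 : (eps * q) ^+ 2 <= 4 + eps0 ^+ 2.
  case: (pq_le eps c12 dn d0 w0 kb) => [q1|q2].
    by rewrite /q q1 mulr1; lra.
  have q0 : 0 <= eps * q by rewrite mulr_ge0 // ?ltW // ler0n.
  have : (eps * q) ^+ 2 <= 2 ^+ 2 by rewrite lerXn2r // ?nnegrE // ltW.
  by lra.
have D0 : 0 <= D.
  apply: addr_ge0 => //; apply: mulr_ge0; first by apply: addr_ge0.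
  by apply: mulr_ge0.
have hA : A%:R <= x * (D * l ^+ 3).
  have h1 : A%:R * d%:R <= n%:R * (1 + 2 * (C * q ^+ 2 * l ^+ 3)).
    have pvR : (pv eps c1 X Y d)%:R = C * q ^+ 2 * l ^+ 3.
      rewrite /pv (natrM _ (64 * 128 * c1 * pq eps X Y d ^ 2)%N) (natrM _ (64 * 128 * c1)%N).
      by rewrite (natrX _ (pq _ _ _ _)) (natrX _ (logn2 _)).
    have -> : 1 + 2 * (C * q ^+ 2 * l ^+ 3) = (1 + 2 * pv eps c1 X Y d)%N%:R :> R.
      by rewrite natrD (natrM _ 2) pvR.
    by rewrite -!natrM ler_nat; exact: ch.
  have h2 : A%:R <= n%:R * (1 + 2 * (C * q ^+ 2 * l ^+ 3)) / d%:R by rewrite ler_pdivlMr.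
  apply: le_trans h2 _.
  have -> : n%:R * (1 + 2 * (C * q ^+ 2 * l ^+ 3)) / d%:R = x * (eps ^+ 2 + 2 * (C * l ^+ 3) * (eps * q) ^+ 2).
    by rewrite /x; field; rewrite !lt0r_neq0.
  apply: ler_wpM2l => //.
  have h3 : C * l ^+ 3 * (eps * q) ^+ 2 <= C * l ^+ 3 * (4 + eps0 ^+ 2).
    by apply: ler_wpM2l => //; apply: mulr_ge0 => //; exact: le_trans ler01 l31.
  have h4 : eps0 ^+ 2 <= eps0 ^+ 2 * l ^+ 3 by rewrite ler_peMr.
  have -> : D * l ^+ 3 = eps0 ^+ 2 * l ^+ 3 + 2 * (C * l ^+ 3 * (4 + eps0 ^+ 2)) by rewrite /D -/C; ring.
  by rewrite -mulrA; apply: lerD; [exact: le_trans e2 h4 | rewrite ler_pM2l].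
have hA1 : 1 + A%:R <= (1 + D) * (1 + x) * l ^+ 3.
  have a1 : 0 <= x * l ^+ 3 by apply: mulr_ge0 => //; exact: le_trans ler01 l31.
  have a2 : 0 <= D * l ^+ 3 by apply: mulr_ge0 => //; exact: le_trans ler01 l31.
  have -> : (1 + D) * (1 + x) * l ^+ 3 = l ^+ 3 + x * l ^+ 3 + D * l ^+ 3 + x * (D * l ^+ 3) by ring.
  by move: (x * (D * l ^+ 3)) (x * l ^+ 3) (D * l ^+ 3) (l ^+ 3) hA a1 a2 l31 => y1 y2 y3 y4 *; lra.
have : (t_pre eps c1 X Y d w)%:R <= ((2 * c1 * lg) ^ 59 * (1 + A))%N%:R :> R by rewrite ler_nat.
move=> /le_trans; apply; rewrite natrM natrX natrM exprMn -/l natrD.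
set P := _ ^+ 59.
have P0 : 0 <= P by rewrite exprn_ge0 // ler0n.
have l59 : 0 <= l ^+ 59 by rewrite exprn_ge0 // ler0n.
rewrite (_ : 62 = 59 + 3)%N // exprD.
have -> : P * (1 + D) * (1 + x) * (l ^+ 59 * l ^+ 3) = P * l ^+ 59 * ((1 + D) * (1 + x) * l ^+ 3) by ring.
by apply: ler_wpM2l; [exact: mulr_ge0 | ].
Qed.

(** The tape is as long as the time bound, while the bad event concerns a prefix of it. *)
Lemma Pw_take (R : realType) B (B0 : (0 < B)%N) m1 m2 (E : seq nat -> bool) :
  Pw R B (m1 + m2) (fun l => E (take m1 l)) <= Pw R B m1 E.
Proof.
apply: (@Pw_group R B B0 0 m1 m2 _ (fun _ => E)) => // l1 l2 l3 /size0nil -> s2 /=.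
by rewrite take_size_cat.
Qed.

Lemma uniform_Pr_all (R : realType) (Omega : finType) (E : Omega -> Prop) :
  (0 < #|Omega|)%N -> (forall o, E o) -> uniform_Pr R E = 1.
Proof.
move=> O0 h; rewrite /uniform_Pr (_ : [set o | `[< E o >]] = [set: Omega])%SET.
  by rewrite cardsT divff // pnatr_eq0 -lt0n.
by apply/setP => o; rewrite !inE; apply/asboolP.
Qed.

Theorem theorem8 (R : realType) (c : nat) :
  exists (pre qry : cmd) (kappa k : nat) (Cq : R),
    rand_free qry /\
    forall eps0 : R, 0 < eps0 ->
    exists Cp : R,
    forall (b : nat) (X Y : seq nat) (d w : nat) (eps : R),
      let n := (size X + size Y)%N in
      (kappa * logn2 n <= b)%N ->
      input_fits b X Y d w ->
      (0 < d)%N -> (0 < w)%N -> 0 < eps -> eps <= eps0 ->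
      exists T : nat,
        [/\ T%:R <= Cp * (1 + n%:R / (eps ^+ 2 * d%:R)) * (logn2 n)%:R ^+ k,
            forall omega : T.-tuple 'I_(2 ^ b),
              exists (t : nat) (s : state),
                exec b X Y eps pre (pre_state X Y d w omega) t s /\ (t <= T)%N
          & 1 - (n%:R ^+ c)^-1 <=
            uniform_Pr R (fun omega : T.-tuple 'I_(2 ^ b) =>
              exists (t : nat) (s : state),
                exec b X Y eps pre (pre_state X Y d w omega) t s /\
                answers_all_queries b X Y d w eps qry
                  (Cq * (d * w)%:R * (logn2 n)%:R ^+ k) (memory s))].
Proof.
(* The additional 14 pays for the union bound over [2 ^ (14 * lg)] events. *)
have [c1 c1E] : exists c1, c1 = (c + 14)%N by exists (c + 14)%N.
have c12 : (1 < c1)%N by rewrite c1E; lia.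
exists (pre c1), qry, (c1 + 40)%N, 62%N, ((100 + (2 * c1) ^ 59)%N%:R).
split; first exact: qry_rand_free.
move=> eps0 e00.
pose D := eps0 ^+ 2 + (4 + eps0 ^+ 2) * (2 * (64 * 128 * c1)%N%:R).
have D0 : 0 <= D by rewrite addr_ge0 ?mulr_ge0 ?addr_ge0 ?exprn_ge0 ?(ltW e00) ?ler0n.
set P := (2 * c1)%N%:R ^+ 59 * (1 + D).
have P0 : 0 <= P.
  by apply: mulr_ge0; [apply: exprn_ge0; exact: ler0n | apply: addr_ge0; [exact: ler01 | exact: D0]].
(* The 20 covers the case [n <= d], where the preprocessing stops at once. *)
exists (20 + P) => b X Y d w eps n kb [nb db wb _] d0 w0 e0 ee.
set x := n%:R / (eps ^+ 2 * d%:R).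
have x0 : 0 <= x.
  by apply: divr_ge0; [exact: ler0n | apply: mulr_ge0; [apply: exprn_ge0; exact: ltW | exact: ler0n]].
have l1 : 1 <= (logn2 n)%:R ^+ 62 :> R by rewrite exprn_ege1 // ler1n.
have B0 : (0 < 2 ^ b)%N by rewrite expn_gt0.
have qb (t : nat) : (t <= (100 + (2 * c1) ^ 59) * (d * w) * logn2 n ^ 62)%N ->
    t%:R <= (100 + (2 * c1) ^ 59)%N%:R * (d * w)%:R * (logn2 n)%:R ^+ 62 :> R.
  by move=> h; rewrite -natrX -!natrM ler_nat.
have [nd|dn] := leqP n d.
  have ps := pre_small eps c1 w _ nd nb.
  exists 20%N; split.
  - apply: (@le_trans _ _ ((20 + P) * (1 + x))); last by rewrite ler_peMr ?mulr_ge0 ?addr_ge0.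
    by have := mulr_ge0 P0 x0; move: P x P0 x0 => u v u0 v0 uv; lra.
  - by move=> omega; have [t [s [ex tl _]]] := ps [seq val v | v <- omega]; exists t, s.
  - rewrite uniform_Pr_all; first by rewrite lerBlDr lerDl invr_ge0 exprn_ge0 ?ler0n.
      by rewrite card_tuple card_ord expn_gt0 B0.
    move=> omega; have [t [s [ex tl _]]] := ps [seq val v | v <- omega]; exists t, s; split=> //.
    move=> x' y hx hy hxy; have [t' [s' [ex' tl' ap]]] := qry_small w (memory s) hx hy nd nb e0.
    by exists t', s'; split=> //; apply: qb; exact: time_small.
pose p := pinst eps c1 X Y d w.
have wfp : wf p := pinst_wf eps c12 dn d0 w0 kb.
have HB : (aTOP p < 2 ^ b)%N := aTOP_lt eps c12 dn d0 w0 kb.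
have HQ := HQ_lt eps c12 dn d0 w0 kb.
have LB2 : (iL p %| 2 ^ b)%N := pL_dvd eps c12 dn d0 w0 kb.
have nlg : (size (iX p) + size (iY p) < 2 ^ ilg p)%N := lt_nV X Y.
have ZB : (2 * iZ p < 2 ^ b)%N.
  by have [[w1 w2 w3 w4] _] := bnd HB; move: HB w3 w4; lia.
have po tp := @pre_ok R b eps c1 X Y d w c12 dn d0 w0 kb tp.
have MT : (iM p <= t_pre eps c1 X Y d w)%N by rewrite /t_pre -/p; lia.
exists (t_pre eps c1 X Y d w); split.
- apply: le_trans (t_pre_real c12 dn d0 w0 kb e0 ee) _; rewrite -/D -/P -/x.
  apply: ler_wpM2r; first exact: le_trans ler01 l1.
  by apply: ler_wpM2r; [rewrite addr_ge0 | rewrite lerDr].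
- move=> omega; have [|t [s [ex tl _]]] := po [seq val v | v <- omega]; last by exists t, s.
  by rewrite size_map size_tuple.
apply: le_trans (uniform_PrE R B0 (E := fun l => exists (t : nat) (s : state),
  exec b X Y eps (pre c1) (State (nth 0%N [:: size X; size Y; d; w]) (fun=> 0%N) l) t s /\
  answers_all_queries b X Y d w eps qry
    ((100 + (2 * c1) ^ 59)%N%:R * (d * w)%:R * (logn2 n)%:R ^+ 62) (memory s))
  (Tb := fun l => bad p (take (iM p) l)) _).
  rewrite lerD2l lerN2 -(subnKC MT).
  apply: le_trans (Pw_take R B0 _ _ _) _; apply: le_trans (P_bad R wfp LB2 ZB nlg) _.
  have n0 : (0 < n)%N by exact: leq_ltn_trans dn.
  (* What remains is [2 ^- (c * lg)], at most [n ^- c] since [n < 2 ^ lg]. *)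
  rewrite /= -/n c1E mulnDl exprD invfM natrX mulrCA mulfV ?expf_neq0 ?pnatr_eq0 // mulr1.
  rewrite lef_pV2 ?posrE ?exprn_gt0 ?ltr0n // mulnC exprM lerXn2r ?nnegrE ?exprn_ge0 ?ler0n //.
  by rewrite -natrX ler_nat ltnW.
move=> l sl _ nbad; have sz : (iM p <= size l)%N by rewrite sl.
have [t [s [ex tl [rc [G _]]]]] := po l sz; exists t, s; split=> // x' y hx hy hxy.
have gd k j : (2 ^ j %| k)%N -> valid p k (2 ^ j) -> good p (nth 0%N (take (iM p) l)) k (2 ^ j).
  by move=> _ v; exact: (notbad_good wfp LB2 ZB nlg nbad v).
have [h1 h2] : (x' <= y + iW p)%N /\ (y <= x' + iW p)%N.
  by move: hxy; rewrite ler_norml /= /pW => /andP[]; lia.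
have [t' [s' [ex' tl' ap]]] := qry_ok wfp HB HQ nlg dn rc gd hx hy h1 h2 w e0 (pq_spec eps c12 dn d0 w0 kb) G.
exists t', s'; split=> //; apply: qb; apply: leq_trans tl' _.
by apply: leq_trans (t_qry_le eps c12 dn d0 w0 kb) _; apply: time_large => //; exact: geq_minl.
Qed.
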